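(* Let $x>0$. **Case 1.** Fix $r\in\mathbb{N}$ with $r\ge2$. Then for any $t\in\mathbb{N}\cup\{0\}$, $s+t=1$ is a singular point of $\Theta(r,s,t,x)$, with the following polar singularity structure in $s$, around $s=1-t$: $$\begin{aligned}\Theta(r,s,t,x)=\;&\frac{x^{-t}\zeta(r)}{s-(1-t)}+\Bigg(\gamma\,\zeta(r)x^{-t}+(-1)^r\sum_{j=0}^{t-2}\binom{j+r-1}{j}\frac{(-1)^{t-j}}{(t-j-1)!}\frac{1}{x^{j+r}}\sum_{m=1}^{\infty}\frac{\psi^{(t-j-1)}(mx+1)}{m^{r+j-t+1}}\\&+\sum_{i=1}^{r-2}\frac{(-1)^i}{x^{t+i}}\binom{i+t-1}{i}\zeta(i+1)\zeta(r-i)-\frac{(-1)^r}{x^{r+t-1}}\binom{r+t-2}{t-1}\sum_{m=1}^{\infty}\frac{\gamma+\psi(mx+1)}{m^{r}}\Bigg)+O_x(|s-(1-t)|).\end{aligned}$$ **Case 2.** Let $r=1$. Then for any $t\in\mathbb{N}$, $s+t=1$ is a singular point of $\Theta(1,s,t,x)$, with the following polar singularity structure in $s$, around $s=1-t$: $$\begin{aligned}\Theta(1,s,t,x)=\;&\frac{x^{-t}}{(s-(1-t))^2}+\frac{x^{-t}}{s-(1-t)}\big(\gamma+\log(x)+H_{t-1}\big)+\Bigg(\frac{1}{x^{t}}\Big(\gamma\big(\gamma+\log(x)+H_{t-1}\big)+\gamma_1\Big)\\&-\sum_{j=0}^{t-2}\frac{(-1)^{t-j}x^{-j-1}}{(t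-j-1)!}\sum_{m=1}^{\infty}\frac{\psi^{(t-j-1)}(mx)+(-1)^{t-j}(t-j-2)!\,(mx)^{-(t-j-1)}}{m^{j-t+2}}\\&+\frac{t\,\zeta(2)}{x^{t+1}}+\frac{1}{x^t}\sum_{m=1}^{\infty}\frac{\psi(mx)-\log(mx)}{m}\Bigg)+O_x(|s-(1-t)|).\end{aligned}$$
   Context: $\mathbb{N}=\{1,2,3,\dots\}$. For $x>0$ the generalized Mordell-Tornheim zeta function is $$\Theta(r,s,t,x)=\sum_{n=1}^{\infty}\sum_{m=1}^{\infty}\frac{1}{n^{r}m^{s}(n+mx)^{t}},$$ absolutely convergent for $(r,s,t)\in\mathbb{C}^3$ with $\Re(r+t)>1$, $\Re(s+t)>1$, $\Re(r+s+t)>2$, and continued meromorphically to $\mathbb{C}^3$; for fixed $r,t$ as in the claim it is regarded as a function of $s$ via this continuation. $\zeta$ is the Riemann zeta function, $\gamma$ Euler's constant, and $\gamma_1$ the first Stieltjes constant, normalized by $\zeta(z)=\frac{1}{z-1}+\gamma-\gamma_1(z-1)+O(|z-1|^2)$. $\psi=\Gamma'/\Gamma$ is the digamma function, $\psi^{(j)}$ its $j$-th derivative, and $H_n=\sum_{j=1}^n1/j$ is the $n$-th harmonic number with $H_0=0$. Conventions: $\binom{-1}{0}=1$, $\binom{c}{-1}=0$ for every $c\in\mathbb{Z}\setminus\{-1\}$, and $\binom{-1}{-1}=1$; $\binom{a}{b}=0$ for integers $0\le a<b$; empty sums are $0$. ''Around $s=1-t$'' means as $s\to 1-t$ with $r,t,x$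 fixed; $O_x$ indicates that the implied constant may depend on $x$.
   Formalization: In Case 2 with t≥2 two signs are corrected: γ+log(x)+H_{t-1} becomes γ+log(x)−H_{t-1} (residue and constant term), and the term (-1)^{t-j}(t-j-2)!(mx)^{-(t-j-1)} in the inner series is subtracted, since with + the series diverges (t=2: Σ(ψ'(mx)+1/(mx))). *)

(* Defs.v *)
(* Stdlib reals with Coquelicot. *)
From Stdlib Require Import Reals ZArith List.
From Coquelicot Require Import Coquelicot.
Open Scope R_scope.

(** * Holomorphic and meromorphic functions *)

(* Points of C^3 are written [(r, s, t)]. *)
Definition C3 : NormedModule C_AbsRing :=
  prod_NormedModule C_AbsRing
    (prod_NormedModule C_AbsRing C_NormedModule C_NormedModule) C_NormedModule.

(* Complex Frechet differentiability at every point of [U]. *)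
Definition holomorphic_on {V : NormedModule C_AbsRing}
    (U : V -> Prop) (f : V -> C_NormedModule) : Prop :=
  forall p : V, U p -> ex_filterdiff f (locally p).

(* [F = g / h] on the open set [U], with [g], [h] holomorphic and [h] not
   identically zero on any nonempty open subset of [U].  The values of [F] on the
   zero set of [h] are left unconstrained. *)
Definition quotient_on {V : NormedModule C_AbsRing}
    (F : V -> C) (U : V -> Prop) (g h : V -> C_NormedModule) : Prop :=
  open U /\ holomorphic_on U g /\ holomorphic_on U h /\
  (forall p : V, U p -> ~ locally p (fun q => h q = RtoC 0)) /\
  (forall p : V, U p -> h p <> RtoC 0 -> F p = (g p / h p)%C).

Definition meromorphic {V : NormedModule C_AbsRing} (F : V -> C) : Prop :=
  forall p : V, exists (U : V -> Prop) (g h : V -> C_NormedModule),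
    U p /\ quotient_on F U g h.

(* [f] is the restriction of the meromorphic function [F] to the complex line
   [s |-> (r, s, t)]: near each point of the line, [F = g / h] where [h] does not
   vanish identically on the line, and [f] is that quotient. *)
Definition is_restriction (F : C3 -> C) (r t : C) (f : C -> C) : Prop :=
  forall s0 : C, exists (U : C3 -> Prop) (g h : C3 -> C_NormedModule),
    U (r, s0, t) /\ quotient_on F U g h /\
    ~ locally (s0 : C_NormedModule) (fun s : C => h (r, s, t) = RtoC 0) /\
    (forall s : C, U (r, s, t) -> h (r, s, t) <> RtoC 0 ->
       f s = (g (r, s, t) / h (r, s, t))%C).

(* [f] does not extend holomorphically across [s0]. *)
Definition singular_point (f : C -> C) (s0 : C) : Prop :=
  ~ exists (U : C_NormedModule -> Prop) (k : C_NormedModule -> C_NormedModule),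
      open U /\ U s0 /\ holomorphic_on U k /\
      (forall s : C, U s -> s <> s0 -> f s = k s).

(* [f s = O (|s - s0| ^ n)] as [s] tends to [s0], [s <> s0]. *)
Definition bigO_at (s0 : C) (n : nat) (f : C -> C) : Prop :=
  exists K d : R, 0 < d /\
    forall s : C, 0 < Cmod (s - s0) < d -> Cmod (f s) <= K * Cmod (s - s0) ^ n.

(** * Zeta functions *)

Definition cexp (z : C) : C :=
  (exp (Re z) * cos (Im z), exp (Re z) * sin (Im z)).

(* [a ^ z] for [a > 0]. *)
Definition cpow (a : R) (z : C) : C := cexp (z * RtoC (ln a))%C.

Definition is_riemann_zeta (zeta : C -> C) : Prop :=
  (forall z : C, 1 < Re z ->
     @is_series C_AbsRing C_NormedModule
       (fun k => (/ cpow (INR (S k)) z)%C) (zeta z)) /\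
  holomorphic_on (fun z : C_NormedModule => z <> RtoC 1) zeta.

Definition mordell_tornheim_term (r s t : C) (x : R) (n m : nat) : C :=
  (/ (cpow (INR n) r * cpow (INR m) s * cpow (INR n + INR m * x) t))%C.

(* [l] is the sum over [n >= 1] of the sums over [m >= 1]. *)
Definition is_mordell_tornheim_sum (r s t : C) (x : R) (l : C) : Prop :=
  exists a : nat -> C,
    (forall n : nat, @is_series C_AbsRing C_NormedModule
       (fun m => mordell_tornheim_term r s t x (S n) (S m)) (a n)) /\
    @is_series C_AbsRing C_NormedModule a l.

(* [Theta] is the meromorphic continuation to C^3, for this [x], of the series. *)
Definition is_mordell_tornheim_zeta (x : R) (Theta : C3 -> C) : Prop :=
  meromorphic Theta /\
  forall r s t : C,
    1 < Re (r + t) -> 1 < Re (s + t) -> 2 < Re (r + s + t) ->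
    is_mordell_tornheim_sum r s t x (Theta (r, s, t)).

(** * Constants and special functions *)

Definition harmonic (n : nat) : R := sum_n_m (fun j => / INR j) 1 n.

Definition euler_gamma : R :=
  real (Lim_seq (fun n => harmonic n - ln (INR n))).

Definition is_stieltjes1 (zeta : C -> C) (gamma1 : R) : Prop :=
  bigO_at (RtoC 1) 2 (fun z =>
    zeta z - (/ (z - 1) + RtoC euler_gamma - RtoC gamma1 * (z - 1)))%C.

Definition Gamma (x : R) : R :=
  RInt_gen (fun u => Rpower u (x - 1) * exp (- u))
    (at_right 0) (Rbar_locally p_infty).

Definition digamma (x : R) : R := Derive Gamma x / Gamma x.

Definition polygamma (j : nat) (x : R) : R := Derive_n digamma j x.

(* Only [0 <= b <= a] is delegated to [Binomial.C], which is a quotient of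
   factorials with truncated subtraction and does not vanish for [a < b]. *)
Definition binZ (a b : Z) : R :=
  if (b =? -1)%Z then (if (a =? -1)%Z then 1 else 0)
  else if ((a =? -1) && (b =? 0))%Z%bool then 1
  else if ((0 <=? b) && (b <=? a))%Z%bool
       then Binomial.C (Z.to_nat a) (Z.to_nat b)
  else 0.

(* Sum over [a <= j <= b], empty when [b < a]; [b] may be negative. *)
Definition sum_range (a : nat) (b : Z) (f : nat -> C) : C :=
  fold_right Cplus (RtoC 0)
    (map f (seq a (Z.to_nat (b - Z.of_nat a + 1)))).

(* Sum over [m >= 1]. *)
Definition Series1 (f : nat -> R) : R := Series (fun k => f (S k)).

(** * Constant terms of the expansions at [s = 1 - t] *)

Definition const_r_ge2 (zeta : C -> C) (x : R) (r t : nat) : C :=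
  let zr := Z.of_nat r in
  let zt := Z.of_nat t in
  (RtoC euler_gamma * zeta (RtoC (INR r)%R) * RtoC (/ x ^ t)%R
   + RtoC ((-1) ^ r)%R *
     sum_range 0 (zt - 2) (fun j =>
       let zj := Z.of_nat j in
       RtoC (binZ (zj + zr - 1) zj
             * ((-1) ^ (t - j) / INR (fact (t - j - 1)))
             * (/ x ^ (j + r))
             * Series1 (fun m =>
                 polygamma (t - j - 1) (INR m * x + 1)
                 / powerRZ (INR m) (zr + zj - zt + 1)))%R)
   + sum_range 1 (zr - 2) (fun i =>
       let zi := Z.of_nat i in
       RtoC ((-1) ^ i / x ^ (t + i) * binZ (zi + zt - 1) zi)%R
       * zeta (RtoC (INR (i + 1))%R) * zeta (RtoC (INR (r - i))%R))
   - RtoC ((-1) ^ r / x ^ (r + t - 1) * binZ (zr + zt - 2) (zt - 1)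
           * Series1 (fun m =>
               (euler_gamma + digamma (INR m * x + 1)) / INR m ^ r))%R)%C.

(* As [y] tends to infinity, [polygamma k y] is equivalent to
   [(-1)^(k-1) (k-1)! / y^k], i.e. with [k = t - j - 1] to
   [(-1)^(t-j) (t-j-2)! / y^(t-j-1)]; it is this leading term that is subtracted
   in the inner series, which would diverge if it were added. *)
Definition const_r1 (zeta : C -> C) (gamma1 x : R) (t : nat) : C :=
  let zt := Z.of_nat t in
  (RtoC (/ x ^ t * (euler_gamma * (euler_gamma + ln x - harmonic (t - 1)) + gamma1))%R
   - sum_range 0 (zt - 2) (fun j =>
       RtoC ((-1) ^ (t - j) * (/ x ^ (j + 1)) / INR (fact (t - j - 1))
             * Series1 (fun m =>
                 (polygamma (t - j - 1) (INR m * x)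
                  - (-1) ^ (t - j) * INR (fact (t - j - 2))
                    / (INR m * x) ^ (t - j - 1))
                 / powerRZ (INR m) (Z.of_nat j - zt + 2)))%R)
   + RtoC (INR t / x ^ (t + 1))%R * zeta (RtoC 2)
   + RtoC (/ x ^ t * Series1 (fun m =>
         (digamma (INR m * x) - ln (INR m * x)) / INR m))%R)%C.

(* Main.v *)
(* Sum over [n] first.  With [F(y) = sum_n n^-r (n+y)^-t] the series is
   [sum_m m^-s F(m x)], and partial fractions express [F] through the digamma and
   polygamma functions, so that [m^t F(m x) = A + B ln m + O(m^(-1/2))] with [B = 0]
   for [r >= 2].  Hence, with [z = s + t], Theta agrees for large [Re s] with
   [A zeta(z) - B zeta'(z) + D(z)], where [D] is a Dirichlet series that converges for
   [Re z > 1/2]; its value at [z = 1] gives the digamma and polygamma sums.  The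
   identity theorem carries this equality to the neighbourhood of [z = 1]. *)
Require Import Defs.
From Stdlib Require Import Reals ZArith List Lra Lia Classical ClassicalEpsilon.
From Coquelicot Require Import Coquelicot.
Open Scope R_scope.

(** * Complex differentiability *)

(** The obstacle is that [Theta] is known only as some meromorphic function on C^3 that agrees with
    the double series where the latter converges. An identity theorem for quotients g / h is
    therefore needed; it rests on isolated zeros, these on Taylor remainders, and these on Cauchy's
    formula, which Goursat's lemma supplies. Cauchy's formula serves twice more: zeta' has to be
    holomorphic off 1 to be continued, and its expansion at 1 has to be deduced from the one that
    defines [gamma1]. [Gamma] is given by its integral and [digamma] by differentiating it.
    Convexity of ln Gamma and the functional equation yield the derivative and its series at once,
    with no differentiation under the integral. A logarithm arises for r = 1 only: the digamma term
    of the partial fractions carries (m x)^-(r+t-1), which is as large as the main term (m x)^-t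
    exactly when r = 1. The exponent 1/2 is a convenience: it absorbs factors ln m, and any exponent
    in (0, 1) would still make the half-plane of D a neighbourhood of z = 1. *)

Lemma Cmod_le_sum (z : C) : Cmod z <= Rabs (Re z) + Rabs (Im z).
Proof.
  destruct z as [a b]; simpl.
  replace (a, b) with (RtoC a + (0, b))%C
    by (unfold RtoC, Cplus; simpl; f_equal; ring).
  eapply Rle_trans; [apply Cmod_triangle|].
  rewrite Cmod_R. apply Rplus_le_compat_l.
  replace ((0, b) : C) with (Ci * RtoC b)%C
    by (unfold RtoC, Ci, Cmult; simpl; f_equal; ring).
  rewrite Cmod_mult, Cmod_Ci, Cmod_R; lra.
Qed.

Lemma Rabs_Im_le_Cmod (z : C) : Rabs (Im z) <= Cmod z.
Proof. eapply Rle_trans; [apply Rmax_r|apply (Rmax_Cmod z)]. Qed.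

Lemma Cmod_minus_sym (a b : C) : Cmod (a - b) = Cmod (b - a).
Proof. rewrite <- (Cmod_opp (a - b)). f_equal. ring. Qed.

Lemma Cmod_minus_0 (a b : C) : Cmod (a - b) = 0 -> a = b.
Proof. intros H. apply Cmod_eq_0 in H. now apply Ceq_minus. Qed.

Lemma Cmod_triangle_rev (a b : C) : Cmod a - Cmod b <= Cmod (a - b).
Proof.
  pose proof (Cmod_triangle (a - b) b) as H.
  replace (a - b + b)%C with a in H by ring. lra.
Qed.

Lemma Cmod_minus_gt_0 (a b : C) : a <> b -> 0 < Cmod (a - b).
Proof. intros H. apply Cmod_gt_0. now apply Cminus_eq_contra. Qed.

Lemma C_eq_of_eps (a b : C) : (forall e, 0 < e -> Cmod (a - b) <= e) -> a = b.
Proof.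
  intros H. apply Cmod_minus_0. apply Rle_antisym; [|apply Cmod_ge_0].
  apply le_epsilon. intros e He. specialize (H e He). lra.
Qed.

(** Discs for the modulus, in which all estimates are made. Coquelicot's [locally] on C uses
    squares; [locally_Cnear] and [Cnear_locally] compare the two. *)
Definition Cnear (z : C) (P : C -> Prop) : Prop :=
  exists d, 0 < d /\ forall w, Cmod (w - z) < d -> P w.

Lemma Cnear_and z P Q : Cnear z P -> Cnear z Q -> Cnear z (fun w => P w /\ Q w).
Proof.
  intros [d1 [H1 H2]] [d2 [H3 H4]]. exists (Rmin d1 d2). split.
  - now apply Rmin_pos.
  - intros w Hw. split; [apply H2|apply H4]; eapply Rlt_le_trans; try apply Hw;
      [apply Rmin_l|apply Rmin_r].
Qed.

Lemma Cnear_imp z (P Q : C -> Prop) : (forall w, P w -> Q w) -> Cnear z P -> Cnear z Q.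
Proof. intros H [d [H1 H2]]. exists d. auto. Qed.

Lemma Cnear_at z (P : C -> Prop) : Cnear z P -> P z.
Proof.
  intros [d [H1 H2]]. apply H2. replace (z - z)%C with (RtoC 0) by ring.
  now rewrite Cmod_0.
Qed.

Lemma Cnear_ball p r z : Cmod (z - p) < r -> Cnear z (fun w => Cmod (w - p) < r).
Proof.
  intros H. exists (r - Cmod (z - p)). split; [lra|]. intros w Hw.
  replace (w - p)%C with ((w - z) + (z - p))%C by ring.
  eapply Rle_lt_trans; [apply Cmod_triangle|]. lra.
Qed.

Lemma Cnear_neq p z : z <> p -> Cnear z (fun w => w <> p).
Proof.
  intros H. exists (Cmod (z - p)). split; [now apply Cmod_minus_gt_0|].
  intros w Hw E. subst w. rewrite Cmod_minus_sym in Hw. lra.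
Qed.

Definition Ccont (f : C -> C) (z : C) : Prop :=
  forall e, 0 < e -> Cnear z (fun w => Cmod (f w - f z) < e).

Lemma Ccont_const c z : Ccont (fun _ => c) z.
Proof.
  intros e He. exists 1. split; [lra|]. intros. replace (c - c)%C with (RtoC 0) by ring.
  now rewrite Cmod_0.
Qed.

Lemma Ccont_id z : Ccont (fun w => w) z.
Proof. intros e He. exists e. auto. Qed.

Lemma Ccont_plus f g z : Ccont f z -> Ccont g z -> Ccont (fun w => f w + g w)%C z.
Proof.
  intros Hf Hg e He.
  apply Cnear_imp with (2 := Cnear_and _ _ _ (Hf (e/2) ltac:(lra)) (Hg (e/2) ltac:(lra))).
  intros w [H1 H2].
  replace (f w + g w - (f z + g z))%C with ((f w - f z) + (g w - g z))%C by ring.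
  eapply Rle_lt_trans; [apply Cmod_triangle|]. lra.
Qed.

Lemma Ccont_mult f g z : Ccont f z -> Ccont g z -> Ccont (fun w => f w * g w)%C z.
Proof.
  intros Hf Hg e He.
  set (A := Cmod (f z) + Cmod (g z) + 1 + e).
  assert (HA : 0 < A) by (unfold A; pose proof (Cmod_ge_0 (f z)); pose proof (Cmod_ge_0 (g z)); lra).
  assert (Hq : 0 < e / (2 * A)) by (apply Rdiv_lt_0_compat; lra).
  apply Cnear_imp with (2 := Cnear_and _ _ _ (Hf _ Hq) (Cnear_and _ _ _ (Hg _ Hq) (Hf e He))).
  intros w [H1 [H2 H3]].
  replace (f w * g w - f z * g z)%C with (f w * (g w - g z) + (f w - f z) * g z)%C by ring.
  eapply Rle_lt_trans; [apply Cmod_triangle|]. rewrite !Cmod_mult.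
  assert (Cmod (f w) <= A).
  { pose proof (Cmod_triangle_rev (f w) (f z)). unfold A.
    pose proof (Cmod_ge_0 (g z)). lra. }
  assert (Cmod (g z) <= A - e).
  { unfold A. pose proof (Cmod_ge_0 (f z)). lra. }
  assert (Cmod (f w) * Cmod (g w - g z) <= A * (e / (2 * A))).
  { apply Rmult_le_compat; try apply Cmod_ge_0; lra. }
  assert (Cmod (f w - f z) * Cmod (g z) <= (e / (2 * A)) * (A - e)).
  { apply Rmult_le_compat; try apply Cmod_ge_0; lra. }
  assert (A * (e / (2 * A)) + (e / (2 * A)) * (A - e) < e); [|lra].
  replace (A * (e / (2 * A)) + (e / (2 * A)) * (A - e)) with (e - e * (e / (2 * A))) by (field; lra).
  pose proof (Rmult_lt_0_compat _ _ He Hq). lra.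
Qed.

Lemma Ccont_comp f g z : Ccont f z -> Ccont g (f z) -> Ccont (fun w => g (f w)) z.
Proof.
  intros Hf Hg e He. destruct (Hg e He) as [d [Hd H]].
  apply Cnear_imp with (2 := Hf d Hd). intros w Hw. now apply H.
Qed.

Lemma Ccont_inv z : z <> RtoC 0 -> Ccont Cinv z.
Proof.
  intros Hz e He. apply Cmod_gt_0 in Hz as Hm.
  set (m := Cmod z) in *.
  exists (Rmin (m / 2) (e * m * m / 2)). split.
  - apply Rmin_pos; [lra|]. apply Rdiv_lt_0_compat; [|lra].
    repeat apply Rmult_lt_0_compat; auto.
  - intros w Hw.
    assert (H1 : Cmod (w - z) < m / 2) by (eapply Rlt_le_trans; [apply Hw|apply Rmin_l]).
    assert (H2 : Cmod (w - z) < e * m * m / 2) by (eapply Rlt_le_trans; [apply Hw|apply Rmin_r]).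
    assert (H3 : m / 2 < Cmod w).
    { rewrite Cmod_minus_sym in H1. pose proof (Cmod_triangle_rev z w). unfold m in *. lra. }
    assert (Hw0 : w <> RtoC 0) by (apply Cmod_gt_0; lra).
    replace (/ w - / z)%C with ((z - w) / (w * z))%C by (field; auto).
    rewrite Cmod_div by (now apply Cmult_neq_0).
    rewrite Cmod_mult, Cmod_minus_sym. fold m.
    apply Rlt_div_l; [apply Rmult_lt_0_compat; lra|].
    eapply Rlt_le_trans; [apply H2|].
    assert (m / 2 * m <= Cmod w * m) by (apply Rmult_le_compat_r; lra).
    pose proof (Rmult_le_compat_l e _ _ (Rlt_le _ _ He) H). lra.
Qed.

Lemma Ccont_ext_near f g z : Cnear z (fun w => f w = g w) -> Ccont f z -> Ccont g z.
Proof.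
  intros H Hf e He. pose proof (Cnear_at _ _ H) as E.
  apply Cnear_imp with (2 := Cnear_and _ _ _ H (Hf e He)).
  intros w [H1 H2]. now rewrite <- H1, <- E.
Qed.

(* Caratheodory's form of differentiability: the calculus rules reduce to
   continuity rules and algebra. *)
Definition Cderiv (f : C -> C) (z l : C) : Prop :=
  exists phi : C -> C, Ccont phi z /\ phi z = l /\
    Cnear z (fun w => f w = f z + phi w * (w - z))%C.

(** Differentiability at the single point [z]; holomorphy near [z] is [Cnear z (Chol f)], or a
    hypothesis on a whole disc. *)
Definition Chol (f : C -> C) (z : C) : Prop := exists l, Cderiv f z l.

(** The Caratheodory slope is the difference quotient, completed by the value [l] at [z]. *)
Lemma Cderiv_eps f z l :
  (forall e, 0 < e -> Cnear z (fun w => Cmod (f w - f z - l * (w - z)) <= e * Cmod (w - z))) ->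
  Cderiv f z l.
Proof.
  intros H.
  exists (fun w => if excluded_middle_informative (w = z) then l else ((f w - f z) / (w - z))%C).
  split; [|split].
  - intros e He. apply Cnear_imp with (2 := H (e / 2) ltac:(lra)). intros w Hw.
    destruct (excluded_middle_informative (z = z)) as [_|N]; [|now destruct N].
    destruct (excluded_middle_informative (w = z)) as [E|E].
    + replace (l - l)%C with (RtoC 0) by ring. now rewrite Cmod_0.
    + pose proof (Cminus_eq_contra _ _ E) as E'.
      replace ((f w - f z) / (w - z) - l)%C with ((f w - f z - l * (w - z)) / (w - z))%C by (field; auto).
      rewrite Cmod_div by auto. apply Rlt_div_l; [now apply Cmod_gt_0|].
      apply Cmod_gt_0 in E'. eapply Rle_lt_trans; [apply Hw|].
      apply Rmult_lt_compat_r; lra.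
  - destruct (excluded_middle_informative (z = z)) as [_|N]; [easy|now destruct N].
  - exists 1. split; [lra|]. intros w _.
    destruct (excluded_middle_informative (w = z)) as [E|E].
    + subst w. ring.
    + pose proof (Cminus_eq_contra _ _ E) as E'. field. auto.
Qed.

Lemma Cderiv_bound f z l :
  Cderiv f z l ->
  forall e, 0 < e -> Cnear z (fun w => Cmod (f w - f z - l * (w - z)) <= e * Cmod (w - z)).
Proof.
  intros [phi [H1 [H2 H3]]] e He.
  apply Cnear_imp with (2 := Cnear_and _ _ _ H3 (H1 e He)). intros w [E H].
  rewrite E. replace (f z + phi w * (w - z) - f z - l * (w - z))%C
    with ((phi w - phi z) * (w - z))%C by (rewrite H2; ring).
  rewrite Cmod_mult. apply Rmult_le_compat_r; [apply Cmod_ge_0|lra].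
Qed.

(** A quadratic error bound survives termwise summation and integration over a parameter, so
    derivatives of series and of Cauchy integrals are all obtained through this criterion. *)
Lemma Cderiv_quad f z l M d :
  0 < d ->
  (forall w, Cmod (w - z) < d -> Cmod (f w - f z - l * (w - z)) <= M * (Cmod (w - z) * Cmod (w - z))) ->
  Cderiv f z l.
Proof.
  intros Hd H. apply Cderiv_eps. intros e He.
  pose proof (Rabs_pos M) as HM. pose proof (Rle_abs M) as HM2.
  exists (Rmin d (e / (Rabs M + 1))). split.
  - apply Rmin_pos; auto. apply Rdiv_lt_0_compat; lra.
  - intros w Hw. eapply Rle_trans; [apply H; eapply Rlt_le_trans; [apply Hw|apply Rmin_l]|].
    rewrite <- Rmult_assoc. apply Rmult_le_compat_r; [apply Cmod_ge_0|].
    assert (H1 : Cmod (w - z) < e / (Rabs M + 1)) by (eapply Rlt_le_trans; [apply Hw|apply Rmin_r]).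
    apply Rlt_div_r in H1; [|lra]. pose proof (Cmod_ge_0 (w - z)).
    apply Rle_trans with (Cmod (w - z) * (Rabs M + 1)); [|lra].
    rewrite Rmult_comm. apply Rmult_le_compat_l; lra.
Qed.

Lemma Cderiv_cont f z l : Cderiv f z l -> Ccont f z.
Proof.
  intros [phi [H1 [H2 H3]]].
  apply (Ccont_ext_near (fun w => f z + phi w * (w + - z))%C).
  - apply Cnear_imp with (2 := H3). intros w E. rewrite E. ring.
  - apply Ccont_plus; [apply Ccont_const|]. apply Ccont_mult; auto.
    apply Ccont_plus; [apply Ccont_id|apply Ccont_const].
Qed.

Lemma Chol_cont f z : Chol f z -> Ccont f z.
Proof. intros [l H]. now apply Cderiv_cont with l. Qed.

Lemma Cderiv_ext_near f g z l : Cnear z (fun w => f w = g w) -> Cderiv f z l -> Cderiv g z l.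
Proof.
  intros H [phi [H1 [H2 H3]]]. exists phi. split; [|split]; auto.
  pose proof (Cnear_at _ _ H) as E.
  apply Cnear_imp with (2 := Cnear_and _ _ _ H H3). intros w [E1 E2].
  now rewrite <- E1, <- E.
Qed.

Lemma Cderiv_const c z : Cderiv (fun _ => c) z 0.
Proof.
  exists (fun _ => RtoC 0). split; [apply Ccont_const|split; auto].
  exists 1. split; [lra|]. intros. ring.
Qed.

Lemma Cderiv_id z : Cderiv (fun w => w) z 1.
Proof.
  exists (fun _ => RtoC 1). split; [apply Ccont_const|split; auto].
  exists 1. split; [lra|]. intros. ring.
Qed.

Lemma Cderiv_plus f g z a b :
  Cderiv f z a -> Cderiv g z b -> Cderiv (fun w => f w + g w)%C z (a + b).
Proof.
  intros [p [H1 [H2 H3]]] [q [H4 [H5 H6]]].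
  exists (fun w => p w + q w)%C. split; [now apply Ccont_plus|split; [congruence|]].
  apply Cnear_imp with (2 := Cnear_and _ _ _ H3 H6). intros w [E1 E2].
  rewrite E1, E2. ring.
Qed.

Lemma Cderiv_mult f g z a b :
  Cderiv f z a -> Cderiv g z b -> Cderiv (fun w => f w * g w)%C z (a * g z + f z * b).
Proof.
  intros Hf Hg. pose proof (Cderiv_cont _ _ _ Hg) as Cg.
  destruct Hf as [p [H1 [H2 H3]]]. destruct Hg as [q [H4 [H5 H6]]].
  exists (fun w => p w * g w + f z * q w)%C. split; [|split; [congruence|]].
  - apply Ccont_plus; apply Ccont_mult; auto. apply Ccont_const.
  - apply Cnear_imp with (2 := Cnear_and _ _ _ H3 H6). intros w [E1 E2].
    rewrite E1, E2. ring.
Qed.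

Lemma Cderiv_scal c f z a : Cderiv f z a -> Cderiv (fun w => c * f w)%C z (c * a).
Proof.
  intros H. replace (c * a)%C with (0 * f z + c * a)%C by ring.
  apply (Cderiv_mult (fun _ => c)); auto. apply Cderiv_const.
Qed.

Lemma Cderiv_minus f g z a b :
  Cderiv f z a -> Cderiv g z b -> Cderiv (fun w => f w - g w)%C z (a - b).
Proof.
  intros Hf Hg. replace (a - b)%C with (a + (- (1)) * b)%C by ring.
  apply Cderiv_ext_near with (fun w => f w + (- (1)) * g w)%C.
  - exists 1. split; [lra|]. intros; ring.
  - apply Cderiv_plus; auto. now apply Cderiv_scal.
Qed.

Lemma Cderiv_comp f g z a b :
  Cderiv f z a -> Cderiv g (f z) b -> Cderiv (fun w => g (f w)) z (b * a).
Proof.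
  intros Hf [q [H4 [H5 H6]]]. pose proof (Cderiv_cont _ _ _ Hf) as Cf.
  destruct Hf as [p [H1 [H2 H3]]].
  exists (fun w => q (f w) * p w)%C. split; [|split; [congruence|]].
  - apply Ccont_mult; auto. now apply Ccont_comp.
  - destruct H6 as [d [Hd H6]].
    apply Cnear_imp with (2 := Cnear_and _ _ _ H3 (Cf d Hd)). intros w [E1 E2].
    rewrite (H6 (f w)) by auto. rewrite E1 at 2. ring.
Qed.

Lemma Cderiv_inv z : z <> RtoC 0 -> Cderiv Cinv z (- / (z * z)).
Proof.
  intros Hz. exists (fun w => - / z * / w)%C. split; [|split].
  - apply Ccont_mult; [apply Ccont_const|now apply Ccont_inv].
  - field. auto.
  - apply Cnear_imp with (2 := Cnear_neq _ _ Hz). intros w Hw. field. auto.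
Qed.

Lemma Chol_ext_near f g z : Cnear z (fun w => f w = g w) -> Chol f z -> Chol g z.
Proof. intros H [l Hl]. exists l. now apply Cderiv_ext_near with f. Qed.
Lemma Chol_const c z : Chol (fun _ => c) z.
Proof. eexists; apply Cderiv_const. Qed.
Lemma Chol_id z : Chol (fun w => w) z.
Proof. eexists; apply Cderiv_id. Qed.
Lemma Chol_plus f g z : Chol f z -> Chol g z -> Chol (fun w => f w + g w)%C z.
Proof. intros [a Ha] [b Hb]. eexists. now apply Cderiv_plus; eauto. Qed.
Lemma Chol_minus f g z : Chol f z -> Chol g z -> Chol (fun w => f w - g w)%C z.
Proof. intros [a Ha] [b Hb]. eexists. now apply Cderiv_minus; eauto. Qed.
Lemma Chol_mult f g z : Chol f z -> Chol g z -> Chol (fun w => f w * g w)%C z.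
Proof. intros [a Ha] [b Hb]. eexists. now apply Cderiv_mult; eauto. Qed.
Lemma Chol_comp f g z : Chol f z -> Chol g (f z) -> Chol (fun w => g (f w)) z.
Proof. intros [a Ha] [b Hb]. eexists. eapply (Cderiv_comp f g); eauto. Qed.
Lemma Chol_inv f z : Chol f z -> f z <> RtoC 0 -> Chol (fun w => / f w)%C z.
Proof. intros Hf H. apply (Chol_comp f Cinv); auto. eexists. now apply Cderiv_inv. Qed.
Lemma Chol_div f g z : Chol f z -> Chol g z -> g z <> RtoC 0 -> Chol (fun w => f w / g w)%C z.
Proof. intros Hf Hg H. apply Chol_mult; auto. now apply Chol_inv. Qed.

(** * The complex exponential *)

Lemma cexp_plus a b : cexp (a + b) = (cexp a * cexp b)%C.
Proof.
  destruct a as [a1 a2], b as [b1 b2]. unfold cexp, Cmult; simpl.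
  rewrite exp_plus, cos_plus, sin_plus. f_equal; ring.
Qed.

Lemma cexp_0 : cexp 0 = RtoC 1.
Proof. unfold cexp; simpl. rewrite exp_0, cos_0, sin_0. unfold RtoC. f_equal; ring. Qed.

Lemma Cmod_cexp z : Cmod (cexp z) = exp (Re z).
Proof.
  unfold cexp, Cmod; simpl.
  replace (exp (Re z) * cos (Im z) * (exp (Re z) * cos (Im z) * 1) +
     exp (Re z) * sin (Im z) * (exp (Re z) * sin (Im z) * 1))
    with ((exp (Re z))² * ((sin (Im z))² + (cos (Im z))²)) by (unfold Rsqr; ring).
  rewrite sin2_cos2, Rmult_1_r. apply sqrt_Rsqr. left. apply exp_pos.
Qed.

Lemma cexp_neq_0 z : cexp z <> RtoC 0.
Proof. apply Cmod_gt_0. rewrite Cmod_cexp. apply exp_pos. Qed.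

Lemma cexp_RtoC a : cexp (RtoC a) = RtoC (exp a).
Proof. unfold cexp; simpl. rewrite cos_0, sin_0. unfold RtoC. f_equal; ring. Qed.

Lemma exp_le_mono a b : a <= b -> exp a <= exp b.
Proof. intros [H|H]; [left; now apply exp_increasing|subst; lra]. Qed.

(** Both bounds come from exp u >= 1 + u, taken at u = a and at u = -a; the latter gives (1 - a) exp
    a <= 1. *)
Lemma exp_quad a : Rabs a <= 1/2 -> Rabs (exp a - 1 - a) <= 2 * (a * a).
Proof.
  intros H. apply Rabs_le_between in H.
  pose proof (exp_ineq1_le a) as H1.
  pose proof (exp_ineq1_le (-a)) as H2. rewrite exp_Ropp in H2.
  assert (H4 : (1 - a) * exp a <= 1).
  { apply Rmult_le_compat_r with (r := exp a) in H2; [|lra]. rewrite Rinv_l in H2; lra. }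
  rewrite Rabs_pos_eq by lra. nra.
Qed.

Lemma cos_quad b : Rabs (cos b - 1) <= b * b.
Proof.
  replace (cos b) with (1 - 2 * sin (b / 2) * sin (b / 2))
    by (rewrite <- cos_2a_sin; f_equal; field).
  replace (1 - 2 * sin (b/2) * sin (b/2) - 1) with (- (2 * (sin (b / 2))²)) by (unfold Rsqr; ring).
  rewrite Rabs_Ropp, Rabs_pos_eq by (pose proof (Rle_0_sqr (sin (b/2))); lra).
  assert ((sin (b/2))² <= (b/2)²).
  { apply Rsqr_le_abs_1. destruct (MVT_gen sin 0 (b/2) cos) as [c [_ H]].
    - intros. apply is_derive_Reals. apply derivable_pt_lim_sin.
    - intros. apply continuity_sin.
    - rewrite sin_0, !Rminus_0_r in H. rewrite H, Rabs_mult.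
      pose proof (COS_bound c). assert (Rabs (cos c) <= 1) by (apply Rabs_le; lra).
      pose proof (Rabs_pos (b/2)). nra. }
  unfold Rsqr in *. nra.
Qed.

Lemma sin_quad b : Rabs b <= 1 -> Rabs (sin b - b) <= b * b.
Proof.
  intros Hb. destruct (MVT_gen (fun x => sin x - x) 0 b (fun x => cos x - 1)) as [c [Hc H]].
  - intros. auto_derive; [easy|ring].
  - intros. reg.
  - rewrite sin_0, !Rminus_0_r in H. rewrite H, Rabs_mult.
    assert (Hcb : Rabs c <= Rabs b).
    { destruct (Rle_dec 0 b).
      - rewrite Rmin_left, Rmax_right in Hc by lra. rewrite !Rabs_pos_eq; lra.
      - rewrite Rmin_right, Rmax_left in Hc by lra. rewrite !Rabs_left1; lra. }
    pose proof (cos_quad c) as H1.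
    replace (c * c) with (Rabs c * Rabs c) in H1
      by (rewrite <- Rabs_mult; apply Rabs_pos_eq; nra).
    replace (b * b) with (Rabs b * Rabs b)
      by (rewrite <- Rabs_mult; apply Rabs_pos_eq; nra).
    pose proof (Rabs_pos c). pose proof (Rabs_pos b).
    apply Rmult_le_compat_r; auto. nra.
Qed.

(** The factor [exp (Cmod h)] makes the bound valid for every h: small h is settled by the real
    estimates, and for large h each of the three terms is dominated separately. The global form is
    what [dirichlet_deriv] needs, where h is a multiple of ln n. *)
Lemma cexp_quad h : Cmod (cexp h - 1 - h) <= 32 * (Cmod h * Cmod h) * exp (Cmod h).
Proof.
  pose proof (Cmod_ge_0 h) as Hh.
  destruct (Rle_dec (Cmod h) (1/2)) as [Hs|Hl].
  - assert (H1 : 1 <= exp (Cmod h)) by (rewrite <- exp_0; apply exp_le_mono; auto).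
    apply Rle_trans with (32 * (Cmod h * Cmod h) * 1); [|apply Rmult_le_compat_l; nra].
    pose proof (re_le_Cmod h) as Ha. pose proof (Rabs_Im_le_Cmod h) as Hb.
    eapply Rle_trans; [apply Cmod_le_sum|].
    destruct h as [a b]. set (m := Cmod (a, b)) in *.
    unfold cexp, Re, Im, Cminus, Cplus, Copp, RtoC in *; simpl in *.
    pose proof (exp_quad a ltac:(lra)) as E1. pose proof (cos_quad b) as E2.
    pose proof (sin_quad b ltac:(lra)) as E3.
    assert (Haa : a * a <= m * m).
    { replace (a * a) with (Rabs a * Rabs a) by (rewrite <- Rabs_mult; apply Rabs_pos_eq; nra).
      apply Rmult_le_compat; auto; apply Rabs_pos. }
    assert (Hbb : b * b <= m * m).
    { replace (b * b) with (Rabs b * Rabs b) by (rewrite <- Rabs_mult; apply Rabs_pos_eq; nra).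
      apply Rmult_le_compat; auto; apply Rabs_pos. }
    assert (E4 : Rabs (exp a - 1) <= 2 * m).
    { replace (exp a - 1) with ((exp a - 1 - a) + a) by ring.
      eapply Rle_trans; [apply Rabs_triang|]. nra. }
    assert (E5 : 0 < exp a <= 2).
    { split; [apply exp_pos|]. apply Rabs_le_between in E4. lra. }
    replace (exp a * cos b + - (1) + - a) with ((exp a - 1 - a) + exp a * (cos b - 1)) by ring.
    replace (exp a * sin b + - 0 + - b) with (exp a * (sin b - b) + (exp a - 1) * b) by ring.
    pose proof (Rabs_triang (exp a - 1 - a) (exp a * (cos b - 1))) as T1.
    pose proof (Rabs_triang (exp a * (sin b - b)) ((exp a - 1) * b)) as T2.
    rewrite Rabs_mult, (Rabs_pos_eq (exp a)) in T1, T2 by lra. rewrite (Rabs_mult (exp a - 1)) in T2.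
    assert (Rabs (exp a - 1) * Rabs b <= (2 * m) * m)
      by (apply Rmult_le_compat; try lra; apply Rabs_pos).
    nra.
  - assert (H0 : Cmod (cexp h) <= exp (Cmod h)).
    { rewrite Cmod_cexp. apply exp_le_mono. eapply Rle_trans; [apply Rle_abs|apply re_le_Cmod]. }
    pose proof (exp_ineq1_le (Cmod h)) as H1.
    assert (H2 : Cmod (cexp h - 1 - h) <= Cmod (cexp h) + 1 + Cmod h).
    { unfold Cminus. eapply Rle_trans; [apply Cmod_triangle|]. rewrite Cmod_opp.
      apply Rplus_le_compat_r. eapply Rle_trans; [apply Cmod_triangle|].
      rewrite Cmod_opp, Cmod_1. lra. }
    assert (1 <= 4 * (Cmod h * Cmod h)) by nra.
    assert (1 * exp (Cmod h) <= 4 * (Cmod h * Cmod h) * exp (Cmod h)).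
    { apply Rmult_le_compat_r; auto. left; apply exp_pos. }
    nra.
Qed.

Lemma Cderiv_cexp z : Cderiv cexp z (cexp z).
Proof.
  apply Cderiv_quad with (d := 1) (M := Cmod (cexp z) * (32 * exp 1)); [lra|].
  intros w Hw. replace w with (z + (w - z))%C at 1 by ring. rewrite cexp_plus.
  set (h := (w - z)%C) in *.
  replace (cexp z * cexp h - cexp z - cexp z * h)%C with (cexp z * (cexp h - 1 - h))%C by ring.
  rewrite Cmod_mult, Rmult_assoc. apply Rmult_le_compat_l; [apply Cmod_ge_0|].
  eapply Rle_trans; [apply cexp_quad|].
  assert (exp (Cmod h) <= exp 1) by (apply exp_le_mono; lra).
  replace (32 * exp 1 * (Cmod h * Cmod h)) with (32 * (Cmod h * Cmod h) * exp 1) by ring.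
  apply Rmult_le_compat_l; auto. nra.
Qed.

Lemma Chol_cexp z : Chol cexp z.
Proof. eexists; apply Cderiv_cexp. Qed.

(** * Goursat's lemma *)

Definition Rccont (g : R -> C) (t : R) : Prop :=
  forall e, 0 < e -> exists d, 0 < d /\ forall s, Rabs (s - t) < d -> Cmod (g s - g t) < e.

Lemma Rccont_Re g t : Rccont g t -> continuous (fun s => Re (g s)) t.
Proof.
  intros H. apply continuity_pt_filterlim. intros e He. destruct (H e He) as [d [Hd H1]].
  exists d. split; auto. intros s [_ Hs].
  eapply Rle_lt_trans; [|apply (H1 s Hs)].
  eapply Rle_trans; [|apply re_le_Cmod]. apply Req_le.
  change (Rabs (Re (g s) - Re (g t)) = Rabs (Re (g s - g t)%C)).
  unfold Cminus. rewrite re_plus, re_opp. reflexivity.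
Qed.

Lemma Rccont_Im g t : Rccont g t -> continuous (fun s => Im (g s)) t.
Proof.
  intros H. apply continuity_pt_filterlim. intros e He. destruct (H e He) as [d [Hd H1]].
  exists d. split; auto. intros s [_ Hs].
  eapply Rle_lt_trans; [|apply (H1 s Hs)].
  eapply Rle_trans; [|apply Rabs_Im_le_Cmod]. apply Req_le.
  change (Rabs (Im (g s) - Im (g t)) = Rabs (Im (g s - g t)%C)).
  unfold Cminus. rewrite im_plus, im_opp. reflexivity.
Qed.

Lemma Rccont_comp (f : C -> C) (g : R -> C) t :
  Rccont g t -> Ccont f (g t) -> Rccont (fun s => f (g s)) t.
Proof.
  intros Hg Hf e He. destruct (Hf e He) as [d [Hd H]]. destruct (Hg d Hd) as [d' [Hd' H']].
  exists d'. auto.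
Qed.

Lemma Rccont_comp2 (h : C -> C -> C) (f g : R -> C) t :
  Rccont f t -> Rccont g t ->
  (forall e, 0 < e -> exists d, 0 < d /\ forall a b, Cmod (a - f t) < d -> Cmod (b - g t) < d ->
     Cmod (h a b - h (f t) (g t)) < e) ->
  Rccont (fun s => h (f s) (g s)) t.
Proof.
  intros Hf Hg H e He. destruct (H e He) as [d [Hd H1]].
  destruct (Hf d Hd) as [d1 [Hd1 H2]]. destruct (Hg d Hd) as [d2 [Hd2 H3]].
  exists (Rmin d1 d2). split; [now apply Rmin_pos|]. intros s Hs.
  apply H1; [apply H2|apply H3]; eapply Rlt_le_trans; try apply Hs; [apply Rmin_l|apply Rmin_r].
Qed.

Lemma Rccont_const c t : Rccont (fun _ => c) t.
Proof.
  intros e He; exists 1; split; [lra|]; intros. replace (c - c)%C with (RtoC 0) by ring.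
  now rewrite Cmod_0.
Qed.

Lemma Rccont_plus f g t : Rccont f t -> Rccont g t -> Rccont (fun s => f s + g s)%C t.
Proof.
  intros Hf Hg. apply (Rccont_comp2 Cplus); auto. intros e He. exists (e / 2). split; [lra|].
  intros a b Ha Hb. replace (a + b - (f t + g t))%C with ((a - f t) + (b - g t))%C by ring.
  eapply Rle_lt_trans; [apply Cmod_triangle|]. lra.
Qed.

Lemma Rccont_mult f g t : Rccont f t -> Rccont g t -> Rccont (fun s => f s * g s)%C t.
Proof.
  intros Hf Hg. apply (Rccont_comp2 Cmult); auto. intros e He.
  set (A := Cmod (f t) + Cmod (g t) + 1).
  assert (HA : 1 <= A) by (unfold A; pose proof (Cmod_ge_0 (f t)); pose proof (Cmod_ge_0 (g t)); lra).
  exists (Rmin 1 (e / (2 * A))).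
  assert (Hq : 0 < e / (2 * A)) by (apply Rdiv_lt_0_compat; lra).
  split; [apply Rmin_pos; lra|].
  intros a b Ha Hb.
  assert (Ha1 := Rlt_le_trans _ _ _ Ha (Rmin_l _ _)).
  assert (Ha2 := Rlt_le_trans _ _ _ Ha (Rmin_r _ _)).
  assert (Hb2 := Rlt_le_trans _ _ _ Hb (Rmin_r _ _)).
  replace (a * b - f t * g t)%C with (a * (b - g t) + (a - f t) * g t)%C by ring.
  eapply Rle_lt_trans; [apply Cmod_triangle|]. rewrite !Cmod_mult.
  pose proof (Cmod_triangle_rev a (f t)).
  pose proof (Cmod_ge_0 (f t)); pose proof (Cmod_ge_0 (g t)).
  pose proof (Cmod_ge_0 (b - g t)); pose proof (Cmod_ge_0 (a - f t)); pose proof (Cmod_ge_0 a).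
  assert (Cmod a <= A) by (unfold A; lra). assert (Cmod (g t) <= A) by (unfold A; lra).
  assert (Cmod a * Cmod (b - g t) <= A * Cmod (b - g t)) by (apply Rmult_le_compat_r; lra).
  assert (Cmod (a - f t) * Cmod (g t) <= Cmod (a - f t) * A) by (apply Rmult_le_compat_l; lra).
  assert (A * Cmod (b - g t) < A * (e / (2 * A))) by (apply Rmult_lt_compat_l; lra).
  assert (A * Cmod (a - f t) < A * (e / (2 * A))) by (apply Rmult_lt_compat_l; lra).
  assert (A * (e / (2 * A)) = e / 2) by (field; lra). lra.
Qed.

Lemma Rccont_minus f g t : Rccont f t -> Rccont g t -> Rccont (fun s => f s - g s)%C t.
Proof.
  intros Hf Hg.
  assert (H : Rccont (fun s => f s + (- (1)) * g s)%C t).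
  { apply Rccont_plus; auto. apply Rccont_mult; auto. apply Rccont_const. }
  intros e He. destruct (H e He) as [d [Hd H1]]. exists d. split; auto. intros s Hs.
  replace (f s - g s - (f t - g t))%C with ((f s + (- (1)) * g s) - (f t + (- (1)) * g t))%C by ring.
  auto.
Qed.

Lemma Rccont_inv f t : Rccont f t -> f t <> RtoC 0 -> Rccont (fun s => / f s)%C t.
Proof. intros Hf H. apply (Rccont_comp Cinv); auto. now apply Ccont_inv. Qed.

Lemma Rccont_div f g t : Rccont f t -> Rccont g t -> g t <> RtoC 0 -> Rccont (fun s => f s / g s)%C t.
Proof. intros Hf Hg H. apply Rccont_mult; auto. now apply Rccont_inv. Qed.

Lemma Rccont_pair_l c t : Rccont (fun s => (s, c) : C) t.
Proof.
  intros e He. exists e. split; auto. intros s Hs.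
  replace ((s, c) - (t, c))%C with (RtoC (s - t))
    by (unfold RtoC, Cminus, Cplus, Copp; simpl; f_equal; ring).
  now rewrite Cmod_R.
Qed.

Lemma Rccont_pair_r c t : Rccont (fun s => (c, s) : C) t.
Proof.
  intros e He. exists e. split; auto. intros s Hs.
  replace ((c, s) - (c, t))%C with (Ci * RtoC (s - t))%C
    by (unfold RtoC, Ci, Cmult, Cminus, Cplus, Copp; simpl; f_equal; ring).
  rewrite Cmod_mult, Cmod_Ci, Cmod_R. lra.
Qed.

Lemma Rccont_hline f c t : Ccont f (t, c) -> Rccont (fun s => f (s, c)) t.
Proof. intros H. apply (Rccont_comp f (fun s => (s, c))); auto. apply Rccont_pair_l. Qed.

Lemma Rccont_vline f c t : Ccont f (c, t) -> Rccont (fun s => f (c, s)) t.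
Proof. intros H. apply (Rccont_comp f (fun s => (c, s))); auto. apply Rccont_pair_r. Qed.

(** * Complex integrals over segments and rectangle boundaries *)

Definition CInt (g : R -> C) (a b : R) : C :=
  (RInt (fun t => Re (g t)) a b, RInt (fun t => Im (g t)) a b).

Definition Rccont_on (g : R -> C) (a b : R) : Prop :=
  forall t, a <= t <= b -> Rccont g t.

Lemma ex_RInt_Re g a b : a <= b -> Rccont_on g a b -> ex_RInt (fun t => Re (g t)) a b.
Proof.
  intros Hab H. apply (ex_RInt_continuous (V := R_CompleteNormedModule)). intros t Ht. rewrite Rmin_left,
    Rmax_right in Ht by auto.
  apply Rccont_Re. now apply H.
Qed.

Lemma ex_RInt_Im g a b : a <= b -> Rccont_on g a b -> ex_RInt (fun t => Im (g t)) a b.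
Proof.
  intros Hab H. apply (ex_RInt_continuous (V := R_CompleteNormedModule)). intros t Ht. rewrite Rmin_left,
    Rmax_right in Ht by auto.
  apply Rccont_Im. now apply H.
Qed.

Lemma CInt_ext f g a b : a <= b -> (forall t, a <= t <= b -> f t = g t) -> CInt f a b = CInt g a b.
Proof.
  intros Hab H. unfold CInt. f_equal; apply RInt_ext; intros t Ht;
  rewrite Rmin_left, Rmax_right in Ht by auto; rewrite H; auto; lra.
Qed.

Lemma CInt_plus f g a b : a <= b -> Rccont_on f a b -> Rccont_on g a b ->
  CInt (fun t => f t + g t)%C a b = (CInt f a b + CInt g a b)%C.
Proof.
  intros Hab Hf Hg. unfold CInt, Cplus; simpl. f_equal.
  - rewrite <- (RInt_plus (V := R_CompleteNormedModule)); [|now apply ex_RInt_Re|now apply ex_RInt_Re].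
    reflexivity.
  - rewrite <- (RInt_plus (V := R_CompleteNormedModule)); [|now apply ex_RInt_Im|now apply ex_RInt_Im].
    reflexivity.
Qed.

Lemma CInt_scal c f a b : a <= b -> Rccont_on f a b ->
  CInt (fun t => c * f t)%C a b = (c * CInt f a b)%C.
Proof.
  intros Hab Hf. pose proof (ex_RInt_Re f a b Hab Hf) as H1. pose proof (ex_RInt_Im f a b Hab Hf) as H2.
  destruct c as [c1 c2]. unfold CInt, Cmult; simpl. f_equal.
  - apply is_RInt_unique. apply (is_RInt_minus (V := R_NormedModule)
      (fun t => scal c1 (Re (f t))) (fun t => scal c2 (Im (f t)))).
    + apply (is_RInt_scal (V := R_NormedModule)). now apply (RInt_correct (V := R_CompleteNormedModule)).
    + apply (is_RInt_scal (V := R_NormedModule)). now apply (RInt_correct (V := R_CompleteNormedModule)).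
  - apply is_RInt_unique. apply (is_RInt_plus (V := R_NormedModule)
      (fun t => scal c1 (Im (f t))) (fun t => scal c2 (Re (f t)))).
    + apply (is_RInt_scal (V := R_NormedModule)). now apply (RInt_correct (V := R_CompleteNormedModule)).
    + apply (is_RInt_scal (V := R_NormedModule)). now apply (RInt_correct (V := R_CompleteNormedModule)).
Qed.

Lemma CInt_minus f g a b : a <= b -> Rccont_on f a b -> Rccont_on g a b ->
  CInt (fun t => f t - g t)%C a b = (CInt f a b - CInt g a b)%C.
Proof.
  intros Hab Hf Hg.
  rewrite (CInt_ext _ (fun t => f t + (- (1)) * g t)%C) by (auto; intros; ring).
  rewrite CInt_plus, CInt_scal; auto; try ring.
  intros t Ht. apply Rccont_mult; auto. apply Rccont_const.
Qed.

Lemma CInt_Chasles f a b c : a <= b -> b <= c -> Rccont_on f a c ->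
  CInt f a c = (CInt f a b + CInt f b c)%C.
Proof.
  intros Hab Hbc Hf.
  assert (H1 : Rccont_on f a b) by (intros t Ht; apply Hf; lra).
  assert (H2 : Rccont_on f b c) by (intros t Ht; apply Hf; lra).
  unfold CInt, Cplus; simpl.
  rewrite <- (RInt_Chasles (V := R_CompleteNormedModule) (fun t => Re (f t)) a b c)
    by now apply ex_RInt_Re.
  rewrite <- (RInt_Chasles (V := R_CompleteNormedModule) (fun t => Im (f t)) a b c)
    by now apply ex_RInt_Im.
  reflexivity.
Qed.

Lemma CInt_const c a b : CInt (fun _ => c) a b = (RtoC (b - a) * c)%C.
Proof.
  unfold CInt. rewrite !RInt_const. destruct c; unfold scal, RtoC, Cmult; simpl.
  unfold mult; simpl. f_equal; ring.
Qed.

(** The factor 2 is the price of estimating real and imaginary parts separately; sharp constants do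
    not matter later. *)
Lemma CInt_bound f a b M : a <= b -> Rccont_on f a b -> (forall t, a <= t <= b -> Cmod (f t) <= M) ->
  Cmod (CInt f a b) <= 2 * M * (b - a).
Proof.
  intros Hab Hf H. eapply Rle_trans; [apply Cmod_le_sum|]. unfold CInt; simpl.
  assert (H1 : Rabs (RInt (fun t => Re (f t)) a b) <= (b - a) * M).
  { apply abs_RInt_le_const; auto. now apply ex_RInt_Re.
    intros t Ht. eapply Rle_trans; [apply re_le_Cmod|auto]. }
  assert (H2 : Rabs (RInt (fun t => Im (f t)) a b) <= (b - a) * M).
  { apply abs_RInt_le_const; auto. now apply ex_RInt_Im.
    intros t Ht. eapply Rle_trans; [apply Rabs_Im_le_Cmod|auto]. }
  lra.
Qed.

Lemma RInt_affine A B a b : RInt (fun t => A + B * t) a b = A * (b - a) + B * (b * b - a * a) / 2.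
Proof.
  apply is_RInt_unique.
  replace (A * (b - a) + B * (b * b - a * a) / 2)
    with ((fun t => A * t + B * (t * t) / 2) b - (fun t => A * t + B * (t * t) / 2) a) by (simpl; field).
  apply (is_RInt_derive (V := R_CompleteNormedModule) (fun t => A * t + B * (t * t) / 2) (fun t => A + B *
    t)).
  - intros. auto_derive; auto. field.
  - intros. apply continuity_pt_filterlim. reg.
Qed.

(** The counterclockwise boundary integral; on the vertical sides dz = i dv. *)
Definition rect_int (F : C -> C) (a b c d : R) : C :=
  (CInt (fun u => F (u, c)) a b + Ci * CInt (fun v => F (b, v)) c d
   - CInt (fun u => F (u, d)) a b - Ci * CInt (fun v => F (a, v)) c d)%C.

Definition rect_cont (F : C -> C) (a b c d : R) : Prop :=
  forall u v, a <= u <= b -> c <= v <= d -> Ccont F (u, v).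

Lemma rect_cont_h F a b c d y : rect_cont F a b c d -> c <= y <= d ->
  Rccont_on (fun u => F (u, y)) a b.
Proof. intros H Hy t Ht. apply Rccont_hline. auto. Qed.

Lemma rect_cont_v F a b c d x : rect_cont F a b c d -> a <= x <= b ->
  Rccont_on (fun v => F (x, v)) c d.
Proof. intros H Hy t Ht. apply Rccont_vline. auto. Qed.

Lemma rect_int_split_h F a m b c d : a <= m <= b -> c <= d -> rect_cont F a b c d ->
  rect_int F a b c d = (rect_int F a m c d + rect_int F m b c d)%C.
Proof.
  intros Hm Hcd H. unfold rect_int.
  rewrite (CInt_Chasles _ a m b) by (try lra; apply (rect_cont_h F a b c d); auto; lra).
  rewrite (CInt_Chasles (fun u => F (u, d)) a m b) by (try lra; apply (rect_cont_h F a b c d); auto; lra).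
  ring.
Qed.

Lemma rect_int_split_v F a b c m d : a <= b -> c <= m <= d -> rect_cont F a b c d ->
  rect_int F a b c d = (rect_int F a b c m + rect_int F a b m d)%C.
Proof.
  intros Hab Hm H. unfold rect_int.
  rewrite (CInt_Chasles _ c m d) by (try lra; apply (rect_cont_v F a b c d); auto; lra).
  rewrite (CInt_Chasles (fun u => F (a, u)) c m d) by (try lra; apply (rect_cont_v F a b c d); auto; lra).
  ring.
Qed.

(** Direct evaluation of the component integrals. This is the only closed integral that Goursat's
    argument has to know beforehand. *)
Lemma rect_int_affine al be a b c d : rect_int (fun w => al + be * w)%C a b c d = RtoC 0.
Proof.
  destruct al as [a1 a2], be as [b1 b2]. unfold rect_int, CInt.
  assert (E : forall f A B x y, (forall t, f t = A + B * t) -> RInt f x y = A * (y - x) + B * (y * y - x *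
    x) / 2).
  { intros f A B x y H. rewrite <- RInt_affine. apply RInt_ext. auto. }
  rewrite (E _ (a1 - b2 * c) b1 a b) by (intros; simpl; ring).
  rewrite (E _ (a2 + b1 * c) b2 a b) by (intros; simpl; ring).
  rewrite (E _ (a1 - b2 * d) b1 a b) by (intros; simpl; ring).
  rewrite (E _ (a2 + b1 * d) b2 a b) by (intros; simpl; ring).
  rewrite (E _ (a1 + b1 * b) (- b2) c d) by (intros; simpl; ring).
  rewrite (E _ (a2 + b2 * b) b1 c d) by (intros; simpl; ring).
  rewrite (E _ (a1 + b1 * a) (- b2) c d) by (intros; simpl; ring).
  rewrite (E _ (a2 + b2 * a) b1 c d) by (intros; simpl; ring).
  unfold Ci, RtoC, Cmult, Cminus, Cplus, Copp; simpl. f_equal; field.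
Qed.

Lemma rect_int_bound F a b c d M : a <= b -> c <= d -> rect_cont F a b c d ->
  (forall u v, a <= u <= b -> c <= v <= d -> Cmod (F (u, v)) <= M) ->
  Cmod (rect_int F a b c d) <= 4 * M * ((b - a) + (d - c)).
Proof.
  intros Hab Hcd Hc H.
  assert (H1 : Cmod (CInt (fun u => F (u, c)) a b) <= 2 * M * (b - a)).
  { apply CInt_bound; auto. apply (rect_cont_h F a b c d); auto; lra. intros; apply H; lra. }
  assert (H2 : Cmod (CInt (fun u => F (u, d)) a b) <= 2 * M * (b - a)).
  { apply CInt_bound; auto. apply (rect_cont_h F a b c d); auto; lra. intros; apply H; lra. }
  assert (H3 : Cmod (CInt (fun u => F (a, u)) c d) <= 2 * M * (d - c)).
  { apply CInt_bound; auto. apply (rect_cont_v F a b c d); auto; lra. intros; apply H; lra. }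
  assert (H4 : Cmod (CInt (fun u => F (b, u)) c d) <= 2 * M * (d - c)).
  { apply CInt_bound; auto. apply (rect_cont_v F a b c d); auto; lra. intros; apply H; lra. }
  unfold rect_int, Cminus.
  eapply Rle_trans; [apply Cmod_triangle|]. rewrite Cmod_opp, Cmod_mult, Cmod_Ci.
  eapply Rle_trans; [apply Rplus_le_compat_r, Cmod_triangle|]. rewrite Cmod_opp.
  eapply Rle_trans; [apply Rplus_le_compat_r, Rplus_le_compat_r, Cmod_triangle|].
  rewrite Cmod_mult, Cmod_Ci. lra.
Qed.

Lemma rect_int_minus_affine F al be a b c d : a <= b -> c <= d -> rect_cont F a b c d ->
  rect_int F a b c d = rect_int (fun w => F w - (al + be * w))%C a b c d.
Proof.
  intros Hab Hcd H.
  assert (HL : forall z, Ccont (fun w => al + be * w)%C z).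
  { intros z. apply Ccont_plus; [apply Ccont_const|].
    apply Ccont_mult; [apply Ccont_const|apply Ccont_id]. }
  transitivity (rect_int F a b c d - rect_int (fun w => al + be * w)%C a b c d)%C.
  { rewrite rect_int_affine. ring. }
  unfold rect_int.
  rewrite (CInt_minus (fun u => F (u, c)) (fun u => al + be * (u, c))%C); auto.
  rewrite (CInt_minus (fun u => F (u, d)) (fun u => al + be * (u, d))%C); auto.
  rewrite (CInt_minus (fun u => F (a, u)) (fun u => al + be * (a, u))%C); auto.
  rewrite (CInt_minus (fun u => F (b, u)) (fun u => al + be * (b, u))%C); auto.
  ring.
  all: try (intros t Ht; first [apply (Rccont_vline F)|apply (Rccont_hline F)]; apply H; lra).
  all: intros t Ht; first [apply (Rccont_vline (fun w => al + be * w)%C)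
     |apply (Rccont_hline (fun w => al + be * w)%C)]; apply HL.
Qed.

(** [P a c s] speaks of the rectangle with lower left corner (a, c) and sides s A and s B. If it
    fails at scale 1, it fails on one of the four quarters, and so on; the nested rectangles shrink
    to a point at which the local hypothesis is contradicted. *)
Lemma bisection_2d (A B : R) (P : R -> R -> R -> Prop) (a0 c0 : R) :
  0 < A -> 0 < B ->
  (forall a c s, 0 < s -> P a c (s / 2) -> P (a + s / 2 * A) c (s / 2) ->
     P a (c + s / 2 * B) (s / 2) -> P (a + s / 2 * A) (c + s / 2 * B) (s / 2) -> P a c s) ->
  (forall x y, a0 <= x <= a0 + A -> c0 <= y <= c0 + B ->
     exists d, 0 < d /\ forall a c s, 0 < s < d -> a0 <= a -> a + s * A <= a0 + A ->
       c0 <= c -> c + s * B <= c0 + B -> a <= x <= a + s * A -> c <= y <= c + s * B -> P a c s) ->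
  P a0 c0 1.
Proof.
  intros HA HB Hsub Hloc. apply NNPP. intros HN.
  (* The conditions on [p] stand behind the existential, so that the choice function [nx] is total
     and can be iterated. *)
  assert (Hstep : forall p : R * R * R, exists q : R * R * R,
    0 < snd p -> ~ P (fst (fst p)) (snd (fst p)) (snd p) ->
    ~ P (fst (fst q)) (snd (fst q)) (snd q) /\ snd q = snd p / 2 /\
    fst (fst p) <= fst (fst q) /\ fst (fst q) + snd q * A <= fst (fst p) + snd p * A /\
    snd (fst p) <= snd (fst q) /\ snd (fst q) + snd q * B <= snd (fst p) + snd p * B).
  { intros [[a c] s]; simpl.
    destruct (classic (0 < s)) as [Hs|]; [|exists (a, c, s); tauto].
    assert (0 < s / 2 * A) by (apply Rmult_lt_0_compat; lra).
    assert (0 < s / 2 * B) by (apply Rmult_lt_0_compat; lra).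
    destruct (classic (P a c (s / 2))); [|exists (a, c, s / 2); simpl; repeat split; auto; lra].
    destruct (classic (P (a + s / 2 * A) c (s / 2))); [|exists (a + s / 2 * A, c, s / 2); simpl; repeat
      split; auto; lra].
    destruct (classic (P a (c + s / 2 * B) (s / 2))); [|exists (a, c + s / 2 * B, s / 2); simpl; repeat
      split; auto; lra].
    exists (a + s / 2 * A, c + s / 2 * B, s / 2); simpl. intros _ H4. repeat split; try lra.
    intros H5. apply H4. apply Hsub; auto. }
  set (nx := fun p => proj1_sig (constructive_indefinite_description _ (Hstep p))).
  assert (Hnx : forall p, _) by (intros p; exact (proj2_sig (constructive_indefinite_description _ (Hstep
    p)))).
  fold nx in Hnx.
  set (q := fix q n := match n with O => (a0, c0, 1) | S n => nx (q n) end).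
  set (a := fun n => fst (fst (q n))). set (c := fun n => snd (fst (q n))).
  set (s := fun n => snd (q n)).
  assert (Hq : forall n, 0 < s n /\ ~ P (a n) (c n) (s n)).
  { induction n as [|n [IH1 IH2]]; [split; [unfold s; simpl; lra|exact HN]|].
    destruct (Hnx (q n) IH1 IH2) as [H1 [H2 _]]. split; auto.
    unfold s; simpl. fold nx. unfold nx in *. rewrite H2. unfold s in IH1. lra. }
  assert (Hs : forall n, s (S n) = s n / 2).
  { intros n. destruct (Hq n) as [H1 H2]. destruct (Hnx (q n) H1 H2) as [_ [H _]]. exact H. }
  assert (Hm : forall n, a n <= a (S n) /\ a (S n) + s (S n) * A <= a n + s n * A /\
    c n <= c (S n) /\ c (S n) + s (S n) * B <= c n + s n * B).
  { intros n. destruct (Hq n) as [H1 H2]. destruct (Hnx (q n) H1 H2) as [_ [_ H]]. exact H. }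
  assert (Hm2 : forall n k, a n <= a (n + k)%nat /\ a (n + k)%nat + s (n + k)%nat * A <= a n + s n * A /\
    c n <= c (n + k)%nat /\ c (n + k)%nat + s (n + k)%nat * B <= c n + s n * B).
  { intros n. induction k as [|k IH]; [rewrite Nat.add_0_r; lra|].
    rewrite Nat.add_succ_r. specialize (Hm (n + k)%nat). lra. }
  assert (Hs2 : forall n, s n = (1/2) ^ n).
  { induction n; [reflexivity|]. rewrite Hs, IHn. simpl. field. }
  assert (HsA : forall n, 0 < s n * A) by (intros; apply Rmult_lt_0_compat; auto; apply Hq).
  assert (HsB : forall n, 0 < s n * B) by (intros; apply Rmult_lt_0_compat; auto; apply Hq).
  assert (Hcross : forall n k, a k <= a n + s n * A /\ c k <= c n + s n * B).
  { intros n k. destruct (le_lt_dec n k) as [H|H].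
    - replace k with (n + (k - n))%nat by lia. specialize (Hm2 n (k - n)%nat).
      specialize (HsA (n + (k - n))%nat). specialize (HsB (n + (k - n))%nat). lra.
    - replace n with (k + (n - k))%nat by lia. specialize (Hm2 k (n - k)%nat).
      specialize (HsA (k + (n - k))%nat). specialize (HsB (k + (n - k))%nat). lra. }
  (* The common point of the nested rectangles is the supremum of their lower left corners,
     coordinate by coordinate. *)
  destruct (completeness (fun x => exists n, x = a n)) as [x [Hx1 Hx2]].
  { exists (a 0%nat + s 0%nat * A). intros y [n ->]. apply Hcross. }
  { exists (a 0%nat), 0%nat. auto. }
  destruct (completeness (fun x => exists n, x = c n)) as [y [Hy1 Hy2]].
  { exists (c 0%nat + s 0%nat * B). intros z [n ->]. apply Hcross. }
  { exists (c 0%nat), 0%nat. auto. }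
  assert (Hx : forall n, a n <= x <= a n + s n * A).
  { intros n. split; [apply Hx1; exists n; auto|]. apply Hx2. intros z [k ->]. apply Hcross. }
  assert (Hy : forall n, c n <= y <= c n + s n * B).
  { intros n. split; [apply Hy1; exists n; auto|]. apply Hy2. intros z [k ->]. apply Hcross. }
  assert (X0 := Hx 0%nat). assert (Y0 := Hy 0%nat). unfold a, s, c in X0, Y0; simpl in X0, Y0.
  destruct (Hloc x y ltac:(lra) ltac:(lra)) as [d [Hd Hl]].
  destruct (pow_lt_1_zero (1/2) ltac:(rewrite Rabs_pos_eq; lra) d Hd) as [N HN2].
  specialize (HN2 N (Nat.le_refl _)).
  destruct (Hq N) as [HsN HPN]. apply HPN.
  assert (H0N := Hm2 0%nat N). rewrite Nat.add_0_l in H0N.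
  assert (a 0%nat = a0) by reflexivity. assert (c 0%nat = c0) by reflexivity. assert (Es0 : s 0%nat = 1) by
    reflexivity.
  rewrite Es0 in H0N.
  apply Hl; auto; try lra. split; auto.
  rewrite <- Hs2 in HN2. rewrite Rabs_pos_eq in HN2; lra.
Qed.

(** The bound 4 e D^2 s^2 at scale s is reproduced by adding it over the four quarters. On small
    rectangles it holds because F minus its affine approximation is at most e s D there, while the
    affine part has integral zero. *)
Lemma Goursat F a b c d : a < b -> c < d ->
  (forall u v, a <= u <= b -> c <= v <= d -> Chol F (u, v)) ->
  rect_int F a b c d = RtoC 0.
Proof.
  intros Hab Hcd H.
  assert (Hcont : rect_cont F a b c d) by (intros u v Hu Hv; apply Chol_cont; auto).
  set (D := (b - a) + (d - c)).
  assert (HD : 0 < D) by (unfold D; lra).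
  cut (forall e, 0 < e -> Cmod (rect_int F a b c d) <= 4 * e * D * D).
  { intros He. apply C_eq_of_eps. intros e0 He0.
    replace (rect_int F a b c d - 0)%C with (rect_int F a b c d) by ring.
    assert (0 < 4 * D * D) by (repeat apply Rmult_lt_0_compat; lra).
    specialize (He (e0 / (4 * D * D))).
    replace (4 * (e0 / (4 * D * D)) * D * D) with e0 in He by (field; lra).
    apply He. now apply Rdiv_lt_0_compat. }
  intros e He.
  assert (Hgen : (a <= a /\ a + 1 * (b - a) <= b /\ c <= c /\ c + 1 * (d - c) <= d) ->
    Cmod (rect_int F a (a + 1 * (b - a)) c (c + 1 * (d - c))) <= 4 * e * D * D * (1 * 1)).
  2: { replace (a + 1 * (b - a)) with b in Hgen by ring.
       replace (c + 1 * (d - c)) with d in Hgen by ring.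
       rewrite !Rmult_1_r in Hgen. apply Hgen; lra. }
  apply (bisection_2d (b - a) (d - c) (fun x y s =>
    (a <= x /\ x + s * (b - a) <= b /\ c <= y /\ y + s * (d - c) <= d) ->
    Cmod (rect_int F x (x + s * (b - a)) y (y + s * (d - c))) <= 4 * e * D * D * (s * s))); try lra.
  - intros x y s Hs H1 H2 H3 H4 Hin.
    assert (0 < s / 2 * (b - a)) by (apply Rmult_lt_0_compat; lra).
    assert (0 < s / 2 * (d - c)) by (apply Rmult_lt_0_compat; lra).
    assert (E1 : x + s / 2 * (b - a) + s / 2 * (b - a) = x + s * (b - a)) by field.
    assert (E2 : y + s / 2 * (d - c) + s / 2 * (d - c) = y + s * (d - c)) by field.
    rewrite E1, ?E2 in *.
    specialize (H1 ltac:(lra)). specialize (H2 ltac:(lra)).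
    specialize (H3 ltac:(lra)). specialize (H4 ltac:(lra)).
    rewrite (rect_int_split_h F x (x + s / 2 * (b - a))); try lra;
      [|intros u v Hu Hv; apply Hcont; lra].
    rewrite (rect_int_split_v F x _ y (y + s / 2 * (d - c))); try lra;
      [|intros u v Hu Hv; apply Hcont; lra].
    rewrite (rect_int_split_v F (x + s / 2 * (b - a)) _ y (y + s / 2 * (d - c))); try lra;
      [|intros u v Hu Hv; apply Hcont; lra].
    eapply Rle_trans; [apply Cmod_triangle|].
    eapply Rle_trans; [apply Rplus_le_compat; apply Cmod_triangle|].
    lra.
  - intros x y Hx Hy. destruct (H x y) as [l Hl]; try lra.
    destruct (Cderiv_bound _ _ _ Hl e He) as [dd [Hdd Hd]].
    exists (dd / D). split; [now apply Rdiv_lt_0_compat|].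
    intros p q s Hs P1 P2 P3 P4 P5 P6 Hin.
    assert (HsD : s * D < dd) by (destruct Hs as [_ Hs]; apply Rlt_div_r in Hs; auto).
    assert (Hsub : rect_cont F p (p + s * (b - a)) q (q + s * (d - c))) by (intros u v Hu Hv; apply Hcont;
      lra).
    rewrite (rect_int_minus_affine F (F (x, y) - l * (x, y))%C l) by (auto; lra).
    eapply Rle_trans.
    + apply rect_int_bound with (M := e * (s * D)); try lra.
      * intros u v Hu Hv.
        apply (Ccont_ext_near (fun w => F w + ((- (F (x,y) - l * (x,y))) + (- l) * w))%C).
        { exists 1; split; [lra|]. intros; ring. }
        apply Ccont_plus; auto. apply Ccont_plus; [apply Ccont_const|].
        apply Ccont_mult; [apply Ccont_const|apply Ccont_id].
      * intros u v Hu Hv.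
        assert (Hdist : Cmod ((u, v) - (x, y)) <= s * D).
        { eapply Rle_trans; [apply Cmod_le_sum|]. unfold Cminus, Cplus, Copp; simpl.
          assert (Rabs (u + - x) <= s * (b - a)) by (apply Rabs_le; lra).
          assert (Rabs (v + - y) <= s * (d - c)) by (apply Rabs_le; lra).
          unfold D. lra. }
        replace (F (u, v) - (F (x, y) - l * (x, y) + l * (u, v)))%C
          with (F (u, v) - F (x, y) - l * ((u, v) - (x, y)))%C by ring.
        eapply Rle_trans; [apply Hd; lra|]. apply Rmult_le_compat_l; lra.
    + unfold D. apply Req_le. ring.
Qed.

(** The coordinates are swapped because [uniform_continuity_2d_1d] expects the variable of the
    compact segment first. *)
Lemma continuity_2d_Re F u v : Ccont F (u, v) -> continuity_2d_pt (fun y x => Re (F (x, y))) v u.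
Proof.
  intros H e. destruct (H e (cond_pos e)) as [d [Hd H1]].
  assert (Hd2 : 0 < d / 2) by lra. exists (mkposreal _ Hd2). simpl. intros y x Hy Hx.
  eapply Rle_lt_trans; [|apply (H1 (x, y))].
  - eapply Rle_trans; [|apply re_le_Cmod]. apply Req_le.
    change (Rabs (Re (F (x, y)) - Re (F (u, v))) = Rabs (Re (F (x, y) - F (u, v))%C)).
    unfold Cminus. rewrite re_plus, re_opp. reflexivity.
  - eapply Rle_lt_trans; [apply Cmod_le_sum|]. unfold Cminus, Cplus, Copp; simpl.
    unfold Rminus in *. lra.
Qed.

Lemma continuity_2d_Im F u v : Ccont F (u, v) -> continuity_2d_pt (fun y x => Im (F (x, y))) v u.
Proof.
  intros H e. destruct (H e (cond_pos e)) as [d [Hd H1]].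
  assert (Hd2 : 0 < d / 2) by lra. exists (mkposreal _ Hd2). simpl. intros y x Hy Hx.
  eapply Rle_lt_trans; [|apply (H1 (x, y))].
  - eapply Rle_trans; [|apply Rabs_Im_le_Cmod]. apply Req_le.
    change (Rabs (Im (F (x, y)) - Im (F (u, v))) = Rabs (Im (F (x, y) - F (u, v))%C)).
    unfold Cminus. rewrite im_plus, im_opp. reflexivity.
  - eapply Rle_lt_trans; [apply Cmod_le_sum|]. unfold Cminus, Cplus, Copp; simpl.
    unfold Rminus in *. lra.
Qed.

(** Uniform continuity near the compact segment over u0. It carries the circle average across the
    one radius at which holomorphy may fail. *)
Lemma vline_int_cont F u0 r a b : 0 < r -> a <= b ->
  (forall u v, Rabs (u - u0) < r -> a <= v <= b -> Ccont F (u, v)) ->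
  forall e, 0 < e -> exists d, 0 < d /\ forall u, Rabs (u - u0) < d ->
    Cmod (CInt (fun v => F (u, v)) a b - CInt (fun v => F (u0, v)) a b) <= e.
Proof.
  intros Hr Hab H e He.
  assert (H0 : forall v, a <= v <= b -> Ccont F (u0, v)).
  { intros. apply H; auto. rewrite Rminus_diag, Rabs_R0. auto. }
  (* The 4 is 2 from [CInt_bound] times 2 for real and imaginary parts; the summand 1 keeps the
     denominator positive when a = b. *)
  set (e' := e / (4 * (b - a + 1))).
  assert (He' : 0 < e') by (apply Rdiv_lt_0_compat; lra).
  destruct (uniform_continuity_2d_1d (fun y x => Re (F (x, y))) a b u0
    (fun v Hv => continuity_2d_Re F u0 v (H0 v Hv)) (mkposreal _ He')) as [d1 Hd1].
  destruct (uniform_continuity_2d_1d (fun y x => Im (F (x, y))) a b u0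
    (fun v Hv => continuity_2d_Im F u0 v (H0 v Hv)) (mkposreal _ He')) as [d2 Hd2].
  simpl in Hd1, Hd2.
  pose proof (cond_pos d1) as P1. pose proof (cond_pos d2) as P2.
  exists (Rmin r (Rmin d1 d2)). split; [repeat apply Rmin_pos; auto|].
  intros u Hu.
  assert (Hu1 : Rabs (u - u0) < r) by (eapply Rlt_le_trans; [apply Hu|apply Rmin_l]).
  assert (Hu2 : Rabs (u - u0) < d1) by (eapply Rlt_le_trans; [apply Hu|eapply Rle_trans; [apply
    Rmin_r|apply Rmin_l]]).
  assert (Hu3 : Rabs (u - u0) < d2) by (eapply Rlt_le_trans; [apply Hu|eapply Rle_trans; [apply
    Rmin_r|apply Rmin_r]]).
  assert (C1 : Rccont_on (fun v => F (u, v)) a b) by (intros t Ht; apply Rccont_vline; auto).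
  assert (C2 : Rccont_on (fun v => F (u0, v)) a b) by (intros t Ht; apply Rccont_vline; auto).
  rewrite <- CInt_minus by auto.
  eapply Rle_trans.
  - apply CInt_bound with (M := 2 * e'); auto.
    + intros t Ht. apply Rccont_minus; auto.
    + intros v Hv. eapply Rle_trans; [apply Cmod_le_sum|].
      apply Rabs_lt_between in Hu2 as Q2. apply Rabs_lt_between in Hu3 as Q3.
      specialize (Hd1 v u0 v u Hv ltac:(lra) Hv ltac:(lra)).
      specialize (Hd2 v u0 v u Hv ltac:(lra) Hv ltac:(lra)).
      rewrite Rminus_diag, Rabs_R0 in Hd1, Hd2. specialize (Hd1 P1). specialize (Hd2 P2).
      unfold Cminus. rewrite re_plus, re_opp, im_plus, im_opp.
      unfold Re, Im, Rminus in *. lra.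
  - unfold e'. replace (2 * (2 * (e / (4 * (b - a + 1)))) * (b - a)) with (e * ((b - a) / (b - a + 1))) by
    (field; lra).
    rewrite <- (Rmult_1_r e) at 2. apply Rmult_le_compat_l; [lra|].
    apply Rle_div_l; lra.
Qed.

Lemma cexp_2PI u : cexp (u, 2 * PI) = cexp (u, 0).
Proof. unfold cexp; simpl. rewrite cos_2PI, sin_2PI, cos_0, sin_0. auto. Qed.

Lemma Cmod_cexp_pair u v : Cmod (cexp (u, v)) = exp u.
Proof. apply Cmod_cexp. Qed.

(* In the coordinate [w = ln zeta], Goursat's lemma on [u1,u2] x [0,2 pi] shows that
   the circle average of [G] is independent of the radius [exp u]; this is used on both
   sides of the exceptional point [z], where [G] is only continuous. *)
Lemma circle_int_zero G R z u : exp u < R ->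
  (forall w, Cmod w < R -> Ccont G w) ->
  (forall w, Cmod w < R -> w <> z -> Chol G w) ->
  G (RtoC 0) = RtoC 0 ->
  CInt (fun v => G (cexp (u, v))) 0 (2 * PI) = RtoC 0.
Proof.
  intros Hu HC HH H0. pose proof PI_RGT_0 as HPI.
  set (F := fun w => G (cexp w)).
  set (V := fun u => CInt (fun v => F (u, v)) 0 (2 * PI)).
  change (V u = RtoC 0).
  assert (HFc : forall u v, exp u < R -> Ccont F (u, v)).
  { intros u1 v H. apply (Ccont_comp cexp G); [apply Chol_cont, Chol_cexp|].
    apply HC. now rewrite Cmod_cexp_pair. }
  assert (Hconst : forall u1 u2, u1 < u2 -> exp u2 < R ->
    (forall t, u1 <= t <= u2 -> exp t <> Cmod z) -> V u1 = V u2).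
  { intros u1 u2 H12 H2 Hz.
    assert (HG : rect_int F u1 u2 0 (2 * PI) = RtoC 0).
    { apply Goursat; [auto|lra|]. intros t v Ht Hv.
      apply (Chol_comp cexp G); [apply Chol_cexp|]. apply HH.
      - rewrite Cmod_cexp_pair. eapply Rle_lt_trans; [apply exp_le_mono, Ht|auto].
      - intros E. apply (Hz t Ht). rewrite <- E. now rewrite Cmod_cexp_pair. }
    unfold rect_int in HG.
    rewrite (CInt_ext (fun u => F (u, 2 * PI)) (fun u => F (u, 0))) in HG
      by (try lra; intros; unfold F; now rewrite cexp_2PI).
    fold (V u1) in HG. fold (V u2) in HG.
    assert (E : (Ci * (V u2 - V u1) = 0)%C) by (rewrite <- HG; ring).
    apply Cmod_minus_0. rewrite Cmod_minus_sym.
    apply (f_equal Cmod) in E. rewrite Cmod_mult, Cmod_Ci, Cmod_0 in E. lra. }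
  (* As the radius exp u shrinks to 0 the average tends to a multiple of G(0) = 0; this determines
     the constant value. *)
  assert (Hlim : forall e, 0 < e -> exists u1, forall u, u <= u1 -> Cmod (V u) <= e).
  { intros e He. assert (HR : 0 < R) by (pose proof (exp_pos u); lra).
    set (e' := e / (2 * (2 * PI))). assert (He' : 0 < e') by (apply Rdiv_lt_0_compat; lra).
    destruct (HC (RtoC 0) ltac:(rewrite Cmod_0; auto) e' He') as [d [Hd H]].
    set (m := Rmin d R / 2). assert (Hm : 0 < m /\ m < d /\ m < R).
    { unfold m. pose proof (Rmin_l d R). pose proof (Rmin_r d R). pose proof (Rmin_pos d R Hd HR). lra. }
    exists (ln m). intros u1 Hu1.
    assert (Hexp : exp u1 <= m) by (rewrite <- (exp_ln m) by lra; now apply exp_le_mono).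
    eapply Rle_trans; [apply CInt_bound with (M := e'); [lra| |]|].
    - intros v Hv. apply Rccont_vline. apply HFc. lra.
    - intros v Hv. left. unfold F. specialize (H (cexp (u1, v))). rewrite H0 in H.
      replace (G (cexp (u1, v)) - 0)%C with (G (cexp (u1, v))) in H by ring. apply H.
      replace (cexp (u1, v) - 0)%C with (cexp (u1, v)) by ring. rewrite Cmod_cexp_pair. lra.
    - unfold e'. apply Req_le. field. lra. }
  assert (HVc : forall u0, exp u0 < R -> forall e, 0 < e -> exists d, 0 < d /\
     forall u, Rabs (u - u0) < d -> Cmod (V u - V u0) <= e).
  { intros u0 Hu0 e He. assert (HR : 0 < R) by (pose proof (exp_pos u); lra).
    assert (Hl : u0 < ln R) by (apply exp_lt_inv; rewrite exp_ln; auto).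
    apply (vline_int_cont F u0 (ln R - u0)); auto; try lra.
    intros u1 v H1 _. apply HFc. apply Rabs_lt_between in H1.
    rewrite <- (exp_ln R) by auto. apply exp_increasing. lra. }
  assert (HA : forall u, exp u < R -> (forall t, t <= u -> exp t <> Cmod z) -> V u = RtoC 0).
  { intros u1 H1 Hz. apply C_eq_of_eps. intros e He. destruct (Hlim e He) as [u2 H2].
    replace (V u1 - 0)%C with (V u1) by ring.
    rewrite <- (Hconst (Rmin u2 u1 - 1) u1); auto.
    - apply H2. pose proof (Rmin_l u2 u1). lra.
    - pose proof (Rmin_r u2 u1). lra.
    - intros t Ht. apply Hz. lra. }
  destruct (Rtotal_order (exp u) (Cmod z)) as [Hlt|Hge].
  { apply HA; auto. intros t Ht. apply exp_le_mono in Ht. lra. }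
  destruct (Req_dec (Cmod z) 0) as [Hz0|Hz0].
  { apply HA; auto. intros t Ht. rewrite Hz0. pose proof (exp_pos t). lra. }
  assert (Hzp : 0 < Cmod z) by (pose proof (Cmod_ge_0 z); lra).
  set (u0 := ln (Cmod z)). assert (Eu0 : exp u0 = Cmod z) by (apply exp_ln; auto).
  assert (Hu0 : u0 <= u).
  { destruct Hge as [E|E]; rewrite <- Eu0 in E; [apply exp_inv in E; lra|left; now apply exp_lt_inv]. }
  assert (Hu0R : exp u0 < R) by (apply exp_le_mono in Hu0; lra).
  (* On the circle through z the value 0 is reached by continuity from inside. Beyond it the average
     is constant again, and continuity from outside identifies that constant. *)
  assert (H00 : V u0 = RtoC 0).
  { apply C_eq_of_eps. intros e He. destruct (HVc u0 Hu0R e He) as [d [Hd H]].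
    rewrite Cmod_minus_sym, <- (HA (u0 - d / 2)).
    - apply H. rewrite Rabs_left; lra.
    - eapply Rle_lt_trans; [apply exp_le_mono|apply Hu0R]. lra.
    - intros t Ht. rewrite <- Eu0. intros E. apply exp_inv in E. lra. }
  destruct Hu0 as [Hu0|Hu0]; [|now rewrite <- Hu0].
  apply C_eq_of_eps. intros e He. destruct (HVc u0 Hu0R e He) as [d [Hd H]].
  rewrite <- H00.
  pose proof (Rmin_l (d / 2) ((u - u0) / 2)) as M1. pose proof (Rmin_r (d / 2) ((u - u0) / 2)) as M2.
  pose proof (Rmin_pos (d / 2) ((u - u0) / 2) ltac:(lra) ltac:(lra)) as M3.
  set (m := Rmin (d / 2) ((u - u0) / 2)) in *.
  rewrite <- (Hconst (u0 + m) u); auto; try lra.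
  - apply H. rewrite Rabs_pos_eq; lra.
  - intros t Ht. rewrite <- Eu0. intros E. apply exp_inv in E. lra.
Qed.

(** * Cauchy's formula and its consequences *)

Lemma Cderiv_unique f z a b : Cderiv f z a -> Cderiv f z b -> a = b.
Proof.
  intros Ha Hb. apply C_eq_of_eps. intros e He.
  pose proof (Cnear_and _ _ _ (Cderiv_bound _ _ _ Ha (e/2) ltac:(lra)) (Cderiv_bound _ _ _ Hb (e/2)
    ltac:(lra))) as [d [Hd H]].
  specialize (H (z + RtoC (d / 2))%C).
  replace (z + RtoC (d / 2) - z)%C with (RtoC (d / 2)) in H by ring.
  rewrite Cmod_R, Rabs_pos_eq in H by lra. destruct (H ltac:(lra)) as [H1 H2].
  set (D := (f (z + RtoC (d / 2)) - f z)%C) in *.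
  assert (H3 : Cmod ((a - b) * RtoC (d / 2)) <= e * (d / 2)).
  { replace ((a - b) * RtoC (d / 2))%C with ((D - b * RtoC (d / 2)) + - (D - a * RtoC (d / 2)))%C by ring.
    eapply Rle_trans; [apply Cmod_triangle|]. rewrite Cmod_opp. lra. }
  rewrite Cmod_mult, Cmod_R, (Rabs_pos_eq (d / 2)) in H3 by lra.
  apply Rmult_le_reg_r in H3; lra.
Qed.

(** Written through [ln rho] so that it is literally the curve of [circle_int_zero]. *)
Definition circle (rho t : R) : C := cexp (ln rho, t).

Lemma Cmod_circle rho t : 0 < rho -> Cmod (circle rho t) = rho.
Proof. intros H. unfold circle. rewrite Cmod_cexp_pair. now apply exp_ln. Qed.

Lemma circle_neq_0 rho t : circle rho t <> RtoC 0.
Proof. apply cexp_neq_0. Qed.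

Lemma Rccont_circle rho t : Rccont (circle rho) t.
Proof. apply (Rccont_vline cexp). apply Chol_cont, Chol_cexp. Qed.

Lemma circle_minus_gt rho z t : Cmod z < rho -> rho - Cmod z <= Cmod (circle rho t - z).
Proof.
  intros H. pose proof (Cmod_ge_0 z). pose proof (Cmod_triangle_rev (circle rho t) z) as H1.
  rewrite Cmod_circle in H1; lra.
Qed.

Lemma circle_minus_neq rho z t : Cmod z < rho -> (circle rho t - z)%C <> RtoC 0.
Proof. intros H. apply Cmod_gt_0. pose proof (circle_minus_gt rho z t H). lra. Qed.

Lemma CInt_conj f a b : a <= b -> Rccont_on f a b -> CInt (fun t => Cconj (f t)) a b = Cconj (CInt f a b).
Proof.
  intros Hab H. unfold CInt, Cconj; simpl. f_equal.
  apply (RInt_opp (V := R_CompleteNormedModule) (fun t => Im (f t))). now apply ex_RInt_Im.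
Qed.

Lemma circle_conj rho t : 0 < rho -> (circle rho t * Cconj (circle rho t))%C = RtoC (rho * rho).
Proof.
  intros H. rewrite <- Cmod2_conj, Cmod_circle by auto.
  unfold Cpow. f_equal. unfold RtoC, Cmult; simpl; f_equal; ring.
Qed.

(** On the circle the conjugate of w is rho^2 / w, so the conjugate of 1 / (w - z) is w / (rho^2 -
    conj(z) w). This is holomorphic on a larger disc and vanishes at 0, hence [circle_int_zero]
    applies to it. *)
Lemma circle_int_inv rho z : Cmod z < rho ->
  CInt (fun t => / (circle rho t - z))%C 0 (2 * PI) = RtoC 0.
Proof.
  intros H. pose proof PI_RGT_0. pose proof (Cmod_ge_0 z) as Hz. assert (Hr : 0 < rho) by lra.
  set (G := fun w => (w / (RtoC (rho * rho) - Cconj z * w))%C).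
  assert (E : forall t, (/ (circle rho t - z))%C = Cconj (G (circle rho t))).
  { intros t. pose proof (circle_minus_neq rho z t H) as N.
    assert (N2 : (Cconj (circle rho t) - Cconj z)%C <> RtoC 0).
    { intros E. apply N. rewrite <- Cminus_conj in E. rewrite <- (Cconj_conj (circle rho t - z)), E.
      unfold Cconj, RtoC; simpl; f_equal; ring. }
    assert (EG : G (circle rho t) = Cconj (/ (circle rho t - z))).
    { unfold G. rewrite <- (circle_conj rho t Hr), Cinv_conj, Cminus_conj by auto.
      pose proof (circle_neq_0 rho t). field. split; auto.
      replace (circle rho t * Cconj (circle rho t) - Cconj z * circle rho t)%C
        with (circle rho t * (Cconj (circle rho t) - Cconj z))%C by ring. now apply Cmult_neq_0. }
    now rewrite EG, Cconj_conj. }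
  (* The harmonic mean of rho and of the modulus rho^2 / |z| of the pole of G; it exceeds rho, stays
     below the pole, and makes sense for z = 0. *)
  assert (HGh : forall w, Cmod w < 2 * (rho * rho) / (rho + Cmod z) -> Chol G w).
  { intros w Hw. apply Chol_div; [apply Chol_id| |].
    - apply Chol_minus; [apply Chol_const|]. apply Chol_mult; [apply Chol_const|apply Chol_id].
    - apply Cmod_gt_0. eapply Rlt_le_trans; [|apply Cmod_triangle_rev].
      rewrite Cmod_R, Rabs_pos_eq, Cmod_mult, Cmod_conj by nra.
      apply Rlt_div_r in Hw; [|lra]. pose proof (Cmod_ge_0 w). nra. }
  rewrite (CInt_ext _ (fun t => Cconj (G (circle rho t)))) by (auto; lra).
  rewrite CInt_conj; try lra.
  - unfold circle. rewrite (circle_int_zero G (2 * (rho * rho) / (rho + Cmod z)) (RtoC 0)); auto.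
    + unfold Cconj, RtoC; simpl; f_equal; ring.
    + rewrite exp_ln by auto. apply Rlt_div_r; nra.
    + intros w Hw. apply Chol_cont. auto.
    + unfold G. unfold Cdiv. ring.
  - intros t Ht. apply (Rccont_comp G); [apply Rccont_circle|]. apply Chol_cont, HGh.
    rewrite Cmod_circle by auto. apply Rlt_div_r; nra.
Qed.

Section Cauchy.
Variables (f : C -> C) (p : C) (Rad rho : R).
Hypothesis (Hrho : 0 < rho < Rad).
Hypothesis (Hf : forall w, Cmod (w - p) < Rad -> Chol f w).

Let circ := circle rho.
Let fz t := f (p + circ t)%C.

Lemma Rccont_f_circle t : Rccont fz t.
Proof.
  unfold fz. apply (Rccont_comp f (fun t => p + circ t)%C).
  - apply Rccont_plus; [apply Rccont_const|apply Rccont_circle].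
  - apply Chol_cont, Hf. replace (p + circ t - p)%C with (circ t) by ring.
    unfold circ. rewrite Cmod_circle; lra.
Qed.

Lemma f_circle_bounded : exists M, 0 < M /\ forall t, 0 <= t <= 2 * PI -> Cmod (fz t) <= M.
Proof.
  pose proof PI_RGT_0.
  destruct (continuity_ab_maj (fun t => Cmod (fz t)) 0 (2 * PI)) as [t0 [H1 _]]; [lra| |].
  - intros t Ht e He. destruct (Rccont_f_circle t e He) as [d [Hd H1]].
    exists d. split; auto. intros s [_ Hs]. simpl in *. unfold R_dist in *.
    eapply Rle_lt_trans; [|apply (H1 s Hs)]. apply Rabs_le.
    pose proof (Cmod_triangle_rev (fz s) (fz t)) as T1.
    pose proof (Cmod_triangle_rev (fz t) (fz s)) as T2.
    rewrite Cmod_minus_sym in T2. lra.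
  - exists (Cmod (fz t0) + 1). split; [pose proof (Cmod_ge_0 (fz t0)); lra|].
    intros t Ht. specialize (H1 t Ht). lra.
Qed.

(** Apply [circle_int_zero] to w phi(w), with phi the difference quotient of w -> f(p + w) at z: phi
    is continuous at z and holomorphic elsewhere, and the factor w gives the zero at 0. Since w / (w
    - z) = 1 + z / (w - z), the part with the constant f(p + z) reduces to [circle_int_inv]. *)
Lemma Cauchy_formula z : Cmod z < rho ->
  CInt (fun t => fz t * circ t / (circ t - z))%C 0 (2 * PI) = (RtoC (2 * PI) * f (p + z))%C.
Proof.
  intros Hz. pose proof PI_RGT_0.
  destruct (Hf (p + z)%C) as [l Hl].
  { replace (p + z - p)%C with z by ring. lra. }
  set (phi := fun w => if excluded_middle_informative (w = z) then l else ((f (p + w) - f (p + z)) / (w -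
    z))%C).
  assert (Hphi1 : forall w, Cmod w < Rad -> w <> z -> Chol phi w).
  { intros w Hw Hn. apply Chol_ext_near with (fun w => (f (p + w) - f (p + z)) / (w - z))%C.
    - apply Cnear_imp with (2 := Cnear_neq _ _ Hn). intros v Hv. unfold phi.
      destruct (excluded_middle_informative (v = z)); tauto.
    - apply Chol_div.
      + apply Chol_minus; [|apply Chol_const]. apply (Chol_comp (fun w => p + w)%C f).
        apply Chol_plus; [apply Chol_const|apply Chol_id]. apply Hf.
        now replace (p + w - p)%C with w by ring.
      + apply Chol_minus; [apply Chol_id|apply Chol_const].
      + now apply Cminus_eq_contra. }
  assert (Hphi2 : Ccont phi z).
  { destruct Hl as [q [Q1 [Q2 [d [Hd Q3]]]]].
    apply (Ccont_ext_near (fun w => q (p + w)%C)).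
    - exists d. split; auto. intros w Hw. unfold phi.
      destruct (excluded_middle_informative (w = z)) as [->|N]; auto.
      rewrite (Q3 (p + w)%C). 2: now replace (p + w - (p + z))%C with (w - z)%C by ring.
      apply Cminus_eq_contra in N. field. auto.
    - apply (Ccont_comp (fun w => p + w)%C q); auto.
      apply Ccont_plus; [apply Ccont_const|apply Ccont_id]. }
  assert (HG : CInt (fun t => circ t * phi (circ t))%C 0 (2 * PI) = RtoC 0).
  { apply (circle_int_zero (fun w => w * phi w)%C Rad z).
    - rewrite exp_ln; lra.
    - intros w Hw. apply Ccont_mult; [apply Ccont_id|].
      destruct (classic (w = z)) as [->|N]; auto. now apply Chol_cont, Hphi1.
    - intros w Hw N. apply Chol_mult; [apply Chol_id|auto].
    - ring. }
  assert (C0 : forall t, Rccont (fun t => / (circ t - z))%C t).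
  { intros t. apply Rccont_inv; [|now apply circle_minus_neq].
    apply Rccont_minus; [apply Rccont_circle|apply Rccont_const]. }
  assert (C1 : forall t, Rccont (fun t => fz t * circ t / (circ t - z))%C t).
  { intros t. apply Rccont_mult; auto. apply Rccont_mult; [apply Rccont_f_circle|apply Rccont_circle]. }
  rewrite (CInt_ext _ (fun t => fz t * circ t / (circ t - z) - f (p + z)%C * (1 + z * / (circ t - z)))%C)
    in HG.
  - rewrite CInt_minus in HG; try lra; try (intros t _; auto).
    + assert (HI : CInt (fun t => / (circ t - z))%C 0 (2 * PI) = RtoC 0) by exact (circle_int_inv rho z Hz).
      rewrite CInt_scal, CInt_plus, CInt_const, CInt_scal, HI in HG; try lra; try (intros t _; auto).
      * apply Ceq_minus in HG. rewrite HG, Rminus_0_r. ring.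
      * apply Rccont_const.
      * apply Rccont_mult; auto. apply Rccont_const.
      * apply Rccont_plus; [apply Rccont_const|]. apply Rccont_mult; auto. apply Rccont_const.
    + apply Rccont_mult; [apply Rccont_const|].
      apply Rccont_plus; [apply Rccont_const|]. apply Rccont_mult; auto. apply Rccont_const.
  - lra.
  - intros t _. unfold phi. pose proof (circle_minus_neq rho z t Hz) as N. fold (circ t) in N.
    destruct (excluded_middle_informative (circ t = z)) as [E|_].
    + exfalso. apply N. rewrite E. ring.
    + unfold fz. field. auto.
Qed.

(** * Taylor expansion with remainder, and isolated zeros *)

Definition taylor_coef n : C := (RtoC (/ (2 * PI)) * CInt (fun t => fz t / circ t ^ n) 0 (2 * PI))%C.
Definition taylor_rest n z : C :=
  (RtoC (/ (2 * PI)) * CInt (fun t => fz t / circ t ^ n * (circ t / (circ t - z))) 0 (2 * PI))%C.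

Lemma Rccont_coef n t : Rccont (fun t => fz t / circ t ^ n)%C t.
Proof.
  apply Rccont_div; [apply Rccont_f_circle| |apply Cpow_nz, circle_neq_0].
  induction n as [|n IH]; simpl; [apply Rccont_const|]. apply Rccont_mult; [apply Rccont_circle|auto].
Qed.

Lemma Rccont_rest n z t : Cmod z < rho -> Rccont (fun t => fz t / circ t ^ n * (circ t / (circ t - z)))%C t.
Proof.
  intros Hz. apply Rccont_mult; [apply Rccont_coef|].
  apply Rccont_div; [apply Rccont_circle| |now apply circle_minus_neq].
  apply Rccont_minus; [apply Rccont_circle|apply Rccont_const].
Qed.

(** One step of the geometric series under the integral: w / (w - z) = 1 + (z / w) (w / (w - z)). *)
Lemma taylor_rest_S n z : Cmod z < rho ->
  taylor_rest n z = (taylor_coef n + z * taylor_rest (S n) z)%C.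
Proof.
  intros Hz. pose proof PI_RGT_0. unfold taylor_rest, taylor_coef.
  rewrite (CInt_ext (fun t => fz t / circ t ^ n * (circ t / (circ t - z)))%C
   (fun t => fz t / circ t ^ n + z * (fz t / circ t ^ S n * (circ t / (circ t - z))))%C); [|lra|].
  - rewrite CInt_plus, CInt_scal; try lra; try ring.
    + intros t _. now apply Rccont_rest.
    + intros t _. apply Rccont_coef.
    + intros t _. apply Rccont_mult; [apply Rccont_const|]. now apply Rccont_rest.
  - intros t _. pose proof (circle_minus_neq rho z t Hz) as N. fold (circ t) in N.
    pose proof (circle_neq_0 rho t) as N2. fold (circ t) in N2.
    pose proof (Cpow_nz _ n N2) as N3. simpl. field. auto.
Qed.

Lemma taylor_0 z : Cmod z < rho -> f (p + z)%C = taylor_rest 0 z.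
Proof.
  intros Hz. pose proof PI_RGT_0. unfold taylor_rest.
  rewrite (CInt_ext _ (fun t => fz t * circ t / (circ t - z))%C); [|lra|].
  - rewrite Cauchy_formula, Cmult_assoc, <- RtoC_mult, Rinv_l by (auto; lra). ring.
  - intros t _. pose proof (circle_minus_neq rho z t Hz) as N. fold (circ t) in N.
    simpl. field. auto.
Qed.

Lemma taylor_rest_bound M n z : (forall t, 0 <= t <= 2 * PI -> Cmod (fz t) <= M) -> 0 <= M -> Cmod z < rho ->
  Cmod (taylor_rest n z) <= 2 * M * / rho ^ n * (rho / (rho - Cmod z)).
Proof.
  intros HM HM0 Hz. pose proof PI_RGT_0. unfold taylor_rest.
  rewrite Cmod_mult, Cmod_R, Rabs_pos_eq by (left; apply Rinv_0_lt_compat; lra).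
  assert (Hp : 0 < rho ^ n) by (apply pow_lt; lra).
  eapply Rle_trans.
  - apply Rmult_le_compat_l; [left; apply Rinv_0_lt_compat; lra|].
    apply CInt_bound with (M := M * / rho ^ n * (rho / (rho - Cmod z))); [lra| |].
    + intros t _. now apply Rccont_rest.
    + intros t Ht. pose proof (circle_minus_neq rho z t Hz) as N. fold (circ t) in N.
      pose proof (circle_neq_0 rho t) as N2. fold (circ t) in N2.
      pose proof (circle_minus_gt rho z t Hz) as N4. fold (circ t) in N4.
      rewrite Cmod_mult, !Cmod_div, Cmod_pow by (auto; now apply Cpow_nz).
      unfold circ at 1 2. rewrite !Cmod_circle by lra.
      unfold Rdiv. apply Rmult_le_compat.
      * apply Rmult_le_pos; [apply Cmod_ge_0|left; now apply Rinv_0_lt_compat].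
      * apply Rmult_le_pos; [lra|left; apply Rinv_0_lt_compat; lra].
      * apply Rmult_le_compat_r; [left; now apply Rinv_0_lt_compat|auto].
      * apply Rmult_le_compat_l; [lra|]. apply Rinv_le_contravar; lra.
  - apply Req_le. field. repeat split; lra.
Qed.

Lemma taylor_n n z : (forall k, (k < n)%nat -> taylor_coef k = RtoC 0) -> Cmod z < rho ->
  f (p + z)%C = (z ^ n * taylor_rest n z)%C.
Proof.
  intros H Hz. induction n as [|n IH].
  - rewrite taylor_0 by auto. simpl. ring.
  - rewrite IH by (intros; apply H; lia). rewrite taylor_rest_S, H by (auto; lia). simpl. ring.
Qed.

(** If all coefficients vanish, f(p + z) = z^n rest_n is O((|z| / rho)^n) for every n, hence 0.
    Otherwise the first nonzero coefficient outweighs z rest_(n+1) close to p. *)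
Lemma hol_zeros_isolated :
  Cnear p (fun w => f w = RtoC 0) \/ exists d, 0 < d /\ forall w, 0 < Cmod (w - p) < d -> f w <> RtoC 0.
Proof.
  destruct f_circle_bounded as [M [HM0 HM]].
  assert (Ep : forall w, w = (p + (w - p))%C) by (intros; ring).
  destruct (classic (forall n, taylor_coef n = RtoC 0)) as [HA|HN].
  - left. exists rho. split; [lra|]. intros w Hw.
    apply C_eq_of_eps. intros e He. replace (f w - 0)%C with (f w) by ring.
    rewrite (Ep w). set (z := (w - p)%C) in *. pose proof (Cmod_ge_0 z) as Hz0.
    set (B := 2 * M * (rho / (rho - Cmod z))).
    assert (HB : 0 < B).
    { unfold B. apply Rmult_lt_0_compat; [lra|]. apply Rdiv_lt_0_compat; lra. }
    assert (Hq : Rabs (Cmod z / rho) < 1).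
    { rewrite Rabs_pos_eq; [apply Rlt_div_l; lra|]. apply Rdiv_le_0_compat; lra. }
    destruct (pow_lt_1_zero _ Hq (e / B)) as [N HN]; [now apply Rdiv_lt_0_compat|].
    specialize (HN N (Nat.le_refl _)).
    rewrite (taylor_n N z) by auto. rewrite Cmod_mult, Cmod_pow.
    eapply Rle_trans.
    { apply Rmult_le_compat_l; [apply pow_le; lra|]. apply taylor_rest_bound with (M := M); auto. lra. }
    replace (Cmod z ^ N * (2 * M * / rho ^ N * (rho / (rho - Cmod z)))) with ((Cmod z / rho) ^ N * B).
    + pose proof (Rle_abs ((Cmod z / rho) ^ N)). apply Rle_trans with (e / B * B); [|apply Req_le; field;
      lra].
      apply Rmult_le_compat_r; lra.
    + unfold B, Rdiv. rewrite Rpow_mult_distr, pow_inv. ring.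
  - right. apply not_all_ex_not in HN.
    destruct (dec_inh_nat_subset_has_unique_least_element (fun n => taylor_coef n <> RtoC 0)) as [n [[Hn
      Hmin] _]].
    { intros n. destruct (classic (taylor_coef n = RtoC 0)); tauto. }
    { exact HN. }
    set (c := Cmod (taylor_coef n)). assert (Hc : 0 < c) by (apply Cmod_gt_0; auto).
    (* The last factor 2 bounds rho / (rho - |z|) for |z| <= rho / 2. *)
    set (B := 2 * M * / rho ^ (S n) * 2).
    assert (HB : 0 < B).
    { unfold B. apply Rmult_lt_0_compat; [|lra]. apply Rmult_lt_0_compat; [lra|].
      apply Rinv_0_lt_compat, pow_lt; lra. }
    exists (Rmin (rho / 2) (c / B)). split; [apply Rmin_pos; [lra|now apply Rdiv_lt_0_compat]|].
    intros w [Hw0 Hw]. rewrite (Ep w). set (z := (w - p)%C) in *.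
    assert (Hz1 := Rlt_le_trans _ _ _ Hw (Rmin_l _ _)). assert (Hz2 := Rlt_le_trans _ _ _ Hw (Rmin_r _ _)).
    rewrite (taylor_n n z); [| |lra].
    2: { intros k Hk. apply NNPP. intros E. specialize (Hmin k E). lia. }
    apply Cmult_neq_0; [apply Cpow_nz; now apply Cmod_gt_0|].
    rewrite taylor_rest_S by lra. intros E.
    assert (E2 : c = Cmod (z * taylor_rest (S n) z)).
    { unfold c. rewrite <- Cmod_opp. f_equal.
      replace (z * taylor_rest (S n) z)%C with ((taylor_coef n + z * taylor_rest (S n) z) - taylor_coef
        n)%C by ring.
      rewrite E. ring. }
    rewrite Cmod_mult in E2.
    assert (Hb : Cmod (taylor_rest (S n) z) <= B).
    { eapply Rle_trans; [apply taylor_rest_bound with (M := M); auto; lra|].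
      unfold B. apply Rmult_le_compat_l.
      - apply Rmult_le_pos; [lra|]. left. apply Rinv_0_lt_compat, pow_lt; lra.
      - apply Rle_div_l; lra. }
    apply Rlt_div_r in Hz2; auto.
    assert (Cmod z * Cmod (taylor_rest (S n) z) <= Cmod z * B) by (apply Rmult_le_compat_l; lra).
    lra.
Qed.

(** * Differentiating Cauchy's formula *)

Lemma CInt_param_deriv (h : C -> R -> C) (h1 : R -> C) a b z d M : a <= b -> 0 < d ->
  (forall w, Cmod (w - z) < d -> Rccont_on (h w) a b) -> Rccont_on h1 a b ->
  (forall w t, Cmod (w - z) < d -> a <= t <= b ->
     Cmod (h w t - h z t - (w - z) * h1 t) <= M * (Cmod (w - z) * Cmod (w - z))) ->
  Cderiv (fun w => CInt (h w) a b) z (CInt h1 a b).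
Proof.
  intros Hab Hd Hc Hc1 H. apply Cderiv_quad with (M := 2 * M * (b - a)) (d := d); auto.
  intros w Hw.
  assert (Hcz : Rccont_on (h z) a b).
  { apply Hc. replace (z - z)%C with (RtoC 0) by ring. now rewrite Cmod_0. }
  specialize (Hc w Hw).
  rewrite (Cmult_comm (CInt h1 a b)).
  assert (C1 : Rccont_on (fun t => (w - z) * h1 t)%C a b)
    by (intros t Ht; apply Rccont_mult; auto; apply Rccont_const).
  assert (C2 : Rccont_on (fun t => h w t - h z t)%C a b) by (intros t Ht; apply Rccont_minus; auto).
  rewrite <- CInt_scal, <- !CInt_minus; auto.
  eapply Rle_trans; [apply CInt_bound with (M := M * (Cmod (w - z) * Cmod (w - z))); auto|].
  - intros t Ht. apply Rccont_minus; auto.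
  - apply Req_le; ring.
Qed.

(** After division by 2 pi and the shift by p, [Tk 1] is f and [Tk 2] is its derivative. *)
Let Tk k w : C := CInt (fun t => fz t * circ t / (circ t - w) ^ k)%C 0 (2 * PI).

Lemma Rccont_Tk k w t : Cmod w < rho -> Rccont (fun t => fz t * circ t / (circ t - w) ^ k)%C t.
Proof.
  intros Hw. apply Rccont_div.
  - apply Rccont_mult; [apply Rccont_f_circle|apply Rccont_circle].
  - induction k as [|k IH]; simpl; [apply Rccont_const|]. apply Rccont_mult; auto.
    apply Rccont_minus; [apply Rccont_circle|apply Rccont_const].
  - apply Cpow_nz. now apply circle_minus_neq.
Qed.

(** The orders k = 1 and k = 2 suffice for the derivative of f and for its holomorphy. With A = circ
    - z and B = circ - w, the second-order remainders are the explicit fractions (A - B)^2 / (A^2 B)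
    and (A - B)^2 (A + 2 B) / (A^3 B^2). *)
Lemma Tk_deriv k z : (k = 1 \/ k = 2)%nat -> Cmod z < rho -> Cderiv (Tk k) z (RtoC (INR k) * Tk (S k) z).
Proof.
  intros Hk Hz. pose proof PI_RGT_0.
  destruct f_circle_bounded as [M [HM0 HM]].
  set (m := (rho - Cmod z) / 2). assert (Hm : 0 < m) by (unfold m; lra).
  unfold Tk. rewrite <- CInt_scal by (try lra; intros t _; now apply Rccont_Tk).
  assert (Hw1 : forall w, Cmod (w - z) < m -> Cmod w < rho - m).
  { intros w Hw. pose proof (Cmod_triangle_rev w z). unfold m in *. lra. }
  (* The two summands of the constant are the bounds for k = 2 and k = 1: |A + 2 B| <= 6 rho, while
     |A| and |B| are at least m. *)
  apply (CInt_param_deriv (fun w t => fz t * circ t / (circ t - w) ^ k)%C) with (d := m)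
    (M := M * rho * (6 * rho / m ^ 5 + / m ^ 3)); auto; [lra| | |].
  - intros w Hw t _. apply Rccont_Tk. specialize (Hw1 w Hw). lra.
  - intros t _. apply Rccont_mult; [apply Rccont_const|]. now apply Rccont_Tk.
  - intros w t Hw Ht. specialize (Hw1 w Hw).
    pose proof (circle_minus_neq rho z t Hz) as N1. fold (circ t) in N1.
    pose proof (circle_minus_neq rho w t ltac:(lra)) as N2. fold (circ t) in N2.
    pose proof (circle_minus_gt rho z t Hz) as N3. fold (circ t) in N3.
    pose proof (circle_minus_gt rho w t ltac:(lra)) as N4. fold (circ t) in N4.
    assert (Bz : Cmod (circ t) = rho) by (apply Cmod_circle; lra).
    assert (B1 : m <= Cmod (circ t - z)) by (unfold m in *; lra).
    assert (B3 : Cmod (circ t - z) <= 2 * rho).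
    { unfold Cminus. eapply Rle_trans; [apply Cmod_triangle|]. rewrite Cmod_opp. lra. }
    assert (B4 : Cmod (circ t - w) <= 2 * rho).
    { unfold Cminus. eapply Rle_trans; [apply Cmod_triangle|]. rewrite Cmod_opp. lra. }
    specialize (HM t Ht).
    assert (P5 : 0 < / m ^ 5) by (apply Rinv_0_lt_compat, pow_lt; auto).
    assert (P3 : 0 < / m ^ 3) by (apply Rinv_0_lt_compat, pow_lt; auto).
    assert (Pw : 0 <= Cmod (w - z) * Cmod (w - z)) by (pose proof (Cmod_ge_0 (w - z)); nra).
    assert (Pf : 0 <= Cmod (fz t) * rho <= M * rho)
      by (pose proof (Cmod_ge_0 (fz t)); split; [nra|apply Rmult_le_compat_r; lra]).
    set (A := (circ t - z)%C) in *. set (B := (circ t - w)%C) in *.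
    assert (EAB : (w - z)%C = (A - B)%C) by (unfold A, B; ring).
    assert (HR1 : forall q K, (fz t * circ t / B ^ k - fz t * circ t / A ^ k - (w - z) * (RtoC (INR k) *
      (fz t * circ t / A ^ S k)))%C
      = (fz t * circ t * ((w - z) * (w - z)) * q)%C -> Cmod q <= K -> K <= 6 * rho / m ^ 5 + / m ^ 3 ->
      Cmod (fz t * circ t / B ^ k - fz t * circ t / A ^ k - (w - z) * (RtoC (INR k) * (fz t * circ t / A ^
        S k)))
      <= M * rho * (6 * rho / m ^ 5 + / m ^ 3) * (Cmod (w - z) * Cmod (w - z))).
    { intros q K E Hq HK. rewrite E, !Cmod_mult, Bz.
      replace (M * rho * (6 * rho / m ^ 5 + / m ^ 3) * (Cmod (w - z) * Cmod (w - z)))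
        with ((M * rho) * (Cmod (w - z) * Cmod (w - z)) * (6 * rho / m ^ 5 + / m ^ 3)) by ring.
      apply Rmult_le_compat; [apply Rmult_le_pos; lra|apply Cmod_ge_0| |lra].
      apply Rmult_le_compat_r; lra. }
    assert (K0 : 0 <= 6 * rho / m ^ 5) by (unfold Rdiv; nra).
    assert (IA : forall j, 0 <= / Cmod A ^ j <= / m ^ j).
    { intros j. split; [left; apply Rinv_0_lt_compat, pow_lt; lra|].
      apply Rinv_le_contravar; [apply pow_lt; auto|apply pow_incr; lra]. }
    assert (IB : forall j, 0 <= / Cmod B ^ j <= / m ^ j).
    { intros j. split; [left; apply Rinv_0_lt_compat, pow_lt; lra|].
      apply Rinv_le_contravar; [apply pow_lt; auto|apply pow_incr; lra]. }
    destruct Hk as [-> | ->].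
    + apply (HR1 (/ (A ^ 2 * B ^ 1))%C (/ m ^ 3)); [| |lra].
      * rewrite EAB. simpl. field. auto.
      * rewrite Cmod_inv, Cmod_mult, !Cmod_pow, Rinv_mult by (apply Cmult_neq_0; now apply Cpow_nz).
        replace (/ m ^ 3) with (/ m ^ 2 * / m ^ 1) by (field; lra).
        apply Rmult_le_compat; first [apply IA|apply IB].
    + apply (HR1 ((A + 2 * B) / (A ^ 3 * B ^ 2))%C (6 * rho / m ^ 5)); [| |lra].
      * rewrite EAB. simpl. replace (RtoC (1 + 1)) with (RtoC 2) by (f_equal; ring). field. auto.
      * rewrite Cmod_div, Cmod_mult, !Cmod_pow by (apply Cmult_neq_0; now apply Cpow_nz).
        unfold Rdiv. apply Rmult_le_compat; [apply Cmod_ge_0| | |].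
        -- rewrite Rinv_mult. apply Rmult_le_pos; [apply IA|apply IB].
        -- eapply Rle_trans; [apply Cmod_triangle|]. rewrite Cmod_mult, Cmod_R, Rabs_pos_eq by lra. lra.
        -- rewrite Rinv_mult. replace (/ m ^ 5) with (/ m ^ 3 * / m ^ 2) by (field; lra).
           apply Rmult_le_compat; first [apply IA|apply IB].
Qed.

Lemma Cderiv_shift g c z l : Cderiv g (z - c) l -> Cderiv (fun w => g (w - c))%C z l.
Proof.
  intros H. replace l with (l * 1)%C by ring. apply (Cderiv_comp (fun w => w - c)%C g); auto.
  replace (RtoC 1) with (1 - 0)%C by ring. apply Cderiv_minus; [apply Cderiv_id|apply Cderiv_const].
Qed.

Lemma f_deriv_formula z : Cmod (z - p) < rho ->
  Cderiv f z (RtoC (/ (2 * PI)) * Tk 2 (z - p)).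
Proof.
  intros Hz. pose proof PI_RGT_0.
  apply Cderiv_ext_near with (fun w => RtoC (/ (2 * PI)) * Tk 1 (w - p))%C.
  - apply Cnear_imp with (2 := Cnear_ball _ _ _ Hz). intros w Hw.
    unfold Tk. rewrite (CInt_ext _ (fun t => fz t * circ t / (circ t - (w - p)))%C); [|lra|].
    + rewrite Cauchy_formula, Cmult_assoc, <- RtoC_mult, Rinv_l by (auto; lra).
      replace (p + (w - p))%C with w by ring. ring.
    + intros t _. simpl. now rewrite Cmult_1_r.
  - apply Cderiv_scal. apply (Cderiv_shift (Tk 1)).
    replace (Tk 2 (z - p)) with (RtoC (INR 1) * Tk 2 (z - p))%C by (simpl; ring).
    apply Tk_deriv; auto.
Qed.

(** By uniqueness of the derivative, D coincides near p with [Tk 2] up to a constant factor and a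
    shift. It is applied to zeta', which is only given pointwise. *)
Lemma derivative_hol D : (forall w, Cmod (w - p) < Rad -> Cderiv f w (D w)) -> Chol D p.
Proof.
  intros HD.
  assert (Hp : Cmod (p - p) < rho) by (replace (p - p)%C with (RtoC 0) by ring; rewrite Cmod_0; lra).
  apply Chol_ext_near with (fun w => RtoC (/ (2 * PI)) * Tk 2 (w - p))%C.
  - apply Cnear_imp with (2 := Cnear_ball _ _ _ Hp). intros w Hw.
    apply (Cderiv_unique f w); [now apply f_deriv_formula|]. apply HD. lra.
  - eexists. apply Cderiv_scal. apply (Cderiv_shift (Tk 2)). apply Tk_deriv; auto.
Qed.

Lemma Cauchy_estimate M l : 0 <= M -> (forall w, Cmod (w - p) < Rad -> Cmod (f w) <= M) -> Cderiv f p l ->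
  Cmod l <= 2 * M / rho.
Proof.
  intros HM0 HM Hl. pose proof PI_RGT_0.
  assert (Hp : Cmod (p - p) < rho) by (replace (p - p)%C with (RtoC 0) by ring; rewrite Cmod_0; lra).
  rewrite (Cderiv_unique _ _ _ _ Hl (f_deriv_formula p Hp)).
  rewrite Cmod_mult, Cmod_R, Rabs_pos_eq by (left; apply Rinv_0_lt_compat; lra).
  eapply Rle_trans.
  - apply Rmult_le_compat_l; [left; apply Rinv_0_lt_compat; lra|].
    apply CInt_bound with (M := M / rho); [lra| |].
    + intros t _. now apply Rccont_Tk.
    + intros t _. pose proof (circle_neq_0 rho t) as N. fold (circ t) in N.
      replace (circ t - (p - p))%C with (circ t) by ring.
      replace (fz t * circ t / circ t ^ 2)%C with (fz t / circ t)%C by (simpl; field; auto).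
      rewrite Cmod_div by auto. unfold circ at 1. rewrite Cmod_circle by lra.
      apply Rmult_le_compat_r; [left; apply Rinv_0_lt_compat; lra|].
      apply HM. replace (p + circ t - p)%C with (circ t) by ring. unfold circ. rewrite Cmod_circle; lra.
  - apply Req_le. field. lra.
Qed.

End Cauchy.

(** * Uniqueness of meromorphic continuation *)

(** Meromorphic functions are compared off the point, because [quotient_on] leaves their values at
    zeros of the denominator free. *)
Definition Cpunctured (z : C) (P : C -> Prop) : Prop :=
  exists d, 0 < d /\ forall w, 0 < Cmod (w - z) < d -> P w.

Lemma Cpunctured_and z P Q : Cpunctured z P -> Cpunctured z Q -> Cpunctured z (fun w => P w /\ Q w).
Proof.
  intros [d1 [H1 H2]] [d2 [H3 H4]]. exists (Rmin d1 d2). split.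
  - now apply Rmin_pos.
  - intros w [Hw0 Hw]. split; [apply H2|apply H4]; split; auto; eapply Rlt_le_trans; try apply Hw;
      [apply Rmin_l|apply Rmin_r].
Qed.

Lemma Cpunctured_imp z (P Q : C -> Prop) : (forall w, P w -> Q w) -> Cpunctured z P -> Cpunctured z Q.
Proof. intros H [d [H1 H2]]. exists d. auto. Qed.

Lemma Cnear_punctured z P : Cnear z P -> Cpunctured z P.
Proof. intros [d [H1 H2]]. exists d. split; auto. intros w [_ Hw]. auto. Qed.

Lemma Cpunctured_witness z (P : C -> Prop) : Cpunctured z P -> exists w, P w.
Proof.
  intros [d [Hd H]]. exists (z + RtoC (d / 2))%C. apply H.
  replace (z + RtoC (d / 2) - z)%C with (RtoC (d / 2)) by ring.
  rewrite Cmod_R, Rabs_pos_eq; lra.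
Qed.

Lemma Cpunctured_nearby z P : Cpunctured z P -> exists d, 0 < d /\ forall w, 0 < Cmod (w - z) < d -> Cnear
  w P.
Proof.
  intros [d [Hd H]]. exists d. split; auto. intros w [H1 H2].
  assert (Hn : w <> z).
  { intros E. subst. replace (z - z)%C with (RtoC 0) in H1 by ring. rewrite Cmod_0 in H1; lra. }
  apply Cnear_imp with (2 := Cnear_and _ _ _ (Cnear_ball z d w H2) (Cnear_neq _ _ Hn)).
  intros v [V1 V2]. apply H. split; auto. now apply Cmod_minus_gt_0.
Qed.

(** * From Coquelicot's neighbourhoods and differentials to discs and complex derivatives *)

Lemma locally_Cnear (z : C) (P : C -> Prop) : locally (z : C_UniformSpace) P -> Cnear z P.
Proof.
  intros [e He]. exists e. split; [apply cond_pos|]. intros w Hw. apply He.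
  now apply C_NormedModule_mixin_compat1.
Qed.

Lemma Cnear_locally (z : C) (P : C -> Prop) : Cnear z P -> locally (z : C_UniformSpace) P.
Proof.
  intros [d [Hd H]]. assert (Hq : 0 < d / sqrt 2) by (apply Rdiv_lt_0_compat; auto; apply Rlt_sqrt2_0).
  exists (mkposreal _ Hq). intros w Hw. apply H.
  pose proof (C_NormedModule_mixin_compat2 z w _ Hw) as H1. simpl in H1.
  replace d with (sqrt 2 * (d / sqrt 2)) by (field; apply Rgt_not_eq, Rlt_sqrt2_0). exact H1.
Qed.

(** A C-linear map on C is multiplication by its value at 1, which is therefore the derivative. *)
Lemma ex_filterdiff_Chol (f : C_NormedModule -> C_NormedModule) (z : C) :
  ex_filterdiff f (locally z) -> Chol f z.
Proof.
  intros [l [[Hl1 Hl2 _] H]]. exists (l (RtoC 1)). apply Cderiv_eps. intros e He.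
  specialize (H z (fun P HP => HP) (mkposreal e He)). apply locally_Cnear in H.
  apply Cnear_imp with (2 := H). intros w Hw.
  change (Cmod (f w - f z - l (w - z)%C)%C <= e * Cmod (w - z)) in Hw.
  assert (El : l (w - z)%C = (l (RtoC 1) * (w - z))%C).
  { transitivity (l (scal (w - z)%C (RtoC 1))).
    - f_equal. change (w - z = (w - z) * 1)%C. ring.
    - rewrite Hl2. apply Cmult_comm. }
  rewrite El in Hw. exact Hw.
Qed.

Lemma locally_line (r s t : C) (P : C3 -> Prop) :
  locally ((r, s, t) : C3) P -> Cnear s (fun w => P (r, w, t)).
Proof.
  intros [e He]. exists e. split; [apply cond_pos|]. intros w Hw. apply He.
  split; [split|]; simpl; try apply ball_center. now apply C_NormedModule_mixin_compat1.
Qed.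

(** The derivative along the middle coordinate is the differential at (0, 1, 0); the product norm of
    an increment in that direction is its modulus. *)
Lemma ex_filterdiff_line (f : C3 -> C_NormedModule) (r s t : C) :
  ex_filterdiff f (locally ((r, s, t) : C3)) -> Chol (fun w => f (r, w, t)) s.
Proof.
  intros [l [[Hl1 Hl2 _] H]]. exists (l (RtoC 0, RtoC 1, RtoC 0)). apply Cderiv_eps. intros e He.
  specialize (H (r, s, t) (fun P HP => HP) (mkposreal e He)). apply locally_line in H.
  apply Cnear_imp with (2 := H). intros w Hw.
  change (Cmod (f (r, w, t) - f (r, s, t) - l (minus ((r, w, t) : C3) (r, s, t)))%C
    <= e * norm (minus ((r, w, t) : C3) (r, s, t))) in Hw.
  assert (El : l (minus ((r, w, t) : C3) (r, s, t)) = (l (RtoC 0, RtoC 1, RtoC 0) * (w - s))%C).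
  { replace (minus ((r, w, t) : C3) (r, s, t)) with (scal (w - s)%C ((RtoC 0, RtoC 1, RtoC 0) : C3)).
    - rewrite Hl2. apply Cmult_comm.
    - unfold minus, plus, opp, scal; simpl. unfold prod_plus, prod_opp, prod_scal; simpl.
      unfold plus, opp, scal; simpl. unfold prod_plus, prod_opp, prod_scal; simpl.
      unfold plus, opp, scal; simpl. unfold mult; simpl.
      f_equal; [f_equal|]; ring. }
  rewrite El in Hw.
  assert (En : norm (minus ((r, w, t) : C3) (r, s, t)) = Cmod (w - s)).
  { unfold minus, plus, opp, norm; simpl. unfold prod_plus, prod_opp, prod_norm; simpl.
    unfold plus, opp, norm; simpl. unfold prod_plus, prod_opp, prod_norm; simpl.
    unfold plus, opp, norm; simpl.
    replace (r + - r)%C with (RtoC 0) by ring. replace (t + - t)%C with (RtoC 0) by ring.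
    rewrite Cmod_0. fold (Cminus w s). pose proof (Cmod_ge_0 (w - s)).
    rewrite !Rmult_0_l, Rplus_0_l, Rplus_0_r, Rmult_1_r, sqrt_square by auto.
    now rewrite Rmult_1_r, sqrt_square. }
  rewrite En in Hw. exact Hw.
Qed.

Definition mero_at (theta : C -> C) (s0 : C) : Prop :=
  exists (d : R) (g h : C -> C), 0 < d /\ (forall s, Cmod (s - s0) < d -> Chol g s /\ Chol h s) /\
    (forall s, 0 < Cmod (s - s0) < d -> h s <> RtoC 0 /\ theta s = (g s / h s)%C).

Lemma zeros_isolated h p d : 0 < d -> (forall s, Cmod (s - p) < d -> Chol h s) ->
  Cnear p (fun w => h w = RtoC 0) \/ Cpunctured p (fun w => h w <> RtoC 0).
Proof. intros Hd H. apply (hol_zeros_isolated h p d (d / 2)); auto. lra. Qed.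

(** The denominator does not vanish identically on the line, so its zeros along the line are
    isolated. On the punctured disc that remains, [theta] and [Theta] are the same quotient. *)
Lemma is_restriction_mero Theta (r t : C) theta : is_restriction Theta r t theta ->
  forall s0, mero_at theta s0 /\ Cpunctured s0 (fun s => theta s = Theta (r, s, t)).
Proof.
  intros H s0. destruct (H s0) as [U [g [h [HU [[Uo [Hg [Hh [_ HT]]]] [Hn Hf]]]]]].
  pose proof (locally_line _ _ _ _ (Uo _ HU)) as [d [Hd HUd]].
  assert (Hh' : forall s, Cmod (s - s0) < d -> Chol (fun s => h (r, s, t)) s)
    by (intros s Hs; apply ex_filterdiff_line, Hh, HUd; auto).
  destruct (zeros_isolated _ _ _ Hd Hh') as [HZ|[d' [Hd' HZ]]].
  { exfalso. apply Hn. now apply Cnear_locally. }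
  pose proof (Rmin_pos _ _ Hd Hd'). pose proof (Rmin_l d d'). pose proof (Rmin_r d d').
  split.
  - exists (Rmin d d'), (fun s => g (r, s, t)), (fun s => h (r, s, t)). split; [|split]; auto.
    + intros s Hs. split; [apply ex_filterdiff_line, Hg, HUd|apply Hh']; lra.
    + intros s Hs. split; [apply HZ; lra|]. apply Hf; [apply HUd|apply HZ]; lra.
  - exists (Rmin d d'). split; auto. intros s Hs.
    rewrite Hf, HT; auto; first [apply HUd|apply HZ]; lra.
Qed.

(** Where theta = g / h, equality with E means g - E h = 0, and a holomorphic function either
    vanishes near p or has no zero in a punctured disc. *)
Lemma mero_dichotomy theta E p : mero_at theta p -> Cnear p (Chol E) ->
  Cpunctured p (fun s => theta s = E s) \/ Cpunctured p (fun s => theta s <> E s).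
Proof.
  intros [d [g [h [Hd [Hgh Hq]]]]] [d' [Hd' HE]].
  pose proof (Rmin_pos _ _ Hd Hd'). pose proof (Rmin_l d d'). pose proof (Rmin_r d d').
  assert (HQ : Cpunctured p (fun s => h s <> RtoC 0 /\ theta s = (g s / h s)%C)) by (exists d; auto).
  destruct (zeros_isolated (fun s => g s - E s * h s)%C p (Rmin d d')) as [Z|Z]; auto.
  - intros s Hs. apply Chol_minus; [apply Hgh; lra|]. apply Chol_mult; [apply HE|apply Hgh]; lra.
  - left. apply Cpunctured_imp with (2 := Cpunctured_and _ _ _ HQ (Cnear_punctured _ _ Z)).
    intros s [[N ->] Es]. apply Ceq_minus in Es. rewrite Es. field. auto.
  - right. apply Cpunctured_imp with (2 := Cpunctured_and _ _ _ HQ Z).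
    intros s [[N ->] Es] Eq. apply Es. rewrite <- Eq. field. auto.
Qed.

Lemma Cnear_half_plane a p : a < Re p -> Cnear p (fun w => a < Re w).
Proof.
  intros H. exists (Re p - a). split; [lra|]. intros w Hw.
  pose proof (re_le_Cmod (w - p)) as H1. unfold Cminus in H1 at 1. rewrite re_plus, re_opp in H1.
  assert (H2 := Rle_lt_trans _ _ _ H1 Hw). apply Rabs_lt_between in H2. lra.
Qed.

Lemma Cmod_hor x y b : Cmod ((x, b) - (y, b)) = Rabs (x - y).
Proof.
  replace ((x, b) - (y, b))%C with (RtoC (x - y))
    by (unfold RtoC, Cminus, Cplus, Copp; simpl; f_equal; ring). apply Cmod_R.
Qed.

(* Along a horizontal line the set where [theta = E] nearby is open and closed, by
   [mero_dichotomy]. *)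
Lemma continuation_horizontal theta E a K b :
  (forall s, mero_at theta s) ->
  (forall u, a < u -> Cnear (u, b) (Chol E)) ->
  (forall u, K < u -> Cpunctured (u, b) (fun s => theta s = E s)) ->
  forall u, a < u -> Cpunctured (u, b) (fun s => theta s = E s).
Proof.
  intros Hm HE HK u Hu. apply NNPP. intros HN.
  set (S := fun x => u <= x /\ ~ Cpunctured (x, b) (fun s => theta s = E s)).
  destruct (completeness S) as [m [M1 M2]].
  - exists K. intros x [_ Hx]. apply Rnot_lt_le. intros Hlt. apply Hx. now apply HK.
  - exists u. split; auto; lra.
  - assert (Hum : u <= m) by (apply M1; split; auto; lra).
    (* At the supremum m of the failures, equality around m would give a smaller upper bound, and
       inequality around m would make m + d / 2 a failure beyond it. *)
    destruct (mero_dichotomy theta E (m, b) (Hm _) (HE m ltac:(lra))) as [D|D].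
    + destruct (Cpunctured_nearby _ _ D) as [d [Hd Hd2]].
      assert (m <= m - d); [|lra]. apply M2. intros x [Hx1 Hx2].
      assert (Hxm : x <= m) by (apply M1; split; auto).
      apply Rnot_lt_le. intros Hlt. apply Hx2.
      destruct (Req_dec x m) as [->|Hne]; auto.
      apply Cnear_punctured, Hd2. rewrite Cmod_hor. rewrite Rabs_left; lra.
    + destruct (Cpunctured_nearby _ _ D) as [d [Hd Hd2]].
      assert (m + d / 2 <= m); [|lra]. apply M1. split; [lra|]. intros HP.
      assert (HQ : Cnear (m + d / 2, b) (fun s => theta s <> E s)).
      { apply Hd2. rewrite Cmod_hor. replace (m + d / 2 - m) with (d / 2) by ring. rewrite Rabs_pos_eq; lra. }
      destruct (Cpunctured_witness _ _ (Cpunctured_and _ _ _ HP (Cnear_punctured _ _ HQ))) as [w [W1 W2]].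
      auto.
Qed.

Lemma punctured_eq_cont f g p : Ccont f p -> Ccont g p -> Cpunctured p (fun s => f s = g s) -> f p = g p.
Proof.
  intros Hf Hg H. apply C_eq_of_eps. intros e He.
  pose proof (Cnear_and _ _ _ (Hf (e / 2) ltac:(lra)) (Hg (e / 2) ltac:(lra))) as Hn.
  destruct (Cpunctured_witness _ _ (Cpunctured_and _ _ _ H (Cnear_punctured _ _ Hn))) as [w [E [W1 W2]]].
  replace (f p - g p)%C with ((g w - g p) + - (f w - f p))%C by (rewrite E; ring).
  eapply Rle_trans; [apply Cmod_triangle|]. rewrite Cmod_opp. lra.
Qed.

(** Horizontal lines off the real axis avoid s0 and are settled by [continuation_horizontal]. At a
    real point other than s0, inequality nearby would contradict the points just above it. Around s0
    both functions are continuous on a punctured disc, so equality near each of its points is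
    equality at that point. *)
Lemma continuation theta E a K (s0 : R) : a < s0 ->
  (forall s, mero_at theta s) ->
  (forall s, a < Re s -> s <> RtoC s0 -> Chol E s) ->
  (forall s, K < Re s -> Cpunctured s (fun s => theta s = E s)) ->
  Cpunctured (RtoC s0) (fun s => theta s = E s).
Proof.
  intros Ha Hm HE HK.
  assert (HEn : forall s, a < Re s -> s <> RtoC s0 -> Cnear s (Chol E)).
  { intros s H1 H2.
    apply Cnear_imp with (2 := Cnear_and _ _ _ (Cnear_half_plane _ _ H1) (Cnear_neq _ _ H2)).
    intros w [W1 W2]. auto. }
  assert (H1 : forall s, a < Re s -> Im s <> 0 -> Cpunctured s (fun s => theta s = E s)).
  { intros [u b] H2 H3. apply continuation_horizontal with (a := a) (K := K); auto.
    intros v Hv. apply HEn; auto. intros Eq. injection Eq as E1 E2. auto. }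
  assert (H2 : forall s, a < Re s -> s <> RtoC s0 -> Cpunctured s (fun s => theta s = E s)).
  { intros s H2 H3. destruct (Req_dec (Im s) 0) as [Hi|]; [|now apply H1].
    destruct (mero_dichotomy theta E s (Hm s) (HEn s H2 H3)) as [|D]; auto. exfalso.
    destruct (Cpunctured_nearby _ _ D) as [d [Hd Hd2]].
    set (q := (s + Ci * RtoC (d / 2))%C).
    assert (Hq : Cnear q (fun s => theta s <> E s)).
    { apply Hd2. unfold q. replace (s + Ci * RtoC (d / 2) - s)%C with (Ci * RtoC (d / 2))%C by ring.
      rewrite Cmod_mult, Cmod_Ci, Cmod_R, Rabs_pos_eq; lra. }
    assert (Hq2 : Cpunctured q (fun s => theta s = E s)).
    { apply H1; unfold q, Ci, RtoC, Cmult, Cplus, Re, Im in *; simpl; lra. }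
    destruct (Cpunctured_witness _ _ (Cpunctured_and _ _ _ Hq2 (Cnear_punctured _ _ Hq))) as [w [W1 W2]].
    auto. }
  destruct (Hm (RtoC s0)) as [d [g [h [Hd [Hgh Hq]]]]].
  assert (HQ : Cpunctured (RtoC s0) (fun s => h s <> RtoC 0 /\ theta s = (g s / h s)%C)) by (exists d; auto).
  destruct (Cpunctured_nearby _ _ HQ) as [d1 [Hd1 HQ1]].
  destruct (Cnear_half_plane a (RtoC s0) Ha) as [d2 [Hd2 HQ2]].
  pose proof (Rmin_l d (Rmin d1 d2)). pose proof (Rmin_r d (Rmin d1 d2)).
  pose proof (Rmin_l d1 d2). pose proof (Rmin_r d1 d2).
  exists (Rmin d (Rmin d1 d2)). split; [repeat apply Rmin_pos; auto|].
  intros s Hs. assert (Hs1 : 0 < Cmod (s - RtoC s0) < d1) by lra.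
  assert (Hne : s <> RtoC s0).
  { intros ->. replace (RtoC s0 - RtoC s0)%C with (RtoC 0) in Hs1 by ring. rewrite Cmod_0 in Hs1; lra. }
  assert (Hre : a < Re s) by (apply HQ2; lra).
  apply punctured_eq_cont; auto.
  - apply Ccont_ext_near with (fun s => g s / h s)%C.
    + apply Cnear_imp with (2 := HQ1 s Hs1). intros w [_ W]. auto.
    + apply Chol_cont. destruct (Hgh s ltac:(lra)) as [G1 G2]. apply Chol_div; auto.
      apply (Hq s). lra.
  - now apply Chol_cont, HE.
Qed.

(** * Dirichlet series *)

Notation Cis_series := (@is_series C_AbsRing C_NormedModule).
Notation Csum_n := (@sum_n C_NormedModule).

Lemma Cis_series_eps (a : nat -> C) (l : C) :
  Cis_series a l <-> forall e, 0 < e -> exists N, forall n, (N <= n)%nat -> Cmod (Csum_n a n - l) < e.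
Proof.
  split.
  - intros H e He.
    assert (HL : locally (l : C_UniformSpace) (fun w => Cmod (w - l) < e)).
    { assert (Hq : 0 < e / sqrt 2) by (apply Rdiv_lt_0_compat; auto; apply Rlt_sqrt2_0).
      exists (mkposreal _ Hq). intros w Hw.
      pose proof (C_NormedModule_mixin_compat2 l w _ Hw) as H1. simpl in H1.
      replace e with (sqrt 2 * (e / sqrt 2)) by (field; apply Rgt_not_eq, Rlt_sqrt2_0). exact H1. }
    destruct (H _ HL) as [N HN]. exists N. auto.
  - intros H P [e He]. destruct (H e (cond_pos e)) as [N HN]. exists N. intros n Hn.
    apply He. apply C_NormedModule_mixin_compat1. now apply HN.
Qed.

Lemma Cis_series_plus a b la lb : Cis_series a la -> Cis_series b lb ->
  Cis_series (fun n => a n + b n)%C (la + lb)%C.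
Proof. intros H1 H2. apply (is_series_plus (V := C_NormedModule) a b la lb H1 H2). Qed.

Lemma Cis_series_scal c a la : Cis_series a la -> Cis_series (fun n => c * a n)%C (c * la)%C.
Proof. intros H1. apply (is_series_scal (V := C_NormedModule) c a la H1). Qed.

Lemma Cis_series_minus a b la lb : Cis_series a la -> Cis_series b lb ->
  Cis_series (fun n => a n - b n)%C (la - lb)%C.
Proof. intros H1 H2. apply (is_series_minus (V := C_NormedModule) a b la lb H1 H2). Qed.

Lemma Cis_series_ext (a b : nat -> C) l : (forall n, a n = b n) -> Cis_series a l -> Cis_series b l.
Proof. apply (is_series_ext (V := C_NormedModule)). Qed.

Lemma Cis_series_unique a la lb : Cis_series a la -> Cis_series a lb -> la = lb.
Proof.
  intros H1 H2. apply C_eq_of_eps. intros e He. rewrite Cis_series_eps in H1, H2.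
  destruct (H1 (e / 2) ltac:(lra)) as [N1 Q1]. destruct (H2 (e / 2) ltac:(lra)) as [N2 Q2].
  specialize (Q1 (N1 + N2)%nat ltac:(lia)). specialize (Q2 (N1 + N2)%nat ltac:(lia)).
  rewrite Cmod_minus_sym in Q1. set (S := Csum_n a (N1 + N2)) in *.
  replace (la - lb)%C with ((la - S) + (S - lb))%C by ring.
  eapply Rle_trans; [apply Cmod_triangle|]. lra.
Qed.

Lemma Csum_n_S a n : Csum_n a (S n) = (Csum_n a n + a (S n))%C.
Proof. apply (sum_Sn (G := C_AbelianMonoid)). Qed.

Lemma Csum_n_O a : Csum_n a 0 = a 0%nat.
Proof. apply (sum_O (G := C_AbelianMonoid)). Qed.

Lemma Csum_n_bound (a : nat -> C) (b : nat -> R) n : (forall k, Cmod (a k) <= b k) ->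
  Cmod (Csum_n a n) <= sum_n b n.
Proof.
  intros H. induction n as [|n IH].
  - rewrite Csum_n_O, sum_O. auto.
  - rewrite Csum_n_S, sum_Sn. eapply Rle_trans; [apply Cmod_triangle|].
    apply Rplus_le_compat; auto.
Qed.

Lemma is_series_eps (a : nat -> R) (l : R) : is_series a l ->
  forall e, 0 < e -> exists N, forall n, (N <= n)%nat -> Rabs (sum_n a n - l) < e.
Proof.
  intros H e He. destruct (H (fun w => Rabs (w - l) < e)) as [N HN].
  - exists (mkposreal e He). intros w Hw. exact Hw.
  - exists N. auto.
Qed.

Lemma Cis_series_bound (a : nat -> C) (b : nat -> R) l B : (forall k, Cmod (a k) <= b k) ->
  Cis_series a l -> is_series b B -> Cmod l <= B.
Proof.
  intros H Ha Hb. rewrite Cis_series_eps in Ha. apply le_epsilon. intros e He.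
  destruct (Ha (e / 2) ltac:(lra)) as [N1 Q1].
  destruct (is_series_eps b B Hb (e / 2) ltac:(lra)) as [N2 Q2].
  specialize (Q1 (N1 + N2)%nat ltac:(lia)). specialize (Q2 (N1 + N2)%nat ltac:(lia)).
  apply Rabs_lt_between in Q2. pose proof (Csum_n_bound a b (N1 + N2) H).
  rewrite Cmod_minus_sym in Q1. pose proof (Cmod_triangle_rev l (Csum_n a (N1 + N2))). lra.
Qed.

Lemma Cex_series_le (a : nat -> C) (b : nat -> R) : (forall k, Cmod (a k) <= b k) -> ex_series b ->
  exists l, Cis_series a l.
Proof.
  intros H Hb. apply (ex_series_le (V := C_CompleteNormedModule) a b); auto.
Qed.

Lemma Cis_series_tail (a : nat -> C) (b : nat -> R) l B M : (forall k, Cmod (a k) <= b k) ->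
  Cis_series a l -> is_series b B -> Cmod (l - Csum_n a M) <= B - sum_n b M.
Proof.
  intros H Ha Hb.
  apply (Cis_series_bound (fun k => a (S M + k)%nat) (fun k => b (S M + k)%nat)); auto.
  - apply (is_series_incr_n (V := C_NormedModule) a (S M)); [lia|].
    apply (eq_ind l (fun q => Cis_series a q) Ha).
    change ((l : C) = ((l : C) - (Csum_n a M : C)) + (Csum_n a M : C))%C. generalize (Csum_n a M : C) (l :
      C). intros u v. change (v = v - u + u)%C. ring.
  - apply (is_series_incr_n (V := R_NormedModule) b (S M)); [lia|].
    apply (eq_ind B (fun q => is_series b q) Hb).
    change ((B : R) = ((B : R) - (sum_n b M : R)) + (sum_n b M : R)). generalize (sum_n b M : R) (B : R).
      intros u v. change (v = v - u + u). ring.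
Qed.

(** * Double series and termwise differentiation *)

Lemma Csum_n_series (c : nat -> nat -> C) (b : nat -> C) M :
  (forall m, Cis_series (fun n => c n m) (b m)) ->
  Cis_series (fun n => Csum_n (c n) M) (Csum_n b M).
Proof.
  intros H. induction M as [|M IH].
  - rewrite Csum_n_O. apply Cis_series_ext with (2 := H 0%nat). intros n. now rewrite Csum_n_O.
  - rewrite Csum_n_S. apply Cis_series_ext with (2 := Cis_series_plus _ _ _ _ IH (H (S M))).
    intros n. now rewrite Csum_n_S.
Qed.

(** Domination by a product makes the tail of row n at most a_n times the tail of b. Summed over n,
    this puts the partial sum of M columns within A times that tail of l. Dividing by A + 1 allows
    for A = 0. *)
Lemma Fubini_series (c : nat -> nat -> C) (a b : nat -> R) (al be : nat -> C) l :
  (forall n m, Cmod (c n m) <= a n * b m) -> (forall n, 0 <= a n) -> ex_series a -> ex_series b ->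
  (forall n, Cis_series (c n) (al n)) -> Cis_series al l ->
  (forall m, Cis_series (fun n => c n m) (be m)) -> Cis_series be l.
Proof.
  intros Hc Ha0 [A HA] [B HB] Hal Hl Hbe. rewrite Cis_series_eps. intros e He.
  assert (HA0 : 0 <= A).
  { apply Rle_trans with (Cmod (RtoC 0)); [apply Cmod_ge_0|].
    apply (Cis_series_bound (fun _ => RtoC 0) a); auto.
    - intros k. now rewrite Cmod_0.
    - rewrite Cis_series_eps. intros e' He'. exists 0%nat. intros n _.
      replace (Csum_n (fun _ => RtoC 0) n) with (RtoC 0).
      + replace (0 - 0)%C with (RtoC 0) by ring. now rewrite Cmod_0.
      + induction n as [|n IH]; [now rewrite Csum_n_O|]. rewrite Csum_n_S, <- IH. ring. }
  destruct (is_series_eps b B HB (e / (A + 1))) as [N HN]; [apply Rdiv_lt_0_compat; lra|].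
  exists N. intros M HM. specialize (HN M HM). rewrite Cmod_minus_sym.
  eapply Rle_lt_trans.
  - apply (Cis_series_bound (fun n => al n - Csum_n (c n) M)%C (fun n => (B - sum_n b M) * a n) _ ((B -
    sum_n b M) * A)).
    + intros n. rewrite (Rmult_comm _ (a n)). rewrite Rmult_minus_distr_l.
      eapply Rle_trans; [apply (Cis_series_tail (c n) (fun m => a n * b m) (al n) (a n * B) M); auto|].
      * apply (is_series_scal_l (a n) b B HB).
      * apply Req_le. f_equal. apply (sum_n_mult_l (K := R_Ring)).
    + apply Cis_series_minus; auto. now apply Csum_n_series.
    + apply (is_series_scal_l (B - sum_n b M) a A HA).
  - rewrite Rabs_minus_sym in HN. apply Rle_lt_trans with (e / (A + 1) * A).
    + apply Rmult_le_compat_r; auto. pose proof (Rle_abs (B - sum_n b M)). lra.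
    + apply Rlt_le_trans with (e / (A + 1) * (A + 1)); [|apply Req_le; field; lra].
      apply Rmult_lt_compat_l; [apply Rdiv_lt_0_compat; lra|lra].
Qed.

Lemma series_Cderiv (u : nat -> C -> C) (v : nat -> C) (w : nat -> R) (U : C -> C) V z d :
  0 < d -> ex_series w ->
  (forall n y, Cmod (y - z) < d -> Cmod (u n y - u n z - v n * (y - z)) <= w n * (Cmod (y - z) * Cmod (y -
    z))) ->
  (forall y, Cmod (y - z) < d -> Cis_series (fun n => u n y) (U y)) ->
  Cis_series v V -> Cderiv U z V.
Proof.
  intros Hd [W HW] Hu HU HV. apply Cderiv_quad with (M := W) (d := d); auto. intros y Hy.
  assert (Hz : Cmod (z - z) < d) by (replace (z - z)%C with (RtoC 0) by ring; now rewrite Cmod_0).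
  apply (Cis_series_bound (fun n => u n y - u n z - v n * (y - z))%C (fun n => w n * (Cmod (y - z) * Cmod
    (y - z)))); auto.
  - apply Cis_series_minus; [apply Cis_series_minus; auto|].
    rewrite (Cmult_comm V). apply Cis_series_ext with (fun n => (y - z) * v n)%C; [intros; ring|].
    now apply Cis_series_scal.
  - apply (is_series_scal_r (Cmod (y - z) * Cmod (y - z)) w W HW).
Qed.

Lemma ex_series_telescope (a F : nat -> R) M : (forall n, 0 <= a n <= F n - F (S n)) -> (forall n, M <= F
  n) ->
  ex_series a.
Proof.
  intros H HF.
  assert (HS : forall n, sum_n a n <= F 0%nat - F (S n)).
  { induction n as [|n IH]; [rewrite sum_O; apply H|]. rewrite sum_Sn. specialize (H (S n)).
    unfold plus; simpl. lra. }
  destruct (ex_finite_lim_seq_incr (sum_n a) (F 0%nat - M)) as [l Hl].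
  - intros n. rewrite sum_Sn. specialize (H (S n)). unfold plus; simpl. lra.
  - intros n. specialize (HS n). specialize (HF (S n)). lra.
  - exists l. exact Hl.
Qed.

(** * Real and complex powers, Dirichlet series *)

Lemma Rpower_pos a b : 0 < Rpower a b.
Proof. apply exp_pos. Qed.

Lemma ln_ge_1_minus_inv y : 0 < y -> 1 - / y <= ln y.
Proof.
  intros H. pose proof (exp_ineq1_le (- ln y)) as H1. rewrite exp_Ropp, exp_ln in H1 by auto. lra.
Qed.

(** The integral comparison in discrete form: (y / (y - 1))^eta - 1 >= eta ln (y / (y - 1)) >= eta /
    y. *)
Lemma Rpower_telescope y eta : 1 < y -> 0 < eta ->
  Rpower y (- (1 + eta)) <= / eta * (Rpower (y - 1) (- eta) - Rpower y (- eta)).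
Proof.
  intros Hy He.
  replace (Rpower (y - 1) (- eta)) with (Rpower y (- eta) * exp (eta * ln (y / (y - 1)))).
  2: { unfold Rpower. rewrite <- exp_plus, ln_div by lra. f_equal. ring. }
  replace (Rpower y (- (1 + eta))) with (Rpower y (- eta) * / y).
  2: { unfold Rpower. rewrite <- (exp_ln y) at 2 by lra. rewrite <- exp_Ropp, <- exp_plus. f_equal. ring. }
  pose proof (exp_ineq1_le (eta * ln (y / (y - 1)))) as H1.
  assert (Hq : 0 < y / (y - 1)) by (apply Rdiv_lt_0_compat; lra).
  pose proof (ln_ge_1_minus_inv _ Hq) as H2.
  replace (1 - / (y / (y - 1))) with (/ y) in H2 by (field; lra).
  assert (H3 : eta * / y <= eta * ln (y / (y - 1))) by (apply Rmult_le_compat_l; lra).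
  pose proof (Rpower_pos y (- eta)) as HP. set (P := Rpower y (- eta)) in *.
  replace (/ eta * (P * exp (eta * ln (y / (y - 1))) - P)) with (P * (/ eta * (exp (eta * ln (y / (y - 1)))
    - 1))) by ring.
  apply Rmult_le_compat_l; [lra|].
  apply Rmult_le_reg_l with eta; auto. rewrite <- Rmult_assoc, Rinv_r by lra. lra.
Qed.

Lemma ex_series_Rpower eta : 0 < eta -> ex_series (fun k => Rpower (INR (S k)) (- (1 + eta))).
Proof.
  intros He. apply (ex_series_incr_1 (V := R_NormedModule)).
  apply ex_series_telescope with (F := fun n => / eta * Rpower (INR (S n)) (- eta)) (M := 0).
  - intros n. split; [left; apply Rpower_pos|].
    assert (1 < INR (S (S n))) by (rewrite <- INR_1; apply lt_INR; lia).
    eapply Rle_trans; [apply Rpower_telescope; eauto|].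
    rewrite Rmult_minus_distr_l. apply Req_le. f_equal. f_equal. f_equal.
    rewrite (S_INR (S n)). ring.
  - intros n. apply Rmult_le_pos; [left; now apply Rinv_0_lt_compat|left; apply Rpower_pos].
Qed.

Lemma ex_series_inv_sqr : ex_series (fun k => / (INR (S k) * INR (S k))).
Proof.
  apply (ex_series_ext (V := R_NormedModule)) with (2 := ex_series_Rpower 1 ltac:(lra)).
  intros k. assert (0 < INR (S k)) by (apply lt_0_INR; lia).
  replace (- (1 + 1)) with (- INR 2) by (simpl; ring).
  rewrite Rpower_Ropp, Rpower_pow by auto. simpl. f_equal. ring.
Qed.

Lemma INR_S_pos k : 0 < INR (S k).
Proof. apply lt_0_INR; lia. Qed.

Lemma INR_S_ge1 k : 1 <= INR (S k).
Proof. rewrite <- INR_1. apply le_INR; lia. Qed.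

Lemma ln_INR_ge0 k : 0 <= ln (INR (S k)).
Proof.
  rewrite <- ln_1. destruct (INR_S_ge1 k) as [H|H]; [left; apply ln_increasing; lra|rewrite <- H; lra].
Qed.

Lemma cpow_plus a z w : cpow a (z + w) = (cpow a z * cpow a w)%C.
Proof. unfold cpow. rewrite <- cexp_plus. f_equal. ring. Qed.

Lemma cpow_neq_0 a z : cpow a z <> RtoC 0.
Proof. apply cexp_neq_0. Qed.

Lemma Cmod_cpow a z : Cmod (cpow a z) = Rpower a (Re z).
Proof. unfold cpow, Rpower. rewrite Cmod_cexp. f_equal. destruct z; simpl. ring. Qed.

Lemma inv_cexp z : (/ cexp z)%C = cexp (- z).
Proof.
  pose proof (cexp_neq_0 z).
  assert (E : (cexp z * cexp (- z) = 1)%C)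
    by (rewrite <- cexp_plus; replace (z + - z)%C with (RtoC 0) by ring; apply cexp_0).
  replace (cexp (- z)) with (/ cexp z * (cexp z * cexp (- z)))%C by (field; auto). rewrite E. ring.
Qed.

Lemma inv_cpow a z : (/ cpow a z)%C = cexp (- z * RtoC (ln a)).
Proof. unfold cpow. rewrite inv_cexp. f_equal. ring. Qed.

Lemma cpow_RtoC a b : cpow a (RtoC b) = RtoC (Rpower a b).
Proof. unfold cpow, Rpower. rewrite <- RtoC_mult, cexp_RtoC. auto. Qed.

Lemma cpow_INR a n : 0 < a -> cpow a (RtoC (INR n)) = RtoC (a ^ n).
Proof. intros H. rewrite cpow_RtoC, Rpower_pow; auto. Qed.

Lemma ln_le_Rpower y eta : 1 <= y -> 0 < eta -> ln y <= / eta * Rpower y eta.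
Proof.
  intros Hy He. pose proof (exp_ineq1_le (eta * ln y)) as H. fold (Rpower y eta) in H.
  apply Rmult_le_reg_l with eta; auto. rewrite <- Rmult_assoc, Rinv_r by lra. lra.
Qed.

Definition dirichlet_term (G : nat -> R) (z : C) (k : nat) : C := (RtoC (G (S k)) / cpow (INR (S k)) z)%C.

(** A total function of z; its value is meaningful where the series converges, as in
    [dirichlet_correct]. *)
Definition dirichlet (G : nat -> R) (z : C) : C :=
  epsilon (inhabits (RtoC 0)) (fun l => Cis_series (dirichlet_term G z) l).

Lemma Rpower_le_exp y a b : 1 <= y -> a <= b -> Rpower y a <= Rpower y b.
Proof. intros [H|<-] Hab; [now apply Rle_Rpower; lra|]. unfold Rpower. rewrite ln_1, !Rmult_0_r. lra. Qed.

Lemma dirichlet_correct G B de z : (forall k, Rabs (G (S k)) <= B * Rpower (INR (S k)) (- de)) ->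
  1 - de < Re z -> Cis_series (dirichlet_term G z) (dirichlet G z).
Proof.
  intros HG Hz. apply (epsilon_spec (inhabits (RtoC 0)) (fun l => Cis_series (dirichlet_term G z) l)).
  apply Cex_series_le with (b := fun k => B * Rpower (INR (S k)) (- (1 + (Re z + de - 1)))).
  - intros k. unfold dirichlet_term. rewrite Cmod_div, Cmod_R, Cmod_cpow by apply cpow_neq_0.
    replace (- (1 + (Re z + de - 1))) with (- de + - Re z) by ring. rewrite Rpower_plus, Rpower_Ropp with
      (y := Re z).
    rewrite <- Rmult_assoc. apply Rmult_le_compat_r; auto. left. apply Rinv_0_lt_compat, Rpower_pos.
  - apply (ex_series_scal_l (V := R_NormedModule) B). apply ex_series_Rpower. lra.
Qed.

(** The term at y is the term at z times cexp(-(y - z) L) with L = ln n. For |y - z| < eta,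
    [cexp_quad] costs L^2 n^eta, and L <= n^eta / eta turns this into n^(3 eta). With eta a quarter
    of the available margin, the weights are of size n^-(1 + eta). *)
Lemma dirichlet_deriv G B de z : (forall k, Rabs (G (S k)) <= B * Rpower (INR (S k)) (- de)) -> 0 <= B ->
  1 - de < Re z ->
  exists V, Cis_series (dirichlet_term (fun m => - (G m * ln (INR m))) z) V /\ Cderiv (dirichlet G) z V.
Proof.
  intros HG HB Hz. set (eta := (Re z + de - 1) / 4). assert (He : 0 < eta) by (unfold eta; lra).
  assert (HV : exists V, Cis_series (dirichlet_term (fun m => - (G m * ln (INR m))) z) V).
  { exists (dirichlet (fun m => - (G m * ln (INR m))) z).
    apply dirichlet_correct with (B := B * / eta) (de := de - eta); [|unfold eta; lra].
    intros k. rewrite Rabs_Ropp, Rabs_mult. rewrite (Rabs_pos_eq (ln _)) by apply ln_INR_ge0.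
    replace (- (de - eta)) with (- de + eta) by ring. rewrite Rpower_plus.
    replace (B * / eta * (Rpower (INR (S k)) (- de) * Rpower (INR (S k)) eta)) with
      ((B * Rpower (INR (S k)) (- de)) * (/ eta * Rpower (INR (S k)) eta)) by ring.
    apply Rmult_le_compat; auto. apply Rabs_pos. apply ln_INR_ge0. apply ln_le_Rpower; auto. apply
      INR_S_ge1. }
  destruct HV as [V HV]. exists V. split; auto.
  apply (series_Cderiv (fun k z => dirichlet_term G z k) (dirichlet_term (fun m => - (G m * ln (INR m))) z)
    (fun k => B * (32 * (/ eta * / eta)) * Rpower (INR (S k)) (- (1 + eta))) (dirichlet G) V z eta); auto.
  - apply (ex_series_scal_l (V := R_NormedModule)). now apply ex_series_Rpower.
  - intros k y Hy. unfold dirichlet_term.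
    pose proof (ln_INR_ge0 k) as HL. pose proof (INR_S_ge1 k) as H1.
    set (L := ln (INR (S k))) in *. set (h := (y - z)%C) in *.
    assert (Ey : (/ cpow (INR (S k)) y = / cpow (INR (S k)) z * cexp (- h * RtoC L))%C).
    { rewrite !inv_cpow, <- cexp_plus. f_equal. unfold h, L. ring. }
    unfold Cdiv. rewrite Ey, RtoC_opp, RtoC_mult.
    match goal with |- Cmod ?X <= _ => replace X with
      (RtoC (G (S k)) * / cpow (INR (S k)) z * (cexp (- h * RtoC L) - 1 - (- h * RtoC L)))%C by ring end.
    rewrite !Cmod_mult, Cmod_R, Cmod_inv, Cmod_cpow by apply cpow_neq_0.
    assert (Em : Cmod (- h * RtoC L) = Cmod h * L).
    { rewrite Cmod_mult, Cmod_opp, Cmod_R, Rabs_pos_eq; auto. }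
    assert (HQ : Cmod (cexp (- h * RtoC L) - 1 - - h * RtoC L) <= 32 * ((Cmod h * L) * (Cmod h * L)) *
      Rpower (INR (S k)) eta).
    { eapply Rle_trans; [apply cexp_quad|]. rewrite Em.
      apply Rmult_le_compat_l.
      - pose proof (Cmod_ge_0 h). nra.
      - unfold Rpower. apply exp_le_mono. fold L. apply Rmult_le_compat_r; lra. }
    eapply Rle_trans.
    { apply Rmult_le_compat; [|apply Cmod_ge_0| |apply HQ].
      - apply Rmult_le_pos; [apply Rabs_pos|left; apply Rinv_0_lt_compat, Rpower_pos].
      - apply Rmult_le_compat_r; [left; apply Rinv_0_lt_compat, Rpower_pos|apply HG]. }
    pose proof (ln_le_Rpower _ eta H1 He) as HL2. fold L in HL2.
    assert (HLL : L * L <= (/ eta * Rpower (INR (S k)) eta) * (/ eta * Rpower (INR (S k)) eta)) by (apply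
      Rmult_le_compat; auto).
    replace (Rpower (INR (S k)) (- (1 + eta))) with (Rpower (INR (S k)) (- de) * / Rpower (INR (S k)) (Re z) *
      (Rpower (INR (S k)) eta * Rpower (INR (S k)) eta * Rpower (INR (S k)) eta)).
    2: { rewrite <- Rpower_Ropp, <- !Rpower_plus. f_equal. unfold eta. field. }
    set (P1 := Rpower (INR (S k)) (- de)) in *. set (P2 := / Rpower (INR (S k)) (Re z)).
    set (P3 := Rpower (INR (S k)) eta) in *.
    assert (0 < P1) by apply Rpower_pos. assert (0 < P2) by apply Rinv_0_lt_compat, Rpower_pos. assert (0 <
      P3) by apply Rpower_pos.
    replace (B * P1 * P2 * (32 * (Cmod h * L * (Cmod h * L)) * P3)) with
      ((B * P1 * P2 * P3 * 32 * (Cmod h * Cmod h)) * (L * L)) by ring.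
    replace (B * (32 * (/ eta * / eta)) * (P1 * P2 * (P3 * P3 * P3)) * (Cmod h * Cmod h)) with
      ((B * P1 * P2 * P3 * 32 * (Cmod h * Cmod h)) * ((/ eta * P3) * (/ eta * P3))) by ring.
    apply Rmult_le_compat_l; auto. pose proof (Cmod_ge_0 h).
    repeat apply Rmult_le_pos; lra.
  - intros y Hy. apply dirichlet_correct with (B := B) (de := de); auto.
    pose proof (re_le_Cmod (y - z)) as H1. unfold Cminus in H1 at 1. rewrite re_plus, re_opp in H1.
    assert (H2 := Rle_lt_trans _ _ _ H1 Hy). apply Rabs_lt_between in H2. unfold eta in *. lra.
Qed.

(** * The Gamma function *)

(** For a nonnegative integrand the improper integral is the supremum of the integrals over compact
    segments. All later arguments about [Gamma] thus become inequalities between proper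
    integrals. *)
Lemma RInt_gen_nonneg (f : R -> R) (M : R) :
  (forall u, 0 < u -> continuous f u) -> (forall u, 0 < u -> 0 <= f u) ->
  (forall a b, 0 < a -> a <= b -> RInt f a b <= M) ->
  let l := RInt_gen f (at_right 0) (Rbar_locally p_infty) in
  (forall a b, 0 < a -> a <= b -> RInt f a b <= l) /\
  (forall e, 0 < e -> exists A B, 0 < A /\ A <= B /\ forall a b, 0 < a <= A -> B <= b -> l - e < RInt f a b).
Proof.
  intros Hc Hp HM l.
  assert (Hex : forall a b, 0 < a -> a <= b -> ex_RInt f a b).
  { intros a b Ha Hab. apply (ex_RInt_continuous (V := R_CompleteNormedModule)). intros z Hz.
    rewrite Rmin_left in Hz by auto. apply Hc. lra. }
  assert (Hpos : forall a b, 0 < a -> a <= b -> 0 <= RInt f a b).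
  { intros a b Ha Hab. apply RInt_ge_0; auto. intros. apply Hp. lra. }
  assert (Hmono : forall a b A B, 0 < a <= A -> A <= B -> B <= b -> RInt f A B <= RInt f a b).
  { intros a b A B Ha HAB Hb.
    rewrite <- (RInt_Chasles (V := R_CompleteNormedModule) f a A b) by (apply Hex; lra).
    rewrite <- (RInt_Chasles (V := R_CompleteNormedModule) f A B b) by (apply Hex; lra).
    pose proof (Hpos a A ltac:(lra) ltac:(lra)). pose proof (Hpos B b ltac:(lra) ltac:(lra)).
    unfold plus; simpl. lra. }
  set (S := fun v => exists a b, 0 < a /\ a <= b /\ v = RInt f a b).
  destruct (completeness S) as [m [M1 M2]].
  { exists M. intros v [a [b [Ha [Hab ->]]]]. auto. }
  { exists (RInt f 1 1), 1, 1. repeat split; lra. }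
  assert (Hm : forall a b, 0 < a -> a <= b -> RInt f a b <= m).
  { intros a b Ha Hab. apply M1. exists a, b. auto. }
  assert (Hm2 : forall e, 0 < e -> exists A B, 0 < A /\ A <= B /\ forall a b, 0 < a <= A -> B <= b -> m - e
    < RInt f a b).
  { intros e He. destruct (classic (exists v, S v /\ m - e < v)) as [[v [[A [B [HA [HAB ->]]]] Hv]]|N].
    - exists A, B. repeat split; auto. intros a b Ha Hb. specialize (Hmono a b A B Ha HAB Hb). lra.
    - exfalso. assert (m <= m - e); [|lra]. apply M2. intros v Hv. apply Rnot_lt_le. intros H. apply N.
      exists v. auto. }
  assert (El : l = m); [|rewrite El; auto].
  apply is_RInt_gen_unique. intros P [e He].
  destruct (Hm2 e (cond_pos e)) as [A [B [HA [HAB H]]]].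
  apply Filter_prod with (Q := fun a => 0 < a <= A) (R := fun b => B <= b).
  - exists (mkposreal A HA). intros y Hy Hy0. unfold ball in Hy; simpl in Hy.
    unfold AbsRing_ball, abs, minus, plus, opp in Hy; simpl in Hy. apply Rabs_lt_between in Hy. lra.
  - exists B. intros y Hy. lra.
  - intros a b Ha Hb. exists (RInt f a b). split.
    + apply (RInt_correct (V := R_CompleteNormedModule)). apply Hex; simpl; lra.
    + apply He. unfold ball; simpl. unfold AbsRing_ball, abs, minus, plus, opp; simpl.
      specialize (H a b Ha Hb). specialize (Hm a b ltac:(lra) ltac:(lra)).
      apply Rabs_lt_between. lra.
Qed.

Definition gamma_kernel (x u : R) : R := Rpower u (x - 1) * exp (- u).

Lemma gamma_kernel_exp x u : gamma_kernel x u = exp ((x - 1) * ln u - u).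
Proof. unfold gamma_kernel, Rpower. rewrite <- exp_plus. f_equal. Qed.

Lemma gamma_kernel_pos x u : 0 < gamma_kernel x u.
Proof. rewrite gamma_kernel_exp. apply exp_pos. Qed.

Lemma gamma_kernel_cont x u : 0 < u -> continuous (gamma_kernel x) u.
Proof.
  intros Hu. apply (ex_derive_continuous (V := R_NormedModule)). unfold gamma_kernel, Rpower. auto_derive.
    auto.
Qed.

(** This is ln (u / c) <= u / c - 1 multiplied by c. *)
Lemma Rpower_exp_bound c u : 0 < c -> 0 < u -> Rpower u c * exp (- u) <= Rpower c c.
Proof.
  intros Hc Hu. unfold Rpower. rewrite <- exp_plus. apply exp_le_mono.
  assert (Hq : 0 < u / c) by (apply Rdiv_lt_0_compat; auto).
  pose proof (exp_ineq1_le (ln (u / c))) as H. rewrite exp_ln in H by auto. rewrite ln_div in H by auto.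
  apply Rmult_le_compat_l with (r := c) in H; [|lra].
  replace (c * (u / c)) with u in H by (field; lra). lra.
Qed.

Lemma ex_RInt_gamma x a b : 0 < a -> a <= b -> ex_RInt (gamma_kernel x) a b.
Proof.
  intros Ha Hab. apply (ex_RInt_continuous (V := R_CompleteNormedModule)). intros z Hz.
  rewrite Rmin_left in Hz by auto. apply gamma_kernel_cont. lra.
Qed.

(* Comparison with the derivative of the bounded function [u^x / (1 + u^x)]. *)
Lemma gamma_int_bounded x : 0 < x -> exists M, forall a b, 0 < a -> a <= b -> RInt (gamma_kernel x) a b <= M.
Proof.
  (* From (1 + q)^2 <= 2 + 2 q^2 with q = u^x, and u^(2x) exp(-u) <= (2x)^(2x). *)
  intros Hx. set (K := (2 + 2 * Rpower (2 * x) (2 * x)) / x).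
  assert (HK : 0 < K). { apply Rdiv_lt_0_compat; auto. pose proof (Rpower_pos (2 * x) (2 * x)). lra. }
  exists K. intros a b Ha Hab.
  set (H := fun u => - K / (1 + Rpower u x)).
  set (H' := fun u => K * (x * Rpower u (x - 1)) / ((1 + Rpower u x) * (1 + Rpower u x))).
  assert (HD : forall u, 0 < u -> is_derive H u (H' u)).
  { intros u Hu. unfold H, H', Rpower. pose proof (exp_pos (x * ln u)).
    auto_derive; [split; auto; split; auto; lra|].
    replace (exp ((x - 1) * ln u)) with (exp (x * ln u) * / u).
    - field. split; lra.
    - rewrite <- (exp_ln u) at 2 by auto. rewrite <- exp_Ropp, <- exp_plus. f_equal. ring. }
  assert (HC : forall u, 0 < u -> continuous H' u).
  { intros u Hu. apply (ex_derive_continuous (V := R_NormedModule)). unfold H', Rpower.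
    pose proof (exp_pos (x * ln u)). auto_derive. repeat split; auto. apply Rgt_not_eq. nra. }
  assert (HI : is_RInt H' a b (H b - H a)).
  { apply (is_RInt_derive (V := R_CompleteNormedModule) H H').
    - intros u Hu. rewrite Rmin_left in Hu by auto. apply HD. lra.
    - intros u Hu. rewrite Rmin_left in Hu by auto. apply HC. lra. }
  apply Rle_trans with (H b - H a).
  - rewrite <- (is_RInt_unique _ _ _ _ HI). apply RInt_le; auto.
    + now apply ex_RInt_gamma.
    + eexists; eauto.
    + intros u Hu. unfold gamma_kernel, H'. pose proof (Rpower_pos u (x - 1)) as P1. pose proof (Rpower_pos
      u x) as P2.
      assert (B : exp (- u) * ((1 + Rpower u x) * (1 + Rpower u x)) <= K * x).
      { replace (K * x) with (2 + 2 * Rpower (2 * x) (2 * x)) by (unfold K; field; lra).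
        pose proof (Rpower_exp_bound (2 * x) u ltac:(lra) ltac:(lra)) as B1.
        replace (2 * x) with (x + x) in B1 at 1 by ring. rewrite Rpower_plus in B1.
        assert (B2 : 0 < exp (- u) <= 1).
        { split; [apply exp_pos|]. rewrite <- exp_0. apply exp_le_mono. lra. }
        set (E := exp (- u)) in *. set (q := Rpower u x) in *.
        assert ((1 + q) * (1 + q) <= 2 + 2 * (q * q)) by (pose proof (Rle_0_sqr (1 - q)); unfold Rsqr in *;
          lra).
        apply Rle_trans with (E * (2 + 2 * (q * q))); [apply Rmult_le_compat_l; lra|]. nra. }
      apply (Rle_div_r _ _ ((1 + Rpower u x) * (1 + Rpower u x))); [apply Rmult_lt_0_compat; lra|].
      replace (Rpower u (x - 1) * exp (- u) * ((1 + Rpower u x) * (1 + Rpower u x)))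
        with (Rpower u (x - 1) * (exp (- u) * ((1 + Rpower u x) * (1 + Rpower u x)))) by ring.
      replace (K * (x * Rpower u (x - 1))) with (Rpower u (x - 1) * (K * x)) by ring.
      apply Rmult_le_compat_l; lra.
  - unfold H. assert (Q : forall u, 0 < K / (1 + Rpower u x) <= K).
    { intros u. pose proof (Rpower_pos u x). split; [apply Rdiv_lt_0_compat; lra|]. apply Rle_div_l; nra. }
    pose proof (Q a). pose proof (Q b). unfold Rdiv in *. lra.
Qed.

Lemma Gamma_spec x : 0 < x ->
  (forall a b, 0 < a -> a <= b -> RInt (gamma_kernel x) a b <= Gamma x) /\
  (forall e, 0 < e -> exists A B, 0 < A /\ A <= B /\ forall a b, 0 < a <= A -> B <= b -> Gamma x - e < RInt
    (gamma_kernel x) a b).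
Proof.
  intros Hx. destruct (gamma_int_bounded x Hx) as [M HM].
  apply (RInt_gen_nonneg (gamma_kernel x) M); auto.
  - intros. now apply gamma_kernel_cont.
  - intros. left. apply gamma_kernel_pos.
Qed.

Lemma Gamma_pos x : 0 < x -> 0 < Gamma x.
Proof.
  intros Hx. destruct (Gamma_spec x Hx) as [H _]. eapply Rlt_le_trans; [|apply (H 1 2); lra].
  apply RInt_gt_0; [lra| |].
  - intros. apply gamma_kernel_pos.
  - intros. apply gamma_kernel_cont. lra.
Qed.

Lemma Gamma_by_parts x a b : 0 < x -> 0 < a -> a <= b ->
  RInt (gamma_kernel (x + 1)) a b = x * RInt (gamma_kernel x) a b + (Rpower a x * exp (- a) - Rpower b x *
    exp (- b)).
Proof.
  intros Hx Ha Hab.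
  assert (HI : is_RInt (fun u => gamma_kernel (x + 1) u - x * gamma_kernel x u) a b
     ((fun u => - (Rpower u x * exp (- u))) b - (fun u => - (Rpower u x * exp (- u))) a)).
  { apply (is_RInt_derive (V := R_CompleteNormedModule) (fun u => - (Rpower u x * exp (- u)))).
    - intros u Hu. rewrite Rmin_left in Hu by auto. unfold gamma_kernel, Rpower.
      auto_derive; [lra|]. replace (x + 1 - 1) with x by ring.
      replace (exp ((x - 1) * ln u)) with (exp (x * ln u) * / u).
      + field. lra.
      + rewrite <- (exp_ln u) at 2 by lra. rewrite <- exp_Ropp, <- exp_plus. f_equal. ring.
    - intros u Hu. rewrite Rmin_left in Hu by auto. apply (ex_derive_continuous (V := R_NormedModule)).
      unfold gamma_kernel, Rpower. auto_derive. lra. }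
  pose proof (is_RInt_unique _ _ _ _ HI) as E.
  rewrite (RInt_minus (V := R_CompleteNormedModule) (gamma_kernel (x + 1)) (fun u => scal x (gamma_kernel x
    u))) in E.
  - rewrite (RInt_scal (V := R_CompleteNormedModule)) in E by now apply ex_RInt_gamma.
    unfold minus, plus, opp, scal in E; simpl in E. unfold mult in E; simpl in E. lra.
  - now apply ex_RInt_gamma.
  - apply (ex_RInt_scal (V := R_NormedModule)). now apply ex_RInt_gamma.
Qed.

Lemma Gamma_S x : 0 < x -> Gamma (x + 1) = x * Gamma x.
Proof.
  intros Hx. destruct (Gamma_spec x Hx) as [G1 G2]. destruct (Gamma_spec (x + 1) ltac:(lra)) as [G3 G4].
  apply cond_eq. intros e He. set (e' := e / (4 * (1 + x))).
  assert (He' : 0 < e') by (apply Rdiv_lt_0_compat; lra).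
  assert (Ee : e = 4 * (1 + x) * e') by (unfold e'; field; lra).
  destruct (G2 e' He') as [A1 [B1 [HA1 [HAB1 H1]]]]. destruct (G4 e' He') as [A2 [B2 [HA2 [HAB2 H2]]]].
  set (K := Rpower (x + 1) (x + 1)).
  (* Here exp (ln e' / x) is e'^(1/x), so that a^x <= e'; and b >= K / e' gives b^x exp(-b) <= K / b
     <= e'. Both boundary terms of the integration by parts are then small. *)
  set (a := Rmin (Rmin A1 A2) (exp (ln e' / x))).
  set (b := Rmax (Rmax B1 B2) (K / e')).
  assert (Ha : 0 < a) by (repeat apply Rmin_pos; auto; apply exp_pos).
  assert (a <= A1 /\ a <= A2 /\ a <= exp (ln e' / x)) as [Ha1 [Ha2 Ha3]].
  { unfold a. pose proof (Rmin_l (Rmin A1 A2) (exp (ln e' / x))). pose proof (Rmin_r (Rmin A1 A2) (exp (ln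
    e' / x))).
    pose proof (Rmin_l A1 A2). pose proof (Rmin_r A1 A2). lra. }
  assert (B1 <= b /\ B2 <= b /\ K / e' <= b) as [Hb1 [Hb2 Hb3]].
  { unfold b. pose proof (Rmax_l (Rmax B1 B2) (K / e')). pose proof (Rmax_r (Rmax B1 B2) (K / e')).
    pose proof (Rmax_l B1 B2). pose proof (Rmax_r B1 B2). lra. }
  specialize (H1 a b ltac:(lra) ltac:(lra)). specialize (H2 a b ltac:(lra) ltac:(lra)).
  specialize (G1 a b Ha ltac:(lra)). specialize (G3 a b Ha ltac:(lra)).
  pose proof (Gamma_by_parts x a b Hx Ha ltac:(lra)) as E.
  assert (Q1 : 0 < Rpower a x * exp (- a) <= e').
  { split; [apply Rmult_lt_0_compat; apply exp_pos|].
    apply Rle_trans with (Rpower a x * 1).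
    - apply Rmult_le_compat_l; [left; apply Rpower_pos|]. rewrite <- exp_0. apply exp_le_mono. lra.
    - rewrite Rmult_1_r. unfold Rpower. rewrite <- (exp_ln e') by auto. apply exp_le_mono.
      apply Rle_trans with (x * (ln e' / x)); [|apply Req_le; field; lra].
      apply Rmult_le_compat_l; [lra|]. rewrite <- (ln_exp (ln e' / x)). apply ln_le; auto. }
  assert (Hb : 0 < b) by lra.
  assert (Q2 : 0 < Rpower b x * exp (- b) <= e').
  { split; [apply Rmult_lt_0_compat; apply exp_pos|].
    pose proof (Rpower_exp_bound (x + 1) b ltac:(lra) Hb) as Q. fold K in Q.
    rewrite Rpower_plus, Rpower_1 in Q by auto. apply Rle_div_l in Hb3; auto.
    apply Rmult_le_reg_r with b; auto. lra. }
  rewrite E in H2, G3. apply Rabs_lt_between. rewrite Ee.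
  set (I := RInt (gamma_kernel x) a b) in *.
 nra.
Qed.

(** * Log-convexity of Gamma *)

Lemma exp_convex la a b : 0 <= la <= 1 -> exp (la * a + (1 - la) * b) <= la * exp a + (1 - la) * exp b.
Proof.
  intros Hl. set (m := la * a + (1 - la) * b).
  assert (H : forall t, exp m * (1 + (t - m)) <= exp t).
  { intros t. replace t with (m + (t - m)) at 2 by ring. rewrite exp_plus.
    apply Rmult_le_compat_l; [left; apply exp_pos|apply exp_ineq1_le]. }
  pose proof (Rmult_le_compat_l la _ _ ltac:(lra) (H a)).
  pose proof (Rmult_le_compat_l (1 - la) _ _ ltac:(lra) (H b)).
  assert (la * (exp m * (1 + (a - m))) + (1 - la) * (exp m * (1 + (b - m))) = exp m) by (unfold m; ring).
  lra.
Qed.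

Definition lnGamma (x : R) : R := ln (Gamma x).

(** Hoelder's inequality by way of Young's: convexity of exp is applied pointwise to the integrands
    normalised by Gamma p and Gamma q, and the result is integrated over a compact segment. *)
Lemma lnGamma_convex la p q : 0 <= la <= 1 -> 0 < p -> 0 < q ->
  lnGamma (la * p + (1 - la) * q) <= la * lnGamma p + (1 - la) * lnGamma q.
Proof.
  intros Hl Hp Hq. set (m := la * p + (1 - la) * q).
  assert (Hm : 0 < m) by (unfold m; nra).
  set (T := la * lnGamma p + (1 - la) * lnGamma q).
  destruct (Gamma_spec m Hm) as [_ Gm]. destruct (Gamma_spec p Hp) as [Gp _]. destruct (Gamma_spec q Hq) as
    [Gq _].
  pose proof (Gamma_pos p Hp) as Pp. pose proof (Gamma_pos q Hq) as Pq.
  unfold lnGamma at 1. rewrite <- (ln_exp T). apply ln_le; [now apply Gamma_pos|].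
  apply le_epsilon. intros e He. destruct (Gm e He) as [a [b [Ha [Hab H]]]].
  specialize (H a b ltac:(lra) ltac:(lra)). specialize (Gp a b Ha Hab). specialize (Gq a b Ha Hab).
  enough (RInt (gamma_kernel m) a b <= exp T) by lra.
  apply Rle_trans with (RInt (fun u => scal (exp T * la / Gamma p) (gamma_kernel p u) + scal (exp T * (1 -
    la) / Gamma q) (gamma_kernel q u)) a b).
  - apply RInt_le; auto.
    + now apply ex_RInt_gamma.
    + apply (ex_RInt_plus (V := R_NormedModule)); apply (ex_RInt_scal (V := R_NormedModule)); now apply
      ex_RInt_gamma.
    + intros u Hu. unfold scal; simpl. unfold mult; simpl. rewrite !gamma_kernel_exp.
      pose proof (exp_convex la ((p - 1) * ln u - u - lnGamma p) ((q - 1) * ln u - u - lnGamma q) Hl) as C.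
      assert (EG : forall al g, 0 < g -> exp (al - ln g) = exp al / g).
      { intros al g Hg. unfold Rminus. rewrite exp_plus, exp_Ropp, exp_ln; auto. }
      unfold lnGamma in C. rewrite !EG in C by auto. fold (lnGamma p) (lnGamma q) in C.
      replace ((m - 1) * ln u - u) with (T + (la * ((p - 1) * ln u - u - lnGamma p) + (1 - la) * ((q - 1) *
        ln u - u - lnGamma q)))
        by (unfold m, T; ring).
      rewrite exp_plus. eapply Rle_trans; [apply Rmult_le_compat_l; [left; apply exp_pos|exact C]|].
      apply Req_le. field. lra.
  - rewrite (RInt_plus (V := R_CompleteNormedModule)), !(RInt_scal (V := R_CompleteNormedModule)).
    + unfold plus, scal; simpl. unfold mult; simpl.
      set (Ip := RInt (gamma_kernel p) a b) in *. set (Iq := RInt (gamma_kernel q) a b) in *.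
      pose proof (exp_pos T) as PT.
      assert (Ip / Gamma p <= 1) by (apply Rle_div_l; lra). assert (Iq / Gamma q <= 1) by (apply Rle_div_l;
        lra).
      replace (exp T * la / Gamma p * Ip + exp T * (1 - la) / Gamma q * Iq)
        with (exp T * (la * (Ip / Gamma p) + (1 - la) * (Iq / Gamma q))) by (field; lra).
      rewrite <- (Rmult_1_r (exp T)) at 2. apply Rmult_le_compat_l; [lra|].
      assert (la * (Ip / Gamma p) <= la * 1) by (apply Rmult_le_compat_l; lra).
      assert ((1 - la) * (Iq / Gamma q) <= (1 - la) * 1) by (apply Rmult_le_compat_l; lra). lra.
    + now apply ex_RInt_gamma.
    + now apply ex_RInt_gamma.
    + apply (ex_RInt_scal (V := R_NormedModule)); now apply ex_RInt_gamma.
    + apply (ex_RInt_scal (V := R_NormedModule)); now apply ex_RInt_gamma.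
Qed.

(** * Digamma *)

Lemma is_derive_quad (f : R -> R) x l M d : 0 < d ->
  (forall h, Rabs h < d -> Rabs (f (x + h) - f x - l * h) <= M * (h * h)) -> is_derive f x l.
Proof.
  intros Hd H. apply is_derive_Reals. intros e He.
  set (K := Rabs M + 1). assert (HK : 0 < K) by (unfold K; pose proof (Rabs_pos M); lra).
  assert (Hq : 0 < Rmin d (e / K)) by (apply Rmin_pos; auto; now apply Rdiv_lt_0_compat).
  exists (mkposreal _ Hq). intros h Hh0 Hh. simpl in Hh.
  assert (H1 := Rlt_le_trans _ _ _ Hh (Rmin_l _ _)). assert (H2 := Rlt_le_trans _ _ _ Hh (Rmin_r _ _)).
  replace ((f (x + h) - f x) / h - l) with ((f (x + h) - f x - l * h) / h) by (field; auto).
  unfold Rdiv. rewrite Rabs_mult, Rabs_inv. apply Rabs_pos_lt in Hh0 as Hp.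
  apply Rlt_div_l; auto. eapply Rle_lt_trans; [apply H; auto|].
  replace (h * h) with (Rabs h * Rabs h) by (rewrite <- Rabs_mult; apply Rabs_pos_eq; nra).
  apply Rlt_div_r in H2; auto. rewrite <- Rmult_assoc. apply Rmult_lt_compat_r; auto.
  eapply Rle_lt_trans; [|apply H2]. rewrite Rmult_comm. apply Rmult_le_compat_l; [lra|].
  unfold K. pose proof (Rle_abs M). lra.
Qed.

(** By the functional equation the chords of ln Gamma over [z - 1, z] and [z, z + 1] have slopes ln
    (z - 1) and ln z. Convexity squeezes the increment at z between them, as in the Bohr-Mollerup
    theorem. The weight h / (1 + h) writes z as a mean of z - 1 and z + h. *)
Lemma ln_slope_bound z h : 1 < z -> Rabs h <= 1 ->
  Rabs (lnGamma (z + h) - lnGamma z - h * ln z) <= Rabs h * (ln z - ln (z - 1)).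
Proof.
  intros Hz Hh.
  assert (HS : forall y, 0 < y -> lnGamma (y + 1) = lnGamma y + ln y).
  { intros y Hy. unfold lnGamma. rewrite Gamma_S, ln_mult by (auto using Gamma_pos). ring. }
  pose proof (HS z ltac:(lra)) as E1. pose proof (HS (z - 1) ltac:(lra)) as E2.
  replace (z - 1 + 1) with z in E2 by ring.
  assert (Hln : ln (z - 1) <= ln z) by (apply ln_le; lra).
  destruct (Rle_dec 0 h) as [H0|H0].
  - rewrite (Rabs_pos_eq h) in Hh |- * by auto.
    pose proof (lnGamma_convex (1 - h) z (z + 1) ltac:(lra) ltac:(lra) ltac:(lra)) as C1.
    replace ((1 - h) * z + (1 - (1 - h)) * (z + 1)) with (z + h) in C1 by ring.
    pose proof (lnGamma_convex (h / (1 + h)) (z - 1) (z + h)) as C2.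
    assert (Hq : 0 <= h / (1 + h) <= 1).
    { split; [apply Rdiv_le_0_compat; lra|apply Rle_div_l; lra]. }
    specialize (C2 Hq ltac:(lra) ltac:(lra)).
    replace (h / (1 + h) * (z - 1) + (1 - h / (1 + h)) * (z + h)) with z in C2 by (field; lra).
    apply Rmult_le_compat_l with (r := 1 + h) in C2; [|lra].
    replace ((1 + h) * (h / (1 + h) * lnGamma (z - 1) + (1 - h / (1 + h)) * lnGamma (z + h)))
      with (h * lnGamma (z - 1) + lnGamma (z + h)) in C2 by (field; lra).
    rewrite E1 in C1.
    assert (Q1 : h * lnGamma z = h * lnGamma (z - 1) + h * ln (z - 1)) by (rewrite E2; ring).
    apply Rabs_le. lra.
  - apply Rnot_le_lt in H0. rewrite (Rabs_left h) in Hh |- * by auto. set (g := - h) in *.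
    assert (Hg : 0 < g) by (unfold g; lra).
    replace (z + h) with (z - g) by (unfold g; ring). replace h with (- g) by (unfold g; ring).
    pose proof (lnGamma_convex (1 - g) z (z - 1) ltac:(lra) ltac:(lra) ltac:(lra)) as C1.
    replace ((1 - g) * z + (1 - (1 - g)) * (z - 1)) with (z - g) in C1 by ring.
    pose proof (lnGamma_convex (g / (1 + g)) (z + 1) (z - g)) as C2.
    assert (Hq : 0 <= g / (1 + g) <= 1).
    { split; [apply Rdiv_le_0_compat; lra|apply Rle_div_l; lra]. }
    specialize (C2 Hq ltac:(lra) ltac:(lra)).
    replace (g / (1 + g) * (z + 1) + (1 - g / (1 + g)) * (z - g)) with z in C2 by (field; lra).
    apply Rmult_le_compat_l with (r := 1 + g) in C2; [|lra].
    replace ((1 + g) * (g / (1 + g) * lnGamma (z + 1) + (1 - g / (1 + g)) * lnGamma (z - g)))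
      with (g * lnGamma (z + 1) + lnGamma (z - g)) in C2 by (field; lra).
    rewrite E1 in C2.
    assert (Q1 : g * lnGamma z = g * lnGamma (z - 1) + g * ln (z - 1)) by (rewrite E2; ring).
    apply Rabs_le. lra.
Qed.

Lemma ln_1p_quad t : Rabs t <= 1/2 -> Rabs (ln (1 + t) - t) <= 2 * (t * t).
Proof.
  intros H. apply Rabs_le_between in H.
  pose proof (exp_ineq1_le (ln (1 + t))) as H1. rewrite exp_ln in H1 by lra.
  pose proof (ln_ge_1_minus_inv (1 + t) ltac:(lra)) as H2.
  assert (H3 : t - (1 - / (1 + t)) <= 2 * (t * t)).
  { replace (t - (1 - / (1 + t))) with (t * t / (1 + t)) by (field; lra).
    apply Rle_div_l; [lra|]. nra. }
  apply Rabs_le. nra.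
Qed.

(* Partial sums of [digamma x = lim (ln (x + N) - sum_(k < N) 1 / (x + k))]. *)
Fixpoint digamma_approx (x : R) (N : nat) : R :=
  match N with
  | O => ln x
  | S N => digamma_approx x N + (ln (x + INR (S N)) - ln (x + INR N) - / (x + INR N))
  end.

Lemma sum_inv_sqr_bound x N : 0 < x ->
  sum_n (fun k => / ((x + INR k) * (x + INR k))) N <= / (x * x) + / x.
Proof.
  intros Hx.
  enough (H : sum_n (fun k => / ((x + INR k) * (x + INR k))) N <= / (x * x) + / x - / (x + INR N)).
  { pose proof (pos_INR N). assert (0 < / (x + INR N)) by (apply Rinv_0_lt_compat; lra). lra. }
  induction N as [|N IH].
  - rewrite sum_O. simpl. rewrite Rplus_0_r. lra.
  - rewrite sum_Sn. unfold plus; simpl plus. pose proof (pos_INR N).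
    change (sum_n (fun k => / ((x + INR k) * (x + INR k))) N + / ((x + INR (S N)) * (x + INR (S N))) <= /
      (x * x) + / x - / (x + INR (S N))).
    rewrite S_INR.
    assert (/ ((x + (INR N + 1)) * (x + (INR N + 1))) <= / (x + INR N) - / (x + (INR N + 1))); [|lra].
    replace (/ (x + INR N) - / (x + (INR N + 1))) with (/ ((x + INR N) * (x + (INR N + 1)))) by (field; lra).
    apply Rinv_le_contravar; [apply Rmult_lt_0_compat; lra|]. apply Rmult_le_compat_r; lra.
Qed.

Lemma ln_step_bounds y : 0 < y -> / (y + 1) <= ln (y + 1) - ln y <= / y.
Proof.
  intros Hy. rewrite <- ln_div by lra. assert (Hq : 0 < (y + 1) / y) by (apply Rdiv_lt_0_compat; lra).
  pose proof (ln_ge_1_minus_inv _ Hq) as H1. replace (1 - / ((y + 1) / y)) with (/ (y + 1)) in H1 by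
    (field; lra).
  pose proof (exp_ineq1_le (ln ((y + 1) / y))) as H2. rewrite exp_ln in H2 by auto.
  replace ((y + 1) / y) with (1 + / y) in H2 at 2 by (field; lra). lra.
Qed.

(** With y = x + N, the increment ln (y + 1) - ln y - 1 / y lies between 1 / (y + 1) - 1 / y and 0.
    The sequence decreases, and the lower bounds telescope to ln x - 1 / x + 1 / (x + N). *)
Lemma digamma_approx_lim x : 0 < x -> exists l : R, is_lim_seq (digamma_approx x) l /\ ln x - / x <= l <=
  ln x.
Proof.
  intros Hx.
  assert (HB : forall N, ln x - / x + / (x + INR N) <= digamma_approx x N <= ln x).
  { induction N as [|N IH]; [simpl; rewrite Rplus_0_r; lra|].
    pose proof (pos_INR N). pose proof (ln_step_bounds (x + INR N) ltac:(lra)) as [S1 S2].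
    cbn [digamma_approx]. rewrite S_INR. replace (x + (INR N + 1)) with (x + INR N + 1) by ring. lra. }
  destruct (ex_finite_lim_seq_decr (digamma_approx x) (ln x - / x)) as [l Hl].
  - intros N. pose proof (pos_INR N). pose proof (ln_step_bounds (x + INR N) ltac:(lra)) as [S1 S2].
    cbn [digamma_approx]. rewrite S_INR. replace (x + (INR N + 1)) with (x + INR N + 1) by ring. lra.
  - intros N. specialize (HB N). pose proof (pos_INR N).
    assert (0 < / (x + INR N)) by (apply Rinv_0_lt_compat; lra). lra.
  - exists l. split; auto. split.
    + apply (is_lim_seq_le (fun _ => ln x - / x) (digamma_approx x) (ln x - / x) l); auto.
      * intros N. specialize (HB N). pose proof (pos_INR N).
        assert (0 < / (x + INR N)) by (apply Rinv_0_lt_compat; lra). lra.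
      * apply is_lim_seq_const.
    + apply (is_lim_seq_le (digamma_approx x) (fun _ => ln x) l (ln x)); auto.
      * intros N. apply HB.
      * apply is_lim_seq_const.
Qed.

(** N uses of the functional equation. The error splits into the slope defect at x + N, which dies
    out as N grows, and a sum of terms ln (1 + u) - u, quadratic in h. The [match] supplies the
    empty sum, since [sum_n] includes its upper index. *)
Lemma lnGamma_shift_diff x h N : 0 < x -> 0 < x + h ->
  lnGamma (x + h) - lnGamma x - h * digamma_approx x N =
  (lnGamma (x + INR N + h) - lnGamma (x + INR N) - h * ln (x + INR N))
  - match N with O => 0 | S M => sum_n (fun k => ln (1 + h / (x + INR k)) - h / (x + INR k)) M end.
Proof.
  intros Hx Hxh. induction N as [|N IH].
  - simpl. rewrite Rplus_0_r. ring.
  - assert (HN := pos_INR N).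
    assert (HS : forall y, 0 < y -> lnGamma (y + 1) = lnGamma y + ln y).
    { intros y Hy. unfold lnGamma. rewrite Gamma_S, ln_mult by (auto using Gamma_pos). ring. }
    assert (ES : sum_n (fun k => ln (1 + h / (x + INR k)) - h / (x + INR k)) N =
      match N with O => 0 | S M => sum_n (fun k => ln (1 + h / (x + INR k)) - h / (x + INR k)) M end
      + (ln (1 + h / (x + INR N)) - h / (x + INR N))).
    { destruct N as [|M]; [rewrite sum_O; symmetry; apply Rplus_0_l|]. rewrite sum_Sn. reflexivity. }
    rewrite ES. cbn [digamma_approx]. rewrite S_INR.
    replace (x + (INR N + 1) + h) with ((x + INR N + h) + 1) by ring.
    replace (x + (INR N + 1)) with ((x + INR N) + 1) by ring.
    rewrite (HS (x + INR N + h)), (HS (x + INR N)) by lra.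
    replace (1 + h / (x + INR N)) with ((x + INR N + h) / (x + INR N)) by (field; lra).
    rewrite ln_div by lra.
    unfold Rdiv in *. lra.
Qed.

Lemma Rabs_sum_n_bound (a b : nat -> R) n : (forall k, Rabs (a k) <= b k) -> Rabs (sum_n a n) <= sum_n b n.
Proof.
  intros H. induction n as [|n IH]; [rewrite !sum_O; auto|]. rewrite !sum_Sn. unfold plus; simpl.
  eapply Rle_trans; [apply Rabs_triang|]. specialize (H (S n)). lra.
Qed.

Lemma is_lim_seq_inv_shift x : is_lim_seq (fun N => / (x + INR N)) 0.
Proof.
  replace (Finite 0) with (Rbar_inv p_infty) by reflexivity. apply is_lim_seq_inv; [|easy].
  apply (is_lim_seq_plus (fun _ => x) INR x p_infty p_infty).
  - apply is_lim_seq_const.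
  - apply is_lim_seq_INR.
  - reflexivity.
Qed.

(** In the limit of [lnGamma_shift_diff] only the quadratic sum is left; 2 Q h^2 bounds it uniformly
    in N, where Q majorizes the sum of (x + k)^-2. *)
Lemma lnGamma_deriv (x l : R) : 0 < x -> is_lim_seq (digamma_approx x) l -> is_derive lnGamma x l.
Proof.
  intros Hx Hl. set (Q := / (x * x) + / x).
  apply is_derive_quad with (M := 2 * Q) (d := Rmin 1 (x / 2)); [apply Rmin_pos; lra|].
  intros h Hh. assert (H1 := Rlt_le_trans _ _ _ Hh (Rmin_l _ _)). assert (H2 := Rlt_le_trans _ _ _ Hh
    (Rmin_r _ _)).
  (* The index [S (S N)] makes the argument x + N + 2 exceed 1, as [ln_slope_bound] requires, and
     keeps the sum nonempty. *)
  assert (HB : forall N, Rabs (lnGamma (x + h) - lnGamma x - h * digamma_approx x (S (S N))) <=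
     2 * Q * (h * h) + / (x + INR N)).
  { intros N. pose proof (pos_INR N) as HN. rewrite (lnGamma_shift_diff x h (S (S N))); auto.
    2: { apply Rabs_lt_between in H2. lra. }
    unfold Rminus at 1. eapply Rle_trans; [apply Rabs_triang|]. rewrite Rabs_Ropp, Rplus_comm. apply
      Rplus_le_compat.
    - eapply Rle_trans; [apply (Rabs_sum_n_bound _ (fun k => 2 * (h * h) * / ((x + INR k) * (x + INR k))))|].
      + intros k. pose proof (pos_INR k) as Hk.
        assert (Ht : Rabs (h / (x + INR k)) <= 1/2).
        { unfold Rdiv at 1. rewrite Rabs_mult, Rabs_inv, (Rabs_pos_eq (x + INR k)) by lra.
          apply Rle_div_l; lra. }
        eapply Rle_trans; [apply (ln_1p_quad _ Ht)|]. apply Req_le. field. lra.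
      + change (@sum_n R_AbelianMonoid) with (@sum_n (Ring.AbelianMonoid R_Ring)).
        rewrite (sum_n_mult_l (K := R_Ring)). unfold mult; simpl.
        pose proof (sum_inv_sqr_bound x (S N) Hx) as HS. fold Q in HS.
        replace (2 * Q * (h * h)) with (2 * (h * h) * Q) by ring.
        apply Rmult_le_compat_l; auto. nra.
    - eapply Rle_trans; [apply ln_slope_bound; [rewrite !S_INR; lra|lra]|].
      pose proof (ln_step_bounds (x + INR (S (S N)) - 1)) as [_ S2]; [rewrite !S_INR; lra|].
      replace (x + INR (S (S N)) - 1 + 1) with (x + INR (S (S N))) in S2 by ring.
      assert (S3 : 0 <= ln (x + INR (S (S N))) - ln (x + INR (S (S N)) - 1)).
      { assert (ln (x + INR (S (S N)) - 1) <= ln (x + INR (S (S N)))); [|lra].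
        apply ln_le; rewrite !S_INR; lra. }
      assert (S4 : / (x + INR (S (S N)) - 1) <= / (x + INR N)) by (apply Rinv_le_contravar; rewrite ?S_INR;
        lra).
 nra. }
  rewrite (Rmult_comm l h).
  apply (is_lim_seq_le (fun N => Rabs (lnGamma (x + h) - lnGamma x - h * digamma_approx x (S (S N))))
     (fun N => 2 * Q * (h * h) + / (x + INR N)) (Rabs (lnGamma (x + h) - lnGamma x - h * l)) (2 * Q * (h *
       h))); auto.
  - apply (is_lim_seq_abs _ (Finite _)). apply (is_lim_seq_minus' (fun _ => _)); [apply is_lim_seq_const|].
    apply (is_lim_seq_scal_l _ h l). apply (is_lim_seq_incr_1 (fun N => digamma_approx x (S N))).
    now apply (is_lim_seq_incr_1 (digamma_approx x)).
  - replace (Finite (2 * Q * (h * h))) with (Finite (2 * Q * (h * h) + 0)) by (f_equal; ring).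
    apply is_lim_seq_plus'; [apply is_lim_seq_const|apply is_lim_seq_inv_shift].
Qed.

Lemma digamma_spec x : 0 < x -> is_lim_seq (digamma_approx x) (digamma x) /\ ln x - / x <= digamma x <= ln x.
Proof.
  intros Hx. destruct (digamma_approx_lim x Hx) as [l [Hl Hb]].
  assert (E : digamma x = l); [|now rewrite E].
  unfold digamma. pose proof (Gamma_pos x Hx) as HG.
  assert (HD : is_derive Gamma x (Gamma x * l)).
  { apply (is_derive_ext_loc (fun y => exp (lnGamma y))).
    - exists (mkposreal x Hx). intros y Hy. unfold ball in Hy; simpl in Hy.
      unfold AbsRing_ball, abs, minus, plus, opp in Hy; simpl in Hy. apply Rabs_lt_between in Hy.
      unfold lnGamma. rewrite exp_ln; auto. apply Gamma_pos. lra.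
    - replace (Gamma x) with (exp (lnGamma x)) by (unfold lnGamma; now rewrite exp_ln).
      rewrite Rmult_comm. apply (is_derive_comp exp lnGamma); [|now apply lnGamma_deriv].
      apply is_derive_Reals, derivable_pt_lim_exp. }
  rewrite (is_derive_unique _ _ _ HD). field. lra.
Qed.

Lemma digamma_approx_harmonic x N : 0 < x ->
  digamma_approx x (S N) = ln (x + INR (S N)) - sum_n (fun k => / (x + INR k)) N.
Proof.
  intros Hx. induction N as [|N IH].
  - rewrite sum_O. simpl. rewrite Rplus_0_r. ring.
  - rewrite sum_Sn. cbn [digamma_approx] in *. rewrite IH. unfold plus; simpl. ring.
Qed.

Lemma is_lim_seq_ln_ratio x y : 0 < x -> 0 < y ->
  is_lim_seq (fun N => ln (x + INR N) - ln (y + INR N)) 0.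
Proof.
  intros Hx Hy.
  assert (B : forall a b, 0 < a -> 0 < b -> ln a - ln b <= (a - b) / b).
  { intros a b Ha Hb. rewrite <- ln_div by auto. assert (0 < a / b) by now apply Rdiv_lt_0_compat.
    pose proof (exp_ineq1_le (ln (a / b))) as H1. rewrite exp_ln in H1 by auto.
    replace ((a - b) / b) with (a / b - 1) by (field; lra). lra. }
  assert (L : forall z c, is_lim_seq (fun N => c * / (z + INR N)) 0).
  { intros z c. replace (Finite 0) with (Rbar_mult c 0) by (simpl; f_equal; ring).
    apply is_lim_seq_scal_l. apply is_lim_seq_inv_shift. }
  apply is_lim_seq_le_le with (u := fun N => (x - y) * / (x + INR N)) (w := fun N => (x - y) * / (y + INR
    N)); auto.
  intros N. pose proof (pos_INR N). split.
  - pose proof (B (y + INR N) (x + INR N) ltac:(lra) ltac:(lra)) as H1.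
    replace ((y + INR N - (x + INR N)) / (x + INR N)) with (- ((x - y) * / (x + INR N))) in H1 by (field;
      lra). lra.
  - pose proof (B (x + INR N) (y + INR N) ltac:(lra) ltac:(lra)) as H1.
    replace ((x + INR N - (y + INR N)) / (y + INR N)) with ((x - y) * / (y + INR N)) in H1 by (field; lra).
      lra.
Qed.

Lemma harmonic_sum_n N : harmonic (S N) = sum_n (fun k => / (1 + INR k)) N.
Proof.
  unfold harmonic. rewrite <- sum_n_m_S. unfold sum_n. apply sum_n_m_ext. intros k. rewrite S_INR. f_equal.
    ring.
Qed.

(** The partial sums of gamma are those of -psi(1) up to ln (N + 2) - ln (N + 1), which tends to
    0. *)
Lemma euler_gamma_digamma : euler_gamma = - digamma 1.
Proof.
  unfold euler_gamma. rewrite (is_lim_seq_unique _ (- digamma 1)); auto.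
  apply (is_lim_seq_incr_1 (fun n => harmonic n - ln (INR n))).
  apply is_lim_seq_ext with (fun N => - digamma_approx 1 (S N) + (ln (2 + INR N) - ln (1 + INR N))).
  - intros N. rewrite digamma_approx_harmonic, harmonic_sum_n, S_INR by lra.
    replace (1 + (INR N + 1)) with (2 + INR N) by ring.
    replace (1 + INR N) with (INR N + 1) by ring. ring.
  - replace (Finite (- digamma 1)) with (Finite (- digamma 1 + 0)) by (f_equal; ring).
    apply is_lim_seq_plus'; [|apply is_lim_seq_ln_ratio; lra].
    apply (proj1 (is_lim_seq_opp (fun N => digamma_approx 1 (S N)) (digamma 1))). apply (is_lim_seq_incr_1
      (digamma_approx 1)). apply digamma_spec. lra.
Qed.

Lemma digamma_series y : 0 < y ->
  is_series (fun k => / INR (S k) - / (y + INR k)) (euler_gamma + digamma y).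
Proof.
  intros Hy. rewrite euler_gamma_digamma.
  change (is_lim_seq (sum_n (fun k => / INR (S k) - / (y + INR k))) (- digamma 1 + digamma y)).
  apply is_lim_seq_ext with (fun N => (- digamma_approx 1 (S N) + digamma_approx y (S N)) + - (ln (y + INR
    (S N)) - ln (1 + INR (S N)))).
  - intros N. rewrite !digamma_approx_harmonic by lra.
    replace (sum_n (fun k => / INR (S k) - / (y + INR k)) N) with
      (sum_n (fun k => / (1 + INR k)) N - sum_n (fun k => / (y + INR k)) N); [ring|].
    induction N as [|N IH]; [rewrite !sum_O; simpl; rewrite Rplus_0_r; ring|].
    rewrite !sum_Sn, <- IH. unfold plus; simpl plus. rewrite (S_INR (S N)).
    replace (INR (S N) + 1) with (1 + INR (S N)) by ring. unfold plus; simpl. ring.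
  - replace (Finite (- digamma 1 + digamma y)) with (Finite ((- digamma 1 + digamma y) + - 0)) by (f_equal;
    ring).
    apply is_lim_seq_plus'; [apply is_lim_seq_plus'|].
    + apply (proj1 (is_lim_seq_opp (fun N => digamma_approx 1 (S N)) (digamma 1))). apply
      (is_lim_seq_incr_1 (digamma_approx 1)). apply digamma_spec. lra.
    + apply (is_lim_seq_incr_1 (digamma_approx y)). now apply digamma_spec.
    + apply (proj1 (is_lim_seq_opp (fun N => ln (y + INR (S N)) - ln (1 + INR (S N))) 0)).
      apply (is_lim_seq_incr_1 (fun N => ln (y + INR N) - ln (1 + INR N))). apply is_lim_seq_ln_ratio; lra.
Qed.

(** * Polygamma *)

Lemma Series_bound (a b : nat -> R) l B : (forall k, Rabs (a k) <= b k) -> is_series a l -> is_series b B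
  -> Rabs l <= B.
Proof.
  intros H Ha Hb. rewrite <- (is_series_unique _ _ Ha), <- (is_series_unique _ _ Hb).
  assert (He : ex_series (fun k => Rabs (a k))).
  { apply (ex_series_le (V := R_CompleteNormedModule) (fun k => Rabs (a k)) b); [|eexists; eauto].
    intros n. unfold norm; simpl. unfold abs; simpl. rewrite Rabs_Rabsolu. auto. }
  eapply Rle_trans; [apply Series_Rabs; auto|]. apply Series_le; [|eexists; eauto].
  intros n. split; [apply Rabs_pos|auto].
Qed.

Lemma series_is_derive (u : nat -> R -> R) (v w : nat -> R) (U : R -> R) V x d :
  0 < d -> ex_series w ->
  (forall n h, Rabs h < d -> Rabs (u n (x + h) - u n x - v n * h) <= w n * (h * h)) ->
  (forall h, Rabs h < d -> is_series (fun n => u n (x + h)) (U (x + h))) ->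
  is_series v V -> is_derive U x V.
Proof.
  intros Hd [W HW] Hu HU HV. apply is_derive_quad with (M := W) (d := d); auto. intros h Hh.
  assert (H0 := HU 0 ltac:(rewrite Rabs_R0; auto)). rewrite Rplus_0_r in H0.
  apply (Series_bound (fun n => u n (x + h) - u n x - v n * h) (fun n => w n * (h * h))); auto.
  - apply (is_series_minus (V := R_NormedModule) (fun n => u n (x + h) - u n x) (fun n => v n * h)).
    + apply (is_series_minus (V := R_NormedModule) (fun n => u n (x + h)) (fun n => u n x)); auto.
    + now apply is_series_scal_r.
  - now apply is_series_scal_r.
Qed.

(** Induction on k: the next error is 1 / (a + h), at most 2 / a, times the sum of the previous
    error and (k + 1) h^2 / a^(k+2). K does not depend on a, so that the bounds at a = y + n are
    summable over n. *)
Lemma inv_pow_quad k : exists K, 0 <= K /\ forall a h, 0 < a -> Rabs h <= a / 2 ->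
  Rabs (/ (a + h) ^ k - / a ^ k + INR k * h * / a ^ (k + 1)) <= K * (h * h) * / a ^ (k + 2).
Proof.
  induction k as [|k [K [HK IH]]].
  - exists 0. split; [lra|]. intros a h Ha Hh. simpl. rewrite Rinv_1.
    replace (1 - 1 + 0 * h * / (a * 1)) with 0 by ring. rewrite Rabs_R0, !Rmult_0_l. lra.
  - exists (2 * INR (S k) + 2 * K). pose proof (pos_INR (S k)) as HS. split; [lra|]. intros a h Ha Hh.
    specialize (IH a h Ha Hh). apply Rabs_le_between in Hh.
    set (e := / (a + h) ^ k - / a ^ k + INR k * h * / a ^ (k + 1)) in *.
    assert (Hak : 0 < a ^ k) by now apply pow_lt.
    assert (E : / (a + h) ^ S k - / a ^ S k + INR (S k) * h * / a ^ (S k + 1) =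
      / (a + h) * (INR (S k) * (h * h) * / a ^ (k + 2) + e)).
    { unfold e. replace (S k + 1)%nat with (k + 2)%nat by lia. replace (k + 2)%nat with (S (S k)) by lia.
      replace (k + 1)%nat with (S k) by lia. rewrite S_INR. simpl.
      assert (0 < (a + h) ^ k) by (apply pow_lt; lra). field. lra. }
    rewrite E, Rabs_mult.
    assert (Hq : Rabs (/ (a + h)) <= 2 * / a).
    { rewrite Rabs_pos_eq by (left; apply Rinv_0_lt_compat; lra).
      replace (2 * / a) with (/ (a / 2)) by (field; lra). apply Rinv_le_contravar; lra. }
    replace (S k + 2)%nat with (S (k + 2)) by lia. simpl (a ^ S (k + 2)). rewrite Rinv_mult.
    replace ((2 * INR (S k) + 2 * K) * (h * h) * (/ a * / a ^ (k + 2))) with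
      ((2 * / a) * (INR (S k) * (h * h) * / a ^ (k + 2) + K * (h * h) * / a ^ (k + 2))) by ring.
    apply Rmult_le_compat; auto; try apply Rabs_pos.
    eapply Rle_trans; [apply Rabs_triang|]. apply Rplus_le_compat; auto.
    assert (0 < / a ^ (k + 2)) by (apply Rinv_0_lt_compat, pow_lt; auto).
    rewrite Rabs_pos_eq; [lra|]. apply Rmult_le_pos; [|lra]. apply Rmult_le_pos; nra.
Qed.

(** The Hurwitz zeta value zeta(k, y), used for k >= 2; [hurwitz k 1] is zeta(k). *)
Definition hurwitz (k : nat) (y : R) : R := Series (fun n => / (y + INR n) ^ k).

Lemma ex_series_hurwitz k y : 0 < y -> ex_series (fun n => / (y + INR n) ^ (k + 2)).
Proof.
  intros Hy.
  assert (H2 : ex_series (fun n => / ((y + INR n) * (y + INR n)))).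
  { destruct (ex_finite_lim_seq_incr (sum_n (fun n => / ((y + INR n) * (y + INR n)))) (/ (y * y) + / y)) as
    [l Hl].
    - intros n. rewrite sum_Sn. unfold plus; simpl plus. pose proof (pos_INR (S n)).
      assert (0 < / ((y + INR (S n)) * (y + INR (S n)))) by (apply Rinv_0_lt_compat; nra).
      change (sum_n (fun n0 : nat => / ((y + INR n0) * (y + INR n0))) n <=
        sum_n (fun n0 : nat => / ((y + INR n0) * (y + INR n0))) n + / ((y + INR (S n)) * (y + INR (S n)))).
          lra.
    - intros n. now apply sum_inv_sqr_bound.
    - exists l. exact Hl. }
  apply (ex_series_le (V := R_CompleteNormedModule)) with (b := fun n => / y ^ k * / ((y + INR n) * (y +
    INR n))).
  - intros n. pose proof (pos_INR n). unfold norm; simpl. unfold abs; simpl.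
    rewrite Rabs_pos_eq by (left; apply Rinv_0_lt_compat, pow_lt; lra).
    replace (k + 2)%nat with (S (S k)) by lia. simpl.
    replace ((y + INR n) * ((y + INR n) * (y + INR n) ^ k)) with ((y + INR n) ^ k * ((y + INR n) * (y + INR
      n))) by ring.
    rewrite Rinv_mult. apply Rmult_le_compat_r; [left; apply Rinv_0_lt_compat; nra|].
    apply Rinv_le_contravar; [now apply pow_lt|]. apply pow_incr; lra.
  - now apply (ex_series_scal_l (V := R_NormedModule)).
Qed.

Lemma hurwitz_correct k y : 0 < y -> (2 <= k)%nat -> is_series (fun n => / (y + INR n) ^ k) (hurwitz k y).
Proof.
  intros Hy Hk. apply Series_correct. replace k with (k - 2 + 2)%nat by lia. now apply ex_series_hurwitz.
Qed.

Lemma hurwitz_deriv k y : 0 < y -> (2 <= k)%nat -> is_derive (hurwitz k) y (- INR k * hurwitz (S k) y).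
Proof.
  intros Hy Hk. destruct (inv_pow_quad k) as [K [HK H]].
  apply (series_is_derive (fun n y => / (y + INR n) ^ k) (fun n => - INR k * / (y + INR n) ^ (S k))
     (fun n => K * / (y + INR n) ^ (k + 2)) (hurwitz k) _ y (y / 2)); try lra.
  - apply (ex_series_scal_l (V := R_NormedModule)). now apply ex_series_hurwitz.
  - intros n h Hh. pose proof (pos_INR n). specialize (H (y + INR n) h ltac:(lra) ltac:(lra)).
    replace (y + h + INR n) with (y + INR n + h) by ring.
    replace (K * / (y + INR n) ^ (k + 2) * (h * h)) with (K * (h * h) * / (y + INR n) ^ (k + 2)) by ring.
    eapply Rle_trans; [|apply H]. apply Req_le. f_equal. replace (k + 1)%nat with (S k) by lia. ring.
  - intros h Hh. apply Rabs_lt_between in Hh. apply hurwitz_correct; auto. lra.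
  - apply (is_series_scal_l (V := R_NormedModule) (- INR k) (fun n => / (y + INR n) ^ S k) (hurwitz (S k)
    y)). apply hurwitz_correct; auto.
Qed.

Lemma digamma_deriv y : 0 < y -> is_derive digamma y (hurwitz 2 y).
Proof.
  intros Hy. destruct (inv_pow_quad 1) as [K [HK H]].
  apply (is_derive_ext_loc (fun y => - euler_gamma + (euler_gamma + digamma y))).
  { apply filter_forall. intros z. change (- euler_gamma + (euler_gamma + digamma z) = digamma z). ring. }
  replace (hurwitz 2 y) with (0 + hurwitz 2 y) by ring.
  apply (is_derive_plus (V := R_NormedModule) (fun _ => - euler_gamma)).
  { apply (is_derive_const (V := R_NormedModule)). }
  apply (series_is_derive (fun n y => / INR (S n) - / (y + INR n)) (fun n => / (y + INR n) ^ 2)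
     (fun n => K * / (y + INR n) ^ (1 + 2)) (fun y => euler_gamma + digamma y) _ y (y / 2)); try lra.
  - apply (ex_series_scal_l (V := R_NormedModule)). now apply ex_series_hurwitz.
  - intros n h Hh. pose proof (pos_INR n). specialize (H (y + INR n) h ltac:(lra) ltac:(lra)).
    replace (y + h + INR n) with (y + INR n + h) by ring.
    replace (K * / (y + INR n) ^ (1 + 2) * (h * h)) with (K * (h * h) * / (y + INR n) ^ (1 + 2)) by ring.
    eapply Rle_trans; [|apply H]. apply Req_le. rewrite <- Rabs_Ropp. f_equal. simpl (1 + 1)%nat. rewrite
      !pow_1. simpl (INR 1). ring.
  - intros h Hh. apply Rabs_lt_between in Hh. apply digamma_series; auto. lra.
  - apply hurwitz_correct; auto.
Qed.

Lemma polygamma_hurwitz k : forall y, 0 < y -> polygamma (S k) y = (-1) ^ k * INR (fact (S k)) * hurwitz (S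
  (S k)) y.
Proof.
  assert (Hloc : forall y, 0 < y -> forall P : R -> Prop, (forall z, 0 < z -> P z) -> locally y P).
  { intros y Hy P HP. exists (mkposreal y Hy). intros z Hz. apply HP. unfold ball in Hz; simpl in Hz.
    unfold AbsRing_ball, abs, minus, plus, opp in Hz; simpl in Hz. apply Rabs_lt_between in Hz. lra. }
  unfold polygamma. induction k as [|k IH]; intros y Hy.
  - change (Derive digamma y = (-1) ^ 0 * INR (fact 1) * hurwitz 2 y).
    rewrite (is_derive_unique _ _ _ (digamma_deriv y Hy)). simpl. ring.
  - cbn [Derive_n] in *.
    rewrite (Derive_ext_loc _ (fun y => (-1) ^ k * INR (fact (S k)) * hurwitz (S (S k)) y)) by (apply Hloc;
      auto).
    rewrite Derive_scal, (is_derive_unique _ _ _ (hurwitz_deriv (S (S k)) y Hy ltac:(lia))).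
    change (fact (S (S k))) with (S (S k) * fact (S k))%nat. rewrite mult_INR. simpl ((-1) ^ S k). ring.
Qed.

Lemma hurwitz_shift k y : 0 < y -> (2 <= k)%nat -> hurwitz k y = / y ^ k + hurwitz k (y + 1).
Proof.
  intros Hy Hk. unfold hurwitz. rewrite Series_incr_1.
  - simpl (INR 0). rewrite Rplus_0_r. f_equal. apply Series_ext. intros n. rewrite S_INR. do 2 f_equal. ring.
  - eexists. now apply hurwitz_correct.
Qed.

(** With p = 1 / a and q = 1 / (a + 1) one has p - q = p q, hence p^(k+1) - q^(k+1) = p (p^k - q^k)
    + q^k p q; the bounds follow by induction from q <= p. *)
Lemma inv_pow_diff_bounds k a : 0 < a ->
  INR k * / (a + 1) ^ (S k) <= / a ^ k - / (a + 1) ^ k <= INR k * / a ^ (S k).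
Proof.
  intros Ha. rewrite <- !pow_inv. set (p := / a). set (q := / (a + 1)).
  assert (Hq : 0 < q) by (apply Rinv_0_lt_compat; lra).
  assert (Hqp : q <= p) by (apply Rinv_le_contravar; lra).
  assert (E : p - q = p * q) by (unfold p, q; field; lra).
  induction k as [|k IH]; [simpl; lra|].
  assert (P : p ^ S k - q ^ S k = p * (p ^ k - q ^ k) + q ^ k * (p * q)).
  { rewrite <- E. simpl. ring. }
  rewrite P. rewrite S_INR.
  assert (Hk1 : 0 < q ^ k) by now apply pow_lt.
  assert (0 < q ^ S k) by now apply pow_lt. assert (Hn := pos_INR k). destruct IH as [I1 I2]. split.
  - apply Rle_trans with (q * (INR k * q ^ S k) + q ^ k * (q * q)); [apply Req_le; simpl; ring|].
    assert (0 <= INR k * q ^ S k) by nra.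
    assert (q * (INR k * q ^ S k) <= p * (p ^ k - q ^ k)) by (apply Rmult_le_compat; lra).
    assert (q ^ k * (q * q) <= q ^ k * (p * q)) by (apply Rmult_le_compat_l; [lra|apply Rmult_le_compat_r;
      lra]).
    lra.
  - apply Rle_trans with (p * (INR k * p ^ S k) + p ^ k * (p * p)); [|apply Req_le; simpl; ring].
    assert (p * (p ^ k - q ^ k) <= p * (INR k * p ^ S k)) by (apply Rmult_le_compat_l; lra).
    assert (q ^ k * (p * q) <= p ^ k * (p * p)) by (apply Rmult_le_compat; nra).
    lra.
Qed.

Lemma is_series_telescope (T : nat -> R) : is_lim_seq T 0 -> is_series (fun n => T n - T (S n)) (T 0%nat).
Proof.
  intros HT. change (is_lim_seq (sum_n (fun n => T n - T (S n))) (T 0%nat)).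
  apply is_lim_seq_ext with (fun n => T 0%nat - T (S n)).
  - induction n as [|n IH]; [now rewrite sum_O|]. rewrite sum_Sn, <- IH. unfold plus; simpl. ring.
  - replace (Finite (T 0%nat)) with (Finite (T 0%nat - 0)) by (f_equal; ring).
    apply is_lim_seq_minus'; [apply is_lim_seq_const|]. now apply (is_lim_seq_incr_1 T).
Qed.

Lemma is_series_inv_pow_telescope k y : 0 < y -> (1 <= k)%nat ->
  is_series (fun n => / (y + INR n) ^ k - / (y + INR (S n)) ^ k) (/ y ^ k).
Proof.
  intros Hy Hk.
  replace (/ y ^ k) with (/ (y + INR 0) ^ k) by (simpl INR; now rewrite Rplus_0_r).
  apply (is_series_telescope (fun n => / (y + INR n) ^ k)). destruct k as [|k]; [lia|].
  apply is_lim_seq_le_le with (u := fun _ => 0) (w := fun n => / y ^ k * / (y + INR n)).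
  - intros n. pose proof (pos_INR n). split; [left; apply Rinv_0_lt_compat, pow_lt; lra|].
    simpl. rewrite Rinv_mult, Rmult_comm. apply Rmult_le_compat_r; [left; apply Rinv_0_lt_compat; lra|].
    apply Rinv_le_contravar; [now apply pow_lt|]. apply pow_incr; lra.
  - apply is_lim_seq_const.
  - replace (Finite 0) with (Rbar_mult (/ y ^ k) 0) by (simpl; f_equal; ring).
    apply is_lim_seq_scal_l, is_lim_seq_inv_shift.
Qed.

(** Termwise comparison with a telescoping series. The upper bound gives the decay of the polygamma
    functions for r >= 2; both bounds together isolate their leading term for r = 1. *)
Lemma hurwitz_bounds k y : 0 < y -> (1 <= k)%nat ->
  0 <= INR k * hurwitz (S k) (y + 1) <= / y ^ k /\ / y ^ k <= INR k * hurwitz (S k) y.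
Proof.
  intros Hy Hk. pose proof (is_series_inv_pow_telescope k y Hy Hk) as HT.
  pose proof (hurwitz_correct (S k) y Hy ltac:(lia)) as H1.
  assert (Hk0 : 0 < INR k) by (apply lt_0_INR; lia).
  assert (B : forall n, INR k * / (y + INR (S n)) ^ S k <= / (y + INR n) ^ k - / (y + INR (S n)) ^ k <= INR
    k * / (y + INR n) ^ S k).
  { intros n. pose proof (pos_INR n). rewrite S_INR. replace (y + (INR n + 1)) with (y + INR n + 1) by ring.
    apply inv_pow_diff_bounds. lra. }
  assert (Pos : forall n, 0 <= INR k * / (y + INR (S n)) ^ S k).
  { intros n. pose proof (pos_INR (S n)). apply Rmult_le_pos; [lra|]. left. apply Rinv_0_lt_compat, pow_lt.
    lra. }
  assert (E2 : INR k * hurwitz (S k) (y + 1) = Series (fun n => INR k * / (y + INR (S n)) ^ S k)).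
  { unfold hurwitz. rewrite Series_scal_l. f_equal. apply Series_ext. intros n. rewrite S_INR. do 2
    f_equal. ring. }
  assert (X2 : ex_series (fun n => INR k * / (y + INR (S n)) ^ S k)).
  { apply (ex_series_scal_l (V := R_NormedModule) (INR k)). apply (ex_series_incr_1 (fun n => / (y + INR n)
    ^ S k)).
    eexists; eauto. }
  split; [split|].
  - rewrite E2. rewrite <- (Rmult_0_l (Series (fun _ => 0))), <- Series_scal_l. apply Series_le; auto.
    intros n. split; [lra|]. rewrite Rmult_0_l. auto.
  - rewrite E2, <- (is_series_unique _ _ HT). apply Series_le; [|eexists; eauto]. intros n. split; auto.
    apply B.
  - rewrite <- (is_series_unique _ _ HT). unfold hurwitz. rewrite <- Series_scal_l. apply Series_le.
    + intros n. split; [eapply Rle_trans; [apply Pos|apply B]|apply B].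
    + apply (ex_series_scal_l (V := R_NormedModule) (INR k)). eexists; eauto.
Qed.

(** * Partial fractions *)

(** The upper bound is strict, so that the empty sum is [bsum 0]; [sum_n] always contains the index
    0. *)
Fixpoint bsum (n : nat) (f : nat -> R) : R :=
  match n with O => 0 | S n => bsum n f + f n end.

Lemma bsum_shift n f : bsum (S n) f = f 0%nat + bsum n (fun i => f (S i)).
Proof. induction n as [|n IH]; [simpl; ring|]. change (bsum (S (S n)) f) with (bsum (S n) f + f (S n)).
  rewrite IH. simpl. ring. Qed.

Lemma bsum_ext n f g : (forall i, (i < n)%nat -> f i = g i) -> bsum n f = bsum n g.
Proof. intros H. induction n as [|n IH]; simpl; auto. rewrite IH, H; auto. Qed.

Lemma bsum_plus n f g : bsum n (fun i => f i + g i) = bsum n f + bsum n g.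
Proof. induction n as [|n IH]; simpl; [ring|]. rewrite IH. ring. Qed.

Lemma bsum_scal n c f : bsum n (fun i => c * f i) = c * bsum n f.
Proof. induction n as [|n IH]; simpl; [ring|]. rewrite IH. ring. Qed.

Lemma bsum_const n c : bsum n (fun _ => c) = INR n * c.
Proof. induction n as [|n IH]; [simpl; ring|]. rewrite S_INR. simpl bsum. rewrite IH. ring. Qed.

Lemma is_series_bsum n (f : nat -> nat -> R) (l : nat -> R) :
  (forall i, (i < n)%nat -> is_series (f i) (l i)) -> is_series (fun k => bsum n (fun i => f i k)) (bsum n l).
Proof.
  intros H. induction n as [|n IH]; simpl.
  - change (is_lim_seq (sum_n (fun _ => 0)) 0). apply is_lim_seq_ext with (fun _ => 0); [|apply
    is_lim_seq_const].
    intros n. induction n as [|n IHn]; [now rewrite sum_O|]. rewrite sum_Sn, <- IHn. unfold plus; simpl. ring.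
  - apply (is_series_plus (V := R_NormedModule)); auto.
Qed.

(** binom(n + i - 1, i), the coefficient of z^i in (1 - z)^-n. The row n = 0 is set apart because n
    + i - 1 would be truncated there. *)
Definition multichoose (n i : nat) : R :=
  match n with
  | O => match i with O => 1 | S _ => 0 end
  | S n => Binomial.C (n + i) i
  end.

Lemma binom_n_0 n : Binomial.C n 0 = 1.
Proof. unfold Binomial.C. rewrite Nat.sub_0_r. simpl. field. apply INR_fact_neq_0. Qed.

Lemma binom_n_n n : Binomial.C n n = 1.
Proof. unfold Binomial.C. rewrite Nat.sub_diag. simpl. field. apply INR_fact_neq_0. Qed.

Lemma multichoose_0 n : multichoose n 0 = 1.
Proof. destruct n; simpl; auto. apply binom_n_0. Qed.

Lemma multichoose_S n i : multichoose (S n) (S i) = multichoose n (S i) + multichoose (S n) i.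
Proof.
  destruct n as [|n]; simpl multichoose.
  - rewrite !binom_n_n. ring.
  - replace (S n + S i)%nat with (S (n + S i)) by lia. rewrite <- (pascal (n + S i) i) by lia.
    replace (S (n + i)) with (n + S i)%nat by lia. ring.
Qed.

(** The polar part of 1 / (n^r (n + y)^t), as a function of n, at one of its two poles: e = -1 for
    the pole 0, and e = 1 with the two exponents exchanged for the pole -y. *)
Definition pf_sum (e : R) (r t : nat) (a c : R) : R :=
  bsum r (fun i => e ^ i * multichoose t i * c ^ (t + i) * a ^ (r - i)).

(** Pascal's rule for [multichoose]. It mirrors a^(r+1) b^(t+1) = c (a^(r+1) b^t - a^r b^(t+1)), the
    step of the double induction in [partial_fractions]. *)
Lemma pf_sum_rec e r t a c :
  pf_sum e (S r) (S t) a c = c * (pf_sum e (S r) t a c + e * pf_sum e r (S t) a c).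
Proof.
  unfold pf_sum. rewrite !bsum_shift, <- bsum_scal, Rplus_assoc, <- bsum_plus, Rmult_plus_distr_l, <-
    bsum_scal.
  rewrite !multichoose_0, !Nat.add_0_r. f_equal; [simpl; ring|].
  apply bsum_ext. intros i _. rewrite multichoose_S. replace (S r - S i)%nat with (r - i)%nat by lia.
  replace (S t + S i)%nat with (S (S (t + i))) by lia. replace (t + S i)%nat with (S (t + i)) by lia.
  replace (S t + i)%nat with (S (t + i)) by lia. simpl. ring.
Qed.

Lemma pf_sum_0 e r a c : pf_sum e (S r) 0 a c = a ^ S r.
Proof.
  unfold pf_sum. rewrite bsum_shift. rewrite (bsum_ext r _ (fun _ => 0 * 0)).
  - rewrite bsum_const. simpl. ring.
  - intros i _. simpl. ring.
Qed.

(* [a = 1/n], [b = 1/(n+y)], [c = 1/y]. *)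
Lemma partial_fractions a b c r t : a * b = c * (a - b) -> (1 <= r + t)%nat ->
  a ^ r * b ^ t = pf_sum (-1) r t a c + (-1) ^ r * pf_sum 1 t r b c.
Proof.
  intros Hab. revert t. induction r as [|r IHr]; intros t.
  - destruct t as [|t]; [lia|]. intros _. rewrite pf_sum_0. unfold pf_sum. simpl. ring.
  - induction t as [|t IHt]; intros _.
    + rewrite pf_sum_0. unfold pf_sum. simpl. ring.
    + specialize (IHr (S t) ltac:(lia)). specialize (IHt ltac:(lia)).
      rewrite !pf_sum_rec.
      replace (a ^ S r * b ^ S t) with (c * (a ^ S r * b ^ t - a ^ r * b ^ S t)).
      * rewrite IHr, IHt. simpl ((-1) ^ S r). ring.
      * transitivity (a ^ r * b ^ t * (c * (a - b))); [simpl; ring|]. rewrite <- Hab. simpl. ring.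
Qed.

Lemma multichoose_sym r t : multichoose (S t) r = multichoose (S r) t.
Proof.
  simpl. rewrite (pascal_step1 (t + r) r) by lia. f_equal; lia.
Qed.

Lemma hurwitz_1 k : (2 <= k)%nat -> is_series (fun n => / INR (S n) ^ k) (hurwitz k 1).
Proof.
  intros Hk. apply (is_series_ext (fun n => / (1 + INR n) ^ k)).
  - intros n. rewrite S_INR. do 2 f_equal. ring.
  - apply hurwitz_correct; auto. lra.
Qed.

(** The terms of [partial_fractions] with simple poles, i = r and j = t, diverge separately. Their
    coefficients are opposite by [multichoose_sym], and together they form the digamma series; all
    other terms are Hurwitz sums. *)
Lemma inner_sum r t y : 0 < y ->
  is_series (fun n => / (INR (S n) ^ S r * (INR (S n) + y) ^ S t))
   (bsum r (fun i => (-1) ^ i * multichoose (S t) i * / y ^ (S t + i) * hurwitz (S r - i) 1)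
    + (-1) ^ S r * bsum t (fun j => multichoose (S r) j * / y ^ (S r + j) * hurwitz (S t - j) (y + 1))
    + (-1) ^ r * multichoose (S r) t * / y ^ (S r + t) * (euler_gamma + digamma (y + 1))).
Proof.
  intros Hy.
  apply (is_series_ext (fun n =>
     bsum r (fun i => (-1) ^ i * multichoose (S t) i * / y ^ (S t + i) * / INR (S n) ^ (S r - i))
    + (-1) ^ S r * bsum t (fun j => multichoose (S r) j * / y ^ (S r + j) * / (y + 1 + INR n) ^ (S t - j))
    + (-1) ^ r * multichoose (S r) t * / y ^ (S r + t) * (/ INR (S n) - / (y + 1 + INR n)))).
  - intros n. pose proof (INR_S_pos n).
    assert (E : y + 1 + INR n = INR (S n) + y) by (rewrite S_INR; ring). rewrite E.
    rewrite Rinv_mult, <- !pow_inv.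
    rewrite (partial_fractions (/ INR (S n)) (/ (INR (S n) + y)) (/ y) (S r) (S t)); [|field; lra|lia].
    unfold pf_sum. cbn [bsum]. rewrite (multichoose_sym r t).
    rewrite (bsum_ext r _ (fun i => (-1) ^ i * multichoose (S t) i * (/ y) ^ (S t + i) * (/ INR (S n)) ^ (S
      r - i)))
      by (intros; now rewrite <- !pow_inv).
    rewrite (bsum_ext t (fun j => multichoose (S r) j * / y ^ (S r + j) * / (INR (S n) + y) ^ (S t - j))
       (fun i => 1 ^ i * multichoose (S r) i * (/ y) ^ (S r + i) * (/ (INR (S n) + y)) ^ (S t - i)))
      by (intros; rewrite <- !pow_inv, pow1; ring).
    replace (S r - r)%nat with 1%nat by lia. replace (S t - t)%nat with 1%nat by lia.
    replace (S t + r)%nat with (S r + t)%nat by lia. rewrite !pow_1, pow1.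
    change ((-1) ^ S r) with (-1 * (-1) ^ r).
    match goal with |- ?u = ?v => change (@eq R u v) end. ring.
  - apply (is_series_plus (V := R_NormedModule)); [apply (is_series_plus (V := R_NormedModule))|].
    + apply is_series_bsum. intros i Hi.
      apply (is_series_scal_l (V := R_NormedModule) ((-1) ^ i * multichoose (S t) i * / y ^ (S t + i)) (fun
        n => / INR (S n) ^ (S r - i))).
      apply hurwitz_1. lia.
    + apply (is_series_scal_l (V := R_NormedModule) ((-1) ^ S r)). apply is_series_bsum. intros j Hj.
      apply (is_series_scal_l (V := R_NormedModule) (multichoose (S r) j * / y ^ (S r + j)) (fun n => / (y
        + 1 + INR n) ^ (S t - j))).
      apply hurwitz_correct; [lra|lia].
    + apply (is_series_scal_l (V := R_NormedModule) ((-1) ^ r * multichoose (S r) t * / y ^ (S r + t)) (fun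
      n => / INR (S n) - / (y + 1 + INR n))).
      apply digamma_series. lra.
Qed.

(** * Remainders of size m^(-3/2) *)

Definition decays (g : nat -> R) : Prop :=
  exists B, 0 <= B /\ forall k, Rabs (g (S k)) <= B * Rpower (INR (S k)) (- (1 + 1/2)).

Lemma decays_ex_series g : decays g -> ex_series (fun k => g (S k)).
Proof.
  intros [B [HB H]]. apply (ex_series_le (V := R_CompleteNormedModule) _ (fun k => B * Rpower (INR (S k))
    (- (1 + 1/2)))).
  - exact H.
  - apply (ex_series_scal_l (V := R_NormedModule) B). apply ex_series_Rpower. lra.
Qed.

Lemma decays_plus f g : decays f -> decays g -> decays (fun m => f m + g m).
Proof.
  intros [B1 [H1 H2]] [B2 [H3 H4]]. exists (B1 + B2). split; [lra|]. intros k.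
  eapply Rle_trans; [apply Rabs_triang|]. specialize (H2 k). specialize (H4 k). lra.
Qed.

Lemma decays_scal c f : decays f -> decays (fun m => c * f m).
Proof.
  intros [B1 [H1 H2]]. exists (Rabs c * B1). split; [apply Rmult_le_pos; auto; apply Rabs_pos|]. intros k.
  rewrite Rabs_mult, Rmult_assoc. apply Rmult_le_compat_l; auto. apply Rabs_pos.
Qed.

Lemma decays_bsum n (f : nat -> nat -> R) : (forall i, (i < n)%nat -> decays (f i)) -> decays (fun m =>
  bsum n (fun i => f i m)).
Proof.
  intros H. induction n as [|n IH]; simpl.
  - exists 0. split; [lra|]. intros. rewrite Rabs_R0. lra.
  - apply decays_plus; auto.
Qed.

Lemma Series1_plus f g : decays f -> decays g -> Series1 (fun m => f m + g m) = Series1 f + Series1 g.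
Proof. intros Hf Hg. apply Series_plus; now apply decays_ex_series. Qed.

Lemma Series1_scal c f : Series1 (fun m => c * f m) = c * Series1 f.
Proof. apply Series_scal_l. Qed.

Lemma Series1_bsum n (f : nat -> nat -> R) : (forall i, (i < n)%nat -> decays (f i)) ->
  Series1 (fun m => bsum n (fun i => f i m)) = bsum n (fun i => Series1 (f i)).
Proof.
  intros H. induction n as [|n IH]; simpl.
  - unfold Series1. transitivity (0 * Series (fun _ : nat => 0)); [|ring]. rewrite <- Series_scal_l.
    apply Series_ext. intros; ring.
  - rewrite <- IH by auto. apply (Series1_plus (fun m => bsum n (fun i => f i m)) (f n)); auto. apply
    decays_bsum; auto.
Qed.

Lemma decays_le_inv_sqr g C : (forall k, Rabs (g (S k)) <= C * / INR (S k) ^ 2) -> decays g.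
Proof.
  intros H. exists (Rabs C). split; [apply Rabs_pos|]. intros k. eapply Rle_trans; [apply H|].
  apply Rmult_le_compat; [|left; apply Rinv_0_lt_compat, pow_lt, INR_S_pos|apply Rle_abs|].
  - specialize (H k). pose proof (Rabs_pos (g (S k))).
    assert (0 < / INR (S k) ^ 2) by (apply Rinv_0_lt_compat, pow_lt, INR_S_pos).
    destruct (Rle_lt_dec 0 C); auto. nra.
  - rewrite <- (Rpower_pow 2) by apply INR_S_pos. rewrite <- Rpower_Ropp.
    apply Rpower_le_exp; [apply INR_S_ge1|simpl; lra].
Qed.

Lemma inv_pow_le_sqr k n : (2 <= n)%nat -> / INR (S k) ^ n <= / INR (S k) ^ 2.
Proof.
  intros Hn. apply Rinv_le_contravar; [apply pow_lt, INR_S_pos|]. apply Rle_pow; [apply INR_S_ge1|auto].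
Qed.

Lemma decays_inv_pow n : (2 <= n)%nat -> decays (fun m => / INR m ^ n).
Proof.
  intros Hn. apply decays_le_inv_sqr with 1. intros k. rewrite Rmult_1_l, Rabs_pos_eq.
  - now apply inv_pow_le_sqr.
  - left. apply Rinv_0_lt_compat, pow_lt, INR_S_pos.
Qed.

Lemma decays_G g : decays g -> exists B, 0 <= B /\ forall k, Rabs (INR (S k) * g (S k)) <= B * Rpower (INR
  (S k)) (- (1/2)).
Proof.
  intros [B [H1 H2]]. exists B. split; auto. intros k. pose proof (INR_S_pos k).
  rewrite Rabs_mult, Rabs_pos_eq by lra.
  replace (Rpower (INR (S k)) (- (1 / 2))) with (INR (S k) * Rpower (INR (S k)) (- (1 + 1/2))).
  - rewrite <- Rmult_assoc, (Rmult_comm B), Rmult_assoc. apply Rmult_le_compat_l; [lra|auto].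
  - rewrite <- (Rpower_1 (INR (S k))) at 1 by auto. rewrite <- Rpower_plus. f_equal. lra.
Qed.

(** * Sums, binomials and powers of the statement in the present notation *)

Lemma sum_range_bsum a b n F f : Z.to_nat (b - Z.of_nat a + 1) = n ->
  (forall i, (i < n)%nat -> F (a + i)%nat = RtoC (f i)) -> sum_range a b F = RtoC (bsum n f).
Proof.
  intros Hn H. unfold sum_range. rewrite Hn. clear Hn. revert a f H.
  induction n as [|n IH]; intros a f H; [reflexivity|].
  rewrite bsum_shift, RtoC_plus. simpl. f_equal.
  - rewrite <- (H 0%nat) by lia. f_equal. lia.
  - apply (IH (S a) (fun i => f (S i))). intros i Hi. rewrite <- (H (S i)) by lia. f_equal. lia.
Qed.

Lemma binZ_multichoose r j : binZ (Z.of_nat j + Z.of_nat (S r) - 1) (Z.of_nat j) = multichoose (S r) j.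
Proof.
  unfold binZ.
  destruct (Z.eqb_spec (Z.of_nat j) (-1)); [lia|].
  destruct (Z.eqb_spec (Z.of_nat j + Z.of_nat (S r) - 1) (-1)); [lia|]. rewrite Bool.andb_false_l.
  destruct (Z.leb_spec 0 (Z.of_nat j)); [|lia].
  destruct (Z.leb_spec (Z.of_nat j) (Z.of_nat j + Z.of_nat (S r) - 1)); [|lia].
  replace (Z.to_nat (Z.of_nat j + Z.of_nat (S r) - 1)) with (r + j)%nat by lia.
  rewrite Nat2Z.id. reflexivity.
Qed.

Lemma binZ_multichoose2 r t : binZ (Z.of_nat (S r) + Z.of_nat (S t) - 2) (Z.of_nat (S t) - 1) = multichoose
  (S r) t.
Proof.
  rewrite <- binZ_multichoose. f_equal; lia.
Qed.

(** For t = 0 this makes the sum of zeta products in [const_r_ge2] vanish. *)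
Lemma binZ_gt_0 i : (1 <= i)%nat -> binZ (Z.of_nat i + Z.of_nat 0 - 1) (Z.of_nat i) = 0.
Proof.
  intros Hi. unfold binZ.
  destruct (Z.eqb_spec (Z.of_nat i) (-1)); [lia|].
  destruct (Z.eqb_spec (Z.of_nat i + Z.of_nat 0 - 1) (-1)); [lia|]. rewrite Bool.andb_false_l.
  destruct (Z.leb_spec (Z.of_nat i) (Z.of_nat i + Z.of_nat 0 - 1)); [lia|]. now rewrite Bool.andb_false_r.
Qed.

(** The exponents of m in the constants may be negative; as quotients of natural powers they become
    accessible to [field]. *)
Lemma powerRZ_sub m a b z : 0 < m -> z = (Z.of_nat a - Z.of_nat b)%Z -> powerRZ m z = m ^ a / m ^ b.
Proof.
  intros Hm ->. assert (0 < m ^ b) by now apply pow_lt.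
  apply Rmult_eq_reg_r with (m ^ b); [|lra]. unfold Rdiv. rewrite Rmult_assoc, Rinv_l, Rmult_1_r by lra.
  rewrite !pow_powerRZ, <- powerRZ_add by lra. f_equal. lia.
Qed.

Lemma digamma_growth x : 0 < x -> exists B, 0 <= B /\ forall k,
  Rabs (euler_gamma + digamma (INR (S k) * x + 1)) <= B * Rpower (INR (S k)) (1/2).
Proof.
  intros Hx. exists (Rabs euler_gamma + 1 + ln (x + 1) + 2).
  assert (H1 : 0 <= ln (x + 1)) by (rewrite <- ln_1; apply ln_le; lra).
  pose proof (Rabs_pos euler_gamma) as H2. split; [lra|]. intros k.
  pose proof (INR_S_ge1 k) as Hm. set (m := INR (S k)) in *.
  assert (Hy : 1 <= m * x + 1) by nra.
  destruct (digamma_spec (m * x + 1) ltac:(lra)) as [_ [D1 D2]].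
  assert (L1 : 0 <= ln (m * x + 1)) by (rewrite <- ln_1; apply ln_le; lra).
  assert (L2 : ln (m * x + 1) <= ln m + ln (x + 1)).
  { rewrite <- ln_mult by lra. apply ln_le; [lra|]. nra. }
  assert (L3 : / (m * x + 1) <= 1) by (rewrite <- Rinv_1; apply Rinv_le_contravar; lra).
  pose proof (ln_le_Rpower m (1/2) Hm ltac:(lra)) as L4.
  replace (/ (1 / 2)) with 2 in L4 by field.
  assert (L5 : 1 <= Rpower m (1/2)).
  { apply Rle_trans with (Rpower m 0); [rewrite Rpower_O; lra|apply Rpower_le_exp; lra]. }
  eapply Rle_trans; [apply Rabs_triang|].
  assert (Rabs (digamma (m * x + 1)) <= 1 + ln (x + 1) + 2 * Rpower m (1/2)) by (apply Rabs_le; lra).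
  set (P := Rpower m (1 / 2)) in *. nra.
Qed.

(** The critical case is r = 2: the logarithmic growth of digamma is bounded by m^(1/2), and m^(1/2)
    m^-2 is exactly the size allowed by [decays]. *)
Lemma decays_digamma x r : 0 < x -> (2 <= r)%nat -> decays (fun m => (euler_gamma + digamma (INR m * x +
  1)) / INR m ^ r).
Proof.
  intros Hx Hr. destruct (digamma_growth x Hx) as [B [HB H]]. exists B. split; auto. intros k.
  unfold Rdiv. rewrite Rabs_mult. pose proof (INR_S_pos k) as Hm.
  rewrite (Rabs_pos_eq (/ _)) by (left; now apply Rinv_0_lt_compat, pow_lt).
  eapply Rle_trans; [apply Rmult_le_compat; [apply Rabs_pos|left; now apply Rinv_0_lt_compat, pow_lt|apply
    H|now apply inv_pow_le_sqr]|].
  apply Req_le. rewrite <- (Rpower_pow 2), <- Rpower_Ropp, Rmult_assoc, <- Rpower_plus by auto. f_equal.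
    f_equal. simpl. lra.
Qed.

(** The polygamma function of order k = S t - j - 1 is O((m x)^-k), and the denominator has exponent
    r - k, so the quotient is O(m^-r). *)
Lemma decays_polygamma x r t j : 0 < x -> (2 <= r)%nat -> (j < t)%nat ->
  decays (fun m => polygamma (S t - j - 1) (INR m * x + 1) / powerRZ (INR m) (Z.of_nat r + Z.of_nat j -
    Z.of_nat (S t) + 1)).
Proof.
  intros Hx Hr Hj. set (k := (t - j - 1)%nat). assert (Ek : (S t - j - 1 = S k)%nat) by (unfold k; lia).
  rewrite Ek. apply decays_le_inv_sqr with (INR (fact (S k)) * / x ^ (S k)). intros n.
  pose proof (INR_S_pos n) as Hm. set (m := INR (S n)) in *.
  assert (Hy : 0 < m * x) by nra. rewrite polygamma_hurwitz by lra.
  pose proof (hurwitz_bounds (S k) (m * x) Hy ltac:(lia)) as [[B1 B2] _].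
  assert (Hk : 1 <= INR (S k)) by apply INR_S_ge1.
  assert (B3 : 0 <= hurwitz (S (S k)) (m * x + 1)) by nra.
  assert (B4 : hurwitz (S (S k)) (m * x + 1) <= / (m * x) ^ S k) by nra.
  rewrite (powerRZ_sub m (r + j + 1) (S k + j + 1)) by (auto; unfold k; lia).
  assert (P : forall a, 0 < m ^ a) by (intros; now apply pow_lt).
  assert (Q : 0 < x ^ S k) by now apply pow_lt.
  unfold Rdiv. rewrite !Rabs_mult, <- RPow_abs. replace (Rabs (-1)) with 1 by (rewrite Rabs_left; lra).
  rewrite pow1, Rmult_1_l, (Rabs_pos_eq (INR _)) by apply pos_INR.
  rewrite (Rabs_pos_eq (hurwitz _ _)) by auto.
  rewrite (Rabs_pos_eq (/ _)).
  2: { left. apply Rinv_0_lt_compat, Rmult_lt_0_compat; auto. apply Rinv_0_lt_compat; auto. }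
  rewrite !Rmult_assoc. apply Rmult_le_compat_l; [apply pos_INR|].
  apply Rle_trans with (/ (m * x) ^ S k * / (m ^ (r + j + 1) * / m ^ (S k + j + 1))).
  - apply Rmult_le_compat_r; auto.
    left. apply Rinv_0_lt_compat, Rmult_lt_0_compat; auto. apply Rinv_0_lt_compat; auto.
  - apply Rle_trans with (/ x ^ S k * / m ^ r); [|apply Rmult_le_compat_l; [left; now apply
    Rinv_0_lt_compat|now apply inv_pow_le_sqr]].
    apply Req_le. rewrite Rpow_mult_distr. replace (r + j + 1)%nat with (r + (j + 1))%nat by lia.
    replace (S k + j + 1)%nat with (S k + (j + 1))%nat by lia. rewrite !(pow_add m).
    pose proof (P r). pose proof (P (S k)). pose proof (P j). field. lra.
Qed.

(** * The inner sum as main term and remainder *)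

Lemma pow_m1_sqr n : (-1) ^ n * (-1) ^ n = 1.
Proof. rewrite <- pow_add. replace (n + n)%nat with (2 * n)%nat by lia. rewrite pow_mult. replace ((-1) ^
  2) with 1 by ring. apply pow1. Qed.

(** The term i = 0 of [inner_sum] is the main term zeta(r) / (m x)^t. The remaining terms, divided
    by m / m^t, make up [g], and summing [g] over m reproduces the sums of [const_r_ge2] one by
    one. *)
Lemma case_r_ge2 zeta x r t : 0 < x -> (2 <= r)%nat ->
  (forall k, (2 <= k)%nat -> zeta (RtoC (INR k)) = RtoC (hurwitz k 1)) ->
  exists g, decays g /\
    (forall m, (1 <= m)%nat -> is_series (fun n => / (INR (S n) ^ r * (INR (S n) + INR m * x) ^ t))
       ((/ x ^ t * hurwitz r 1 + INR m * g m) / INR m ^ t)) /\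
    const_r_ge2 zeta x r t = RtoC (euler_gamma * hurwitz r 1 * / x ^ t + Series1 g).
Proof.
  intros Hx Hr Hz. destruct r as [|[|r]]; try lia. destruct t as [|t].
  (* For t = 0 the inner sum is zeta(r) itself, and every correction in the constant vanishes by the
     conventions on binomials and empty sums. *)
  - exists (fun _ => 0). split; [|split].
    + exists 0. split; [lra|]. intros. rewrite Rabs_R0. lra.
    + intros m Hm. apply (is_series_ext (fun n => / INR (S n) ^ (S (S r)))).
      * intros n. simpl pow. now rewrite Rmult_1_r.
      * replace ((/ x ^ 0 * hurwitz (S (S r)) 1 + INR m * 0) / INR m ^ 0) with (hurwitz (S (S r)) 1) by
        (simpl; field).
        apply hurwitz_1. lia.
    + unfold const_r_ge2. cbv zeta. rewrite Hz by lia.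
      rewrite (sum_range_bsum 0 (Z.of_nat 0 - 2) 0 _ (fun _ => 0)); [|reflexivity|intros; lia].
      rewrite (sum_range_bsum 1 (Z.of_nat (S (S r)) - 2) r _ (fun _ => 0)); [|lia|].
      2: { intros i Hi. rewrite binZ_gt_0 by lia. rewrite Rmult_0_r. ring. }
      (* binom(r - 2, -1) is 0 by convention, because r >= 2 rules out the exceptional upper entry
         -1. *)
      replace (binZ (Z.of_nat (S (S r)) + Z.of_nat 0 - 2) (Z.of_nat 0 - 1)) with 0.
      2: { unfold binZ. simpl (Z.of_nat 0 - 1 =? -1)%Z. destruct (Z.eqb_spec (Z.of_nat (S (S r)) + Z.of_nat
        0 - 2) (-1)); auto. lia. }
      rewrite bsum_const. simpl bsum. unfold Series1.
      replace (Series (fun _ : nat => 0)) with 0.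
      2: { symmetry. transitivity (0 * Series (fun _ : nat => 0)); [|ring]. rewrite <- Series_scal_l. apply
        Series_ext. intros; ring. }
      rewrite <- !RtoC_mult, <- !RtoC_plus, <- RtoC_minus. f_equal. rewrite !bsum_const, !Rmult_0_r,
        Rmult_0_l. ring.
  (* A, B and C are the zeta products, the polygamma sums and the digamma sum; each g carries the
     dependence on m and each c the coefficient. In A the index is one less than in the statement,
     the term 0 having become the main term. *)
  - set (gA := fun (i m : nat) => / INR m ^ (i + 2)).
    set (cA := fun i : nat => (-1) ^ (S i) / x ^ (S t + S i) * multichoose (S t) (S i) * hurwitz (S r - i) 1).
    set (gB := fun (j m : nat) => polygamma (S t - j - 1) (INR m * x + 1) / powerRZ (INR m) (Z.of_nat (S (S
      r)) + Z.of_nat j - Z.of_nat (S t) + 1)).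
    set (cB := fun j : nat => (-1) ^ (S (S r)) * (multichoose (S (S r)) j * ((-1) ^ (S t - j) / INR (fact
      (S t - j - 1))) * / x ^ (j + S (S r)))).
    set (gC := fun m : nat => (euler_gamma + digamma (INR m * x + 1)) / INR m ^ (S (S r))).
    set (cC := - ((-1) ^ (S (S r)) / x ^ (S (S r) + S t - 1) * multichoose (S (S r)) t)).
    assert (DA : forall i, decays (fun m => cA i * gA i m)) by (intros; apply decays_scal, decays_inv_pow;
      lia).
    assert (DB : forall j, (j < t)%nat -> decays (fun m => cB j * gB j m))
      by (intros; apply decays_scal, decays_polygamma; auto; lia).
    assert (DC0 : decays gC). { unfold gC. apply decays_digamma; [exact Hx|]. lia. }
    assert (DC : decays (fun m => cC * gC m)). { apply (decays_scal cC gC). exact DC0. }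
    set (g := fun m => bsum r (fun i => cA i * gA i m) + bsum t (fun j => cB j * gB j m) + cC * gC m).
    exists g.
    assert (DA' : decays (fun m => bsum r (fun i => cA i * gA i m))) by (apply (decays_bsum r (fun i m =>
      cA i * gA i m)); auto).
    assert (DB' : decays (fun m => bsum t (fun j => cB j * gB j m))) by (apply (decays_bsum t (fun j m =>
      cB j * gB j m)); auto).
    split; [|split].
    + apply decays_plus; [apply decays_plus|]; auto.
    + intros m Hm. assert (Hm0 : 0 < INR m) by (apply lt_0_INR; lia).
      assert (Hy : 0 < INR m * x) by now apply Rmult_lt_0_compat.
      match goal with |- is_series _ ?V => replace V with
       (bsum (S r) (fun i => (-1) ^ i * multichoose (S t) i * / (INR m * x) ^ (S t + i) * hurwitz (S (S r)
         - i) 1)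
        + (-1) ^ S (S r) * bsum t (fun j => multichoose (S (S r)) j * / (INR m * x) ^ (S (S r) + j) *
          hurwitz (S t - j) (INR m * x + 1))
        + (-1) ^ S r * multichoose (S (S r)) t * / (INR m * x) ^ (S (S r) + t) * (euler_gamma + digamma
          (INR m * x + 1))); [now apply inner_sum|] end.
      assert (PM : forall a, 0 < INR m ^ a) by (intros; now apply pow_lt).
      assert (PX : forall a, 0 < x ^ a) by (intros; now apply pow_lt).
      set (q := INR m / INR m ^ S t).
      assert (E0 : (-1) ^ 0 * multichoose (S t) 0 * / (INR m * x) ^ (S t + 0) * hurwitz (S (S r) - 0) 1 = /
        x ^ S t * hurwitz (S (S r)) 1 / INR m ^ S t).
      { rewrite Nat.add_0_r, multichoose_0, Rpow_mult_distr, Nat.sub_0_r. change ((-1) ^ 0) with 1.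
        pose proof (PM (S t)). pose proof (PX (S t)).
        generalize dependent (INR m ^ S t). generalize dependent (x ^ S t). intros. field. lra. }
      assert (EA : bsum r (fun i => (-1) ^ S i * multichoose (S t) (S i) * / (INR m * x) ^ (S t + S i) *
        hurwitz (S (S r) - S i) 1) = q * bsum r (fun i => cA i * gA i m)).
      { rewrite <- bsum_scal. apply bsum_ext. intros i Hi. unfold cA, gA, q.
        rewrite Rpow_mult_distr. replace (i + 2)%nat with (S (S i)) by lia.
        replace (S (S r) - S i)%nat with (S r - i)%nat by lia.
        rewrite (pow_add (INR m)). pose proof (PM (S t)). pose proof (PM (S i)). pose proof (PX (S t + S
          i)%nat).
        change (INR m ^ S (S i)) with (INR m * INR m ^ S i).
        generalize dependent (INR m ^ S t). generalize dependent (INR m ^ S i). generalize dependent (x ^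
          (S t + S i)).
        intros. field. lra. }
      assert (EB : (-1) ^ S (S r) * bsum t (fun j => multichoose (S (S r)) j * / (INR m * x) ^ (S (S r) +
        j) * hurwitz (S t - j) (INR m * x + 1)) = q * bsum t (fun j => cB j * gB j m)).
      { rewrite <- !bsum_scal. apply bsum_ext. intros j Hj. unfold cB, gB, q.
        rewrite Rpow_mult_distr. set (k := (t - j - 1)%nat).
        replace (S t - j - 1)%nat with (S k) by (unfold k; lia).
        rewrite polygamma_hurwitz by lra.
        replace (S t - j)%nat with (S (S k)) by (unfold k; lia).
        rewrite (powerRZ_sub (INR m) (S (S r) + j + 1) (S t)) by (auto; lia).
        replace (j + S (S r))%nat with (S (S r) + j)%nat by lia.
        rewrite (pow_add (INR m) (S (S r) + j) 1), pow_1.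
        set (u := (S (S r) + j)%nat). pose proof (PM u). pose proof (PM (S t)). pose proof (PX u).
        pose proof (INR_fact_lt_0 (S k)).
        change ((-1) ^ S (S k)) with (-1 * (-1 * (-1) ^ k)).
        pose proof (pow_m1_sqr k) as E.
        (* The sign of the polygamma function and that of [cB] multiply to ((-1)^k)^2; this factor
           is exposed here and equals 1. *)
        transitivity ((-1) ^ S (S r) * multichoose (S (S r)) j * hurwitz (S (S k)) (INR m * x + 1) * / (INR
          m ^ u * x ^ u) * ((-1) ^ k * (-1) ^ k)).
        - rewrite E. ring.
        - generalize dependent (INR m ^ S t). generalize dependent (INR m ^ u). generalize dependent (x ^ u).
          generalize dependent (INR (fact (S k))). intros. field. lra. }
      assert (EC : (-1) ^ S r * multichoose (S (S r)) t * / (INR m * x) ^ (S (S r) + t) * (euler_gamma +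
        digamma (INR m * x + 1)) = q * (cC * gC m)).
      { unfold cC, gC, q. rewrite Rpow_mult_distr. replace (S (S r) + S t - 1)%nat with (S (S r) + t)%nat
        by lia.
        rewrite (pow_add (INR m)). pose proof (PM (S (S r))). pose proof (PM t). pose proof (PX (S (S r) +
          t)%nat).
        change ((-1) ^ S (S r)) with (-1 * (-1) ^ (S r)). change (INR m ^ S t) with (INR m * INR m ^ t).
        generalize dependent (INR m ^ t). generalize dependent (INR m ^ S (S r)). generalize dependent (x ^
          (S (S r) + t)).
        intros. field. lra. }
      rewrite bsum_shift, E0, EA, EB, EC. unfold g, q. pose proof (PM (S t)).
      pose proof (PX (S t)). generalize dependent (INR m ^ S t). generalize dependent (x ^ S t). intros.
        field. lra.
    + unfold g.
      rewrite (Series1_plus (fun m => bsum r (fun i => cA i * gA i m) + bsum t (fun j => cB j * gB j m))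
        (fun m => cC * gC m)) by (auto; now apply decays_plus).
      rewrite (Series1_plus (fun m => bsum r (fun i => cA i * gA i m)) (fun m => bsum t (fun j => cB j * gB
        j m))) by auto.
      rewrite (Series1_bsum r (fun i m => cA i * gA i m)), (Series1_bsum t (fun j m => cB j * gB j m)) by
        auto.
      rewrite Series1_scal.
      rewrite (bsum_ext r _ (fun i => cA i * hurwitz (i + 2) 1)).
      2: { intros i Hi. rewrite Series1_scal. f_equal. apply is_series_unique, hurwitz_1. lia. }
      rewrite (bsum_ext t _ (fun j => cB j * Series1 (gB j))) by (intros; apply Series1_scal).
      unfold const_r_ge2. cbv zeta. rewrite Hz by lia.
      rewrite (sum_range_bsum 0 (Z.of_nat (S t) - 2) t _ (fun j => (-1) ^ (S (S r)) * (cB j * Series1 (gB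
        j)))); [|lia|].
      2: { intros j Hj. rewrite Nat.add_0_l. f_equal. rewrite binZ_multichoose. fold (gB j). unfold cB.
           rewrite <- !Rmult_assoc, pow_m1_sqr. ring. }
      rewrite (sum_range_bsum 1 (Z.of_nat (S (S r)) - 2) r _ (fun i => cA i * hurwitz (i + 2) 1)); [|lia|].
      2: { intros i Hi. rewrite !Hz by lia. rewrite <- !RtoC_mult. f_equal. unfold cA. rewrite
        binZ_multichoose.
           replace (1 + i)%nat with (S i) by lia. replace (S i + 1)%nat with (i + 2)%nat by lia.
           replace (S (S r) - S i)%nat with (S r - i)%nat by lia. ring. }
      rewrite binZ_multichoose2. rewrite bsum_scal.
      rewrite <- !RtoC_mult, <- !RtoC_plus, <- RtoC_minus. f_equal.
      rewrite <- Rmult_assoc, pow_m1_sqr. unfold cC. fold gC. ring.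
Qed.

(** The approximants at y + 1 are those at y with the index advanced by one, plus 1 / y. *)
Lemma digamma_S y : 0 < y -> digamma (y + 1) = digamma y + / y.
Proof.
  intros Hy.
  assert (E : forall N, digamma_approx (y + 1) N = digamma_approx y (S N) + / y).
  { induction N as [|N IH].
    - simpl. rewrite Rplus_0_r. ring.
    - change (digamma_approx (y + 1) (S N)) with (digamma_approx (y + 1) N + (ln (y + 1 + INR (S N)) - ln
      (y + 1 + INR N) - / (y + 1 + INR N))).
      change (digamma_approx y (S (S N))) with (digamma_approx y (S N) + (ln (y + INR (S (S N))) - ln (y +
        INR (S N)) - / (y + INR (S N)))).
      rewrite IH. rewrite (S_INR (S N)), (S_INR N).
      replace (y + 1 + INR N) with (y + (INR N + 1)) by ring.
      replace (y + 1 + (INR N + 1)) with (y + (INR N + 1 + 1)) by ring. ring. }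
  destruct (digamma_spec y Hy) as [H1 _]. destruct (digamma_spec (y + 1) ltac:(lra)) as [H2 _].
  apply (is_lim_seq_incr_1 (digamma_approx y)) in H1.
  assert (H3 : is_lim_seq (digamma_approx (y + 1)) (digamma y + / y)).
  { apply is_lim_seq_ext with (fun N => digamma_approx y (S N) + / y); [auto|].
    apply is_lim_seq_plus'; auto. apply is_lim_seq_const. }
  apply is_lim_seq_unique in H2. apply is_lim_seq_unique in H3. rewrite H2 in H3. now injection H3.
Qed.

(** Summed downwards, because in [case_r_1] the leading term of the j-th polygamma function
    contributes 1 / (t - j). *)
Lemma harmonic_bsum t : harmonic t = bsum t (fun j => / INR (t - j)).
Proof.
  unfold harmonic. induction t as [|t IH].
  - simpl. rewrite sum_n_m_zero; auto.
  - rewrite bsum_shift, sum_n_Sm by lia. rewrite IH. unfold plus; simpl plus.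
    rewrite Nat.sub_0_r. rewrite Rplus_comm. f_equal.
Qed.

(** With p = S t - j - 1, removing the leading term gains one power: [hurwitz_bounds] and
    [hurwitz_shift] leave O((m x)^-(p+1)). The denominator has exponent 1 - p, so the quotient is
    O(m^-2). *)
Lemma decays_polygamma_diff x t j : 0 < x -> (j < t)%nat ->
  decays (fun m => (polygamma (S t - j - 1) (INR m * x) - (-1) ^ (S t - j) * INR (fact (S t - j - 2)) /
    (INR m * x) ^ (S t - j - 1))
                   / powerRZ (INR m) (Z.of_nat j - Z.of_nat (S t) + 2)).
Proof.
  intros Hx Hj. set (k := (t - j - 1)%nat).
  replace (S t - j - 1)%nat with (S k) by (unfold k; lia). replace (S t - j - 2)%nat with k by (unfold k;
    lia).
  replace (S t - j)%nat with (S (S k)) by (unfold k; lia).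
  apply decays_le_inv_sqr with (INR (fact (S k)) * / x ^ (S (S k))). intros n.
  pose proof (INR_S_pos n) as Hm. set (m := INR (S n)) in *.
  assert (Hy : 0 < m * x) by nra. rewrite polygamma_hurwitz by lra.
  pose proof (hurwitz_bounds (S k) (m * x) Hy ltac:(lia)) as [[B1 B2] B0].
  assert (Hk : 1 <= INR (S k)) by apply INR_S_ge1.
  pose proof (hurwitz_shift (S (S k)) (m * x) Hy ltac:(lia)) as B3.
  rewrite (powerRZ_sub m 0 k) by (auto; unfold k; lia).
  assert (P : forall a, 0 < m ^ a) by (intros; now apply pow_lt).
  assert (Py : forall a, 0 < (m * x) ^ a) by (intros; now apply pow_lt).
  assert (Q : 0 < x ^ S (S k)) by now apply pow_lt.
  set (D := hurwitz (S (S k)) (m * x) - / (INR (S k) * (m * x) ^ S k)).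
  assert (HD : 0 <= D <= / (m * x) ^ S (S k)).
  { unfold D. rewrite Rinv_mult.
    assert (I1 : INR (S k) * (/ INR (S k) * / (m * x) ^ S k) = / (m * x) ^ S k) by (rewrite <- Rmult_assoc,
      Rinv_r by lra; ring).
    set (w := / INR (S k) * / (m * x) ^ S k) in *. split; [nra|].
    assert (hurwitz (S (S k)) (m * x + 1) <= w) by nra. lra. }
  replace (((-1) ^ k * INR (fact (S k)) * hurwitz (S (S k)) (m * x) - (-1) ^ S (S k) * INR (fact k) / (m *
    x) ^ S k) / (m ^ 0 / m ^ k))
    with ((-1) ^ k * (INR (fact (S k)) * m ^ k * D)).
  2: { unfold D. change (m ^ 0) with 1. change ((-1) ^ S (S k)) with (-1 * (-1 * (-1) ^ k)).
       change (fact (S k)) with (S k * fact k)%nat. rewrite mult_INR.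
       pose proof (P k). pose proof (Py (S k)). generalize dependent (m ^ k). generalize dependent ((m * x)
         ^ S k).
       intros. field. lra. }
  rewrite Rabs_mult, <- RPow_abs. replace (Rabs (-1)) with 1 by (rewrite Rabs_left; lra). rewrite pow1,
    Rmult_1_l.
  pose proof (P k) as Hmk.
  pose proof (INR_fact_lt_0 (S k)) as Hf2.
  rewrite Rabs_pos_eq.
  2: { apply Rmult_le_pos; [|lra]. apply Rmult_le_pos; lra. }
  rewrite !Rmult_assoc. apply Rmult_le_compat_l; [lra|].
  apply Rle_trans with (m ^ k * / (m * x) ^ S (S k)); [apply Rmult_le_compat_l; lra|].
  apply Req_le. rewrite Rpow_mult_distr. change (m ^ S (S k)) with (m * (m * m ^ k)).
  generalize dependent (x ^ S (S k)). generalize dependent (m ^ k). intros. simpl. field. lra.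
Qed.

Lemma decays_digamma_ln x : 0 < x -> decays (fun m => (digamma (INR m * x) - ln (INR m * x)) / INR m).
Proof.
  intros Hx. apply decays_le_inv_sqr with (/ x). intros n.
  pose proof (INR_S_pos n) as Hm. set (m := INR (S n)) in *.
  assert (Hy : 0 < m * x) by nra. destruct (digamma_spec (m * x) Hy) as [_ D].
  unfold Rdiv. rewrite Rabs_mult, (Rabs_pos_eq (/ m)) by (left; now apply Rinv_0_lt_compat).
  apply Rle_trans with (/ (m * x) * / m).
  - apply Rmult_le_compat_r; [left; now apply Rinv_0_lt_compat|].
 apply Rabs_le. lra.
  - apply Req_le. simpl. field. lra.
Qed.

(** For r = 1 the digamma and polygamma terms all reach the order of the main term, up to a
    logarithm. Their leading parts are split off: digamma gives ln m + ln x, and the polygamma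
    functions add up to the harmonic number, with a minus sign from the factor (-1)^r of the partial
    fractions. *)
Lemma case_r_1 zeta gamma1 x t : 0 < x -> (1 <= t)%nat -> zeta (RtoC 2) = RtoC (hurwitz 2 1) ->
  exists g, decays g /\
    (forall m, (1 <= m)%nat -> is_series (fun n => / (INR (S n) ^ 1 * (INR (S n) + INR m * x) ^ t))
       ((/ x ^ t * (ln (INR m) + (euler_gamma + ln x - harmonic (t - 1))) + INR m * g m) / INR m ^ t)) /\
    const_r1 zeta gamma1 x t = RtoC (/ x ^ t * (euler_gamma * (euler_gamma + ln x - harmonic (t - 1)) +
      gamma1) + Series1 g).
Proof.
  intros Hx Ht Hz. destruct t as [|t]; [lia|]. replace (S t - 1)%nat with t by lia.
  set (gB := fun (j m : nat) => (polygamma (S t - j - 1) (INR m * x) - (-1) ^ (S t - j) * INR (fact (S t -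
    j - 2)) / (INR m * x) ^ (S t - j - 1))
                   / powerRZ (INR m) (Z.of_nat j - Z.of_nat (S t) + 2)).
  set (cB := fun j : nat => (-1) ^ (S t - j) * / x ^ (j + 1) / INR (fact (S t - j - 1))).
  set (gC := fun m : nat => (digamma (INR m * x) - ln (INR m * x)) / INR m).
  set (gA := fun m : nat => / INR m ^ 2).
  assert (DB : forall j, (j < t)%nat -> decays (fun m => cB j * gB j m)).
  { intros j Hj. apply (decays_scal (cB j) (gB j)). unfold gB. now apply decays_polygamma_diff. }
  assert (DB' : decays (fun m => bsum t (fun j => cB j * gB j m))) by (apply (decays_bsum t (fun j m => cB
    j * gB j m)); auto).
  assert (DA : decays (fun m => INR (S t) / x ^ (S t + 1) * gA m)) by (apply (decays_scal _ gA),
    (decays_inv_pow 2); lia).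
  assert (DC0 : decays gC) by (unfold gC; now apply decays_digamma_ln).
  assert (DC : decays (fun m => / x ^ S t * gC m)) by (apply (decays_scal _ gC); auto).
  set (g := fun m => (-1) * bsum t (fun j => cB j * gB j m) + INR (S t) / x ^ (S t + 1) * gA m + / x ^ S t
    * gC m).
  assert (DB'' : decays (fun m => (-1) * bsum t (fun j => cB j * gB j m))) by (apply (decays_scal (-1) (fun
    m => bsum t (fun j => cB j * gB j m))); auto).
  exists g. split; [|split].
  - unfold g. apply (decays_plus (fun m => (-1) * bsum t (fun j => cB j * gB j m) + INR (S t) / x ^ (S t +
    1) * gA m)); auto.
    apply (decays_plus (fun m => (-1) * bsum t (fun j => cB j * gB j m))); auto.
  - intros m Hm. assert (Hm0 : 0 < INR m) by (apply lt_0_INR; lia).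
    assert (Hy : 0 < INR m * x) by now apply Rmult_lt_0_compat.
    pose proof (inner_sum 0 t (INR m * x) Hy) as HI. simpl (bsum 0 _) in HI.
    match goal with |- is_series _ ?V => match type of HI with is_series _ ?W =>
       replace V with W; [exact HI|] end end.
    assert (PM : forall a, 0 < INR m ^ a) by (intros; now apply pow_lt).
    assert (PX : forall a, 0 < x ^ a) by (intros; now apply pow_lt).
    set (q := INR m / INR m ^ S t).
    (* Each zeta(k + 2, y + 1) with y = m x is a leading term plus a remainder minus y^-(k+2). The
       leading terms sum to the harmonic number, the remainders to the B-part of [g], and the shifts
       give t equal terms of order m^-(t+2). *)
    assert (EB : bsum t (fun j => multichoose 1 j * / (INR m * x) ^ (1 + j) * hurwitz (S t - j) (INR m * x
      + 1))
       = q * bsum t (fun j => cB j * gB j m) + (/ (x ^ S t * INR m ^ S t) * harmonic t + INR t * (- / (INR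
         m * x) ^ (S t + 1)))).
    { rewrite harmonic_bsum, <- (bsum_const t), <- !bsum_scal, <- !bsum_plus. apply bsum_ext. intros j Hj.
      unfold cB, gB, q.
      set (k := (t - j - 1)%nat). replace (t - j)%nat with (S k) by (unfold k; lia).
      replace (S t - j - 1)%nat with (S k) by (unfold k; lia). replace (S t - j - 2)%nat with k by (unfold
        k; lia).
      replace (S t - j)%nat with (S (S k)) by (unfold k; lia).
      rewrite polygamma_hurwitz by auto.
      rewrite (hurwitz_shift (S (S k)) (INR m * x)) by (auto; lia).
      rewrite (powerRZ_sub (INR m) 0 k) by (auto; unfold k; lia).
      simpl multichoose. rewrite binom_n_n.
      replace (S t) with (S j + S k)%nat by (unfold k; lia). replace (j + 1)%nat with (S j) by lia.
      replace (S j + S k + 1)%nat with (S j + S (S k))%nat by lia. replace (1 + j)%nat with (S j) by lia.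
      change (fact (S k)) with (S k * fact k)%nat. rewrite mult_INR.
      rewrite !Rpow_mult_distr, !pow_add. change (INR m ^ 0) with 1.
      change ((-1) ^ S (S k)) with (-1 * (-1 * (-1) ^ k)).
      change (INR m ^ S (S k)) with (INR m * (INR m * INR m ^ k)). change (INR m ^ S k) with (INR m * INR m
        ^ k).
      change (x ^ S (S k)) with (x * (x * x ^ k)). change (x ^ S k) with (x * x ^ k).
      pose proof (PM (S j)) as P1. pose proof (PX (S j)) as P2. pose proof (PM k) as P3. pose proof (PX k)
        as P4.
      pose proof (INR_fact_lt_0 k) as P5. pose proof (INR_S_pos k) as P6. pose proof (pow_m1_sqr k) as E.
      generalize dependent (INR m ^ S j). generalize dependent (x ^ S j). generalize dependent (INR m ^ k).
      generalize dependent (x ^ k). generalize dependent (INR (fact k)). generalize dependent (INR (S k)).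
      generalize dependent (hurwitz (S (S k)) (INR m * x + 1)). generalize dependent ((-1) ^ k).
      intros e E h i Hi f Hf xk Hxk mk Hmk xj Hxj mj Hmj.
      field_simplify; try lra. replace (e ^ 2) with 1 by (rewrite <- E; ring). field. lra. }
    (* The 1 / y of this shift joins the t equal terms; together they are the factor [INR (S t)] in
       front of zeta(2). *)
    rewrite EB. rewrite digamma_S by auto.
    unfold g, gA, gC, q. rewrite ln_mult by lra.
    replace (multichoose 1 t) with 1 by (simpl; now rewrite binom_n_n).
    rewrite !Rpow_mult_distr, !pow_add, !pow_1. simpl ((-1) ^ 0). simpl ((-1) ^ 1). rewrite S_INR.
    change (INR m ^ S t) with (INR m * INR m ^ t). change (x ^ S t) with (x * x ^ t).
    pose proof (PM t) as P1. pose proof (PX t) as P2.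
    simpl (INR m ^ 2).
    generalize dependent (INR m ^ t). generalize dependent (x ^ t).
    generalize (bsum t (fun j => cB j * gB j m)). generalize (harmonic t).
    intros. field. lra.
  - unfold g.
    rewrite (Series1_plus (fun m => (-1) * bsum t (fun j => cB j * gB j m) + INR (S t) / x ^ (S t + 1) * gA
      m) (fun m => / x ^ S t * gC m)); auto.
    2: { apply (decays_plus (fun m => (-1) * bsum t (fun j => cB j * gB j m))); auto. }
    rewrite (Series1_plus (fun m => (-1) * bsum t (fun j => cB j * gB j m))) by auto.
    rewrite !Series1_scal. rewrite (Series1_bsum t (fun j m => cB j * gB j m)) by auto.
    rewrite (bsum_ext t _ (fun j => cB j * Series1 (gB j))) by (intros; apply Series1_scal).
    replace (Series1 gA) with (hurwitz 2 1) by (symmetry; apply is_series_unique, hurwitz_1; lia).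
    unfold const_r1. cbv zeta. rewrite Hz. replace (S t - 1)%nat with t by lia.
    rewrite (sum_range_bsum 0 (Z.of_nat (S t) - 2) t _ (fun j => cB j * Series1 (gB j))); [|lia|].
    2: { intros j Hj. rewrite Nat.add_0_l. reflexivity. }
    fold gC. rewrite <- !RtoC_mult, <- RtoC_minus, <- !RtoC_plus. f_equal. ring.
Qed.

(** * The expansion at the pole *)

Lemma RtoC_is_series (a : nat -> R) l : is_series a l -> Cis_series (fun n => RtoC (a n)) (RtoC l).
Proof.
  intros H. apply Cis_series_eps. intros e He. destruct (is_series_eps a l H e He) as [N HN].
  exists N. intros n Hn. specialize (HN n Hn).
  replace (Csum_n (fun n => RtoC (a n)) n) with (RtoC (sum_n a n)).
  - rewrite <- RtoC_minus, Cmod_R. exact HN.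
  - clear HN Hn. induction n as [|n IH]; [now rewrite sum_O, Csum_n_O|].
    rewrite Csum_n_S, <- IH, sum_Sn, <- RtoC_plus. reflexivity.
Qed.

Lemma zeta_INR zeta k : is_riemann_zeta zeta -> (2 <= k)%nat -> zeta (RtoC (INR k)) = RtoC (hurwitz k 1).
Proof.
  intros [Hz _] Hk. assert (H2 : 1 < INR k) by (rewrite <- INR_1; apply lt_INR; lia).
  apply (Cis_series_unique (fun n => / cpow (INR (S n)) (RtoC (INR k)))%C).
  - apply Hz. exact H2.
  - apply Cis_series_ext with (2 := RtoC_is_series _ _ (hurwitz_1 k Hk)). intros n.
    pose proof (INR_S_pos n). rewrite cpow_INR, RtoC_inv by (auto; apply pow_nonzero; lra). reflexivity.
Qed.

Lemma zeta_hol zeta z : is_riemann_zeta zeta -> z <> RtoC 1 -> Chol zeta z.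
Proof. intros [_ H] Hz. apply ex_filterdiff_Chol. now apply H. Qed.

Definition zeta_deriv (zeta : C -> C) (z : C) : C := epsilon (inhabits (RtoC 0)) (Cderiv zeta z).

Lemma zeta_deriv_correct zeta z : is_riemann_zeta zeta -> z <> RtoC 1 -> Cderiv zeta z (zeta_deriv zeta z).
Proof. intros H Hz. unfold zeta_deriv. apply epsilon_spec. destruct (zeta_hol zeta z H Hz) as [l Hl]. now
  exists l. Qed.

Lemma zeta_deriv_hol zeta z : is_riemann_zeta zeta -> z <> RtoC 1 -> Chol (zeta_deriv zeta) z.
Proof.
  intros H Hz. pose proof (Cmod_minus_gt_0 _ _ Hz) as Hd.
  assert (Hw : forall w, Cmod (w - z) < Cmod (z - 1) -> w <> RtoC 1).
  { intros w Hw ->. rewrite Cmod_minus_sym in Hw. lra. }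
  apply (derivative_hol zeta z (Cmod (z - 1)) (Cmod (z - 1) / 2)); [lra| |].
  - intros w W. now apply zeta_hol, Hw.
  - intros w W. now apply zeta_deriv_correct, Hw.
Qed.

(** Termwise differentiation: [dirichlet_deriv] with constant coefficient 1 and de = 0. *)
Lemma zeta_log_series zeta z : is_riemann_zeta zeta -> 1 < Re z ->
  Cis_series (dirichlet_term (fun m => ln (INR m)) z) (- zeta_deriv zeta z)%C.
Proof.
  intros H Hz.
  assert (HG : forall k : nat, Rabs ((fun _ : nat => 1) (S k)) <= 1 * Rpower (INR (S k)) (- 0)).
  { intros k. rewrite Ropp_0, Rpower_O by apply INR_S_pos. rewrite Rabs_R1. lra. }
  destruct (dirichlet_deriv (fun _ => 1) 1 0 z HG ltac:(lra) ltac:(lra)) as [V [HV HD]].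
  assert (E : forall w, 1 < Re w -> dirichlet (fun _ => 1) w = zeta w).
  { intros w Hw. apply (Cis_series_unique (dirichlet_term (fun _ => 1) w)).
    - apply dirichlet_correct with (B := 1) (de := 0); auto. lra.
    - destruct H as [H _]. apply Cis_series_ext with (2 := H w Hw). intros n. unfold dirichlet_term, Cdiv.
      ring. }
  assert (Hz1 : z <> RtoC 1) by (intros ->; simpl in Hz; lra).
  assert (EV : zeta_deriv zeta z = V).
  { apply (Cderiv_unique zeta z); [now apply zeta_deriv_correct|].
    apply Cderiv_ext_near with (2 := HD).
    apply Cnear_imp with (2 := Cnear_half_plane 1 z Hz). exact E. }
  rewrite EV. replace (- V)%C with ((- (1)) * V)%C by ring.
  apply Cis_series_ext with (2 := Cis_series_scal (- (1))%C _ _ HV). intros n. unfold dirichlet_term, Cdiv.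
  rewrite Rmult_1_l, RtoC_opp. ring.
Qed.

Lemma bigO_1_plus s0 f g : bigO_at s0 1 f -> bigO_at s0 1 g -> bigO_at s0 1 (fun s => f s + g s)%C.
Proof.
  intros [K1 [d1 [H1 H2]]] [K2 [d2 [H3 H4]]]. exists (K1 + K2), (Rmin d1 d2). split; [now apply Rmin_pos|].
  intros s [S1 S2]. pose proof (Rmin_l d1 d2). pose proof (Rmin_r d1 d2).
  eapply Rle_trans; [apply Cmod_triangle|]. specialize (H2 s ltac:(lra)). specialize (H4 s ltac:(lra)). lra.
Qed.

Lemma bigO_1_scal s0 c f : bigO_at s0 1 f -> bigO_at s0 1 (fun s => c * f s)%C.
Proof.
  intros [K1 [d1 [H1 H2]]]. exists (Cmod c * K1), d1. split; auto. intros s Hs.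
  rewrite Cmod_mult, Rmult_assoc. apply Rmult_le_compat_l; [apply Cmod_ge_0|auto].
Qed.

Lemma bigO_ext s0 n f g : Cpunctured s0 (fun s => f s = g s) -> bigO_at s0 n f -> bigO_at s0 n g.
Proof.
  intros [d [Hd H]] [K [d1 [H1 H2]]]. exists K, (Rmin d d1). split; [now apply Rmin_pos|].
  intros s [S1 S2]. pose proof (Rmin_l d d1). pose proof (Rmin_r d d1). rewrite <- H by lra. apply H2. lra.
Qed.

Lemma Cderiv_bigO f z l : Cderiv f z l -> bigO_at z 1 (fun s => f s - f z)%C.
Proof.
  intros H. destruct (Cderiv_bound _ _ _ H 1 ltac:(lra)) as [d [Hd Hb]].
  exists (1 + Cmod l), d. split; auto. intros s [_ Hs]. specialize (Hb s Hs).
  replace (f s - f z)%C with ((f s - f z - l * (s - z)) + l * (s - z))%C by ring.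
  eapply Rle_trans; [apply Cmod_triangle|]. rewrite Cmod_mult. lra.
Qed.

Section Expansion.
Variables (zeta : C -> C) (gamma1 : R).
Hypothesis (Hzeta : is_riemann_zeta zeta) (Hg1 : is_stieltjes1 zeta gamma1).

Lemma zeta_expansion : bigO_at (RtoC 1) 1 (fun z => zeta z - (/ (z - 1) + RtoC euler_gamma))%C.
Proof.
  destruct Hg1 as [K [d [Hd H]]]. exists (Rabs K + Rabs gamma1), (Rmin d 1). split; [apply Rmin_pos; lra|].
  intros z [Z1 Z2]. pose proof (Rmin_l d 1). pose proof (Rmin_r d 1). specialize (H z ltac:(lra)).
  replace (zeta z - (/ (z - 1) + euler_gamma))%C with
    ((zeta z - (/ (z - 1) + euler_gamma - gamma1 * (z - 1))) + (RtoC (- gamma1) * (z - 1)))%C by (rewrite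
      RtoC_opp; ring).
  eapply Rle_trans; [apply Cmod_triangle|]. rewrite Cmod_mult, Cmod_R, Rabs_Ropp.
  set (m := Cmod (z - 1)) in *. pose proof (Rle_abs K). pose proof (Rabs_pos K).
  assert (M1 : m * m <= m) by nra. assert (M2 : 0 <= m * m) by nra.
  assert (K * (m * m) <= Rabs K * m) by (apply Rle_trans with (Rabs K * (m * m)); [apply
    Rmult_le_compat_r|apply Rmult_le_compat_l]; lra).
  simpl in *. rewrite !Rmult_1_r in *. lra.
Qed.

(* Cauchy's estimate on a circle of radius comparable to [|z - 1|] differentiates
   the expansion defining [gamma1]. *)
Lemma zeta_deriv_expansion :
  bigO_at (RtoC 1) 1 (fun z => - zeta_deriv zeta z - (/ ((z - 1) * (z - 1)) + RtoC gamma1))%C.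
Proof.
  (* 18 = 2 (3/2)^2 / (1/4): Cauchy's estimate with radius m / 4 for a function bounded by |K| (3 m
     / 2)^2. Halving d keeps 3 m / 2 below d. *)
  destruct Hg1 as [K [d [Hd H]]]. exists (18 * Rabs K), (d / 2). split; [lra|].
  intros z [Z1 Z2]. set (m := Cmod (z - 1)) in *. pose proof (Rle_abs K). pose proof (Rabs_pos K).
  assert (Hz : z <> RtoC 1) by (intros E; apply Cmod_gt_0 in Z1; apply Z1; rewrite E; ring).
  assert (HB : forall w, Cmod (w - z) < m / 2 -> 0 < Cmod (w - 1) <= 3 / 2 * m).
  { intros w Hw. pose proof (Cmod_triangle (w - z) (z - 1)) as T1.
    replace (w - z + (z - 1))%C with (w - 1)%C in T1 by ring.
    pose proof (Cmod_triangle (z - w) (w - 1)) as T2. replace (z - w + (w - 1))%C with (z - 1)%C in T2 by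
      ring.
    rewrite (Cmod_minus_sym z w) in T2. fold m in T1, T2. lra. }
  assert (HN : forall w, Cmod (w - z) < m / 2 -> w <> RtoC 1).
  { intros w Hw E. destruct (HB w Hw) as [B _]. apply Cmod_gt_0 in B. apply B. rewrite E. ring. }
  assert (HZ0 : (z - 1)%C <> RtoC 0) by now apply Cminus_eq_contra.
  replace (- zeta_deriv zeta z - (/ ((z - 1) * (z - 1)) + gamma1))%C with
    (- (zeta_deriv zeta z - (- / ((z - 1) * (z - 1)) * (1 - 0) + 0 - gamma1 * (1 - 0))))%C by (field; auto).
  rewrite Cmod_opp.
  eapply Rle_trans; [apply (Cauchy_estimate (fun z => zeta z - (/ (z - 1) + euler_gamma - gamma1 * (z -
    1)))%C z (m / 2) (m / 4)) with (M := Rabs K * (3 / 2 * m) ^ 2)|].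
  - lra.
  - intros w Hw. apply Chol_minus; [now apply zeta_hol, HN|].
    assert (L : Chol (fun z => z - 1)%C w) by (apply Chol_minus; [apply Chol_id|apply Chol_const]).
    apply Chol_minus; [apply Chol_plus|].
    + apply Chol_inv; auto. now apply Cminus_eq_contra, HN.
    + apply Chol_const.
    + apply Chol_mult; [apply Chol_const|auto].
  - apply Rmult_le_pos; [auto|]. apply pow_le. lra.
  - intros w Hw. destruct (HB w Hw) as [B1 B2]. eapply Rle_trans; [apply H; lra|].
    apply Rle_trans with (Rabs K * Cmod (w - 1) ^ 2).
    + apply Rmult_le_compat_r; auto. apply pow_le. lra.
    + apply Rmult_le_compat_l; auto. apply pow_incr. lra.
  - assert (L : Cderiv (fun z => z - 1)%C z (1 - 0)) by (apply Cderiv_minus; [apply Cderiv_id|apply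
    Cderiv_const]).
    apply Cderiv_minus; [now apply zeta_deriv_correct|]. apply Cderiv_minus; [apply Cderiv_plus|].
    + apply (Cderiv_comp (fun z => z - 1)%C Cinv); auto. now apply Cderiv_inv.
    + apply Cderiv_const.
    + now apply Cderiv_scal.
  - apply Req_le. simpl. field. lra.
Qed.

Variables (A B : R) (g : nat -> R).
Hypothesis Hg : decays g.

Definition mt_line (z : C) : C :=
  (RtoC A * zeta z + RtoC B * (- zeta_deriv zeta z) + dirichlet (fun m => (INR m * g m)%R) z)%C.

Lemma mt_line_hol z : 1/2 < Re z -> z <> RtoC 1 -> Chol mt_line z.
Proof.
  intros Hz H1. destruct (decays_G g Hg) as [K [HK HG]]. unfold mt_line. apply Chol_plus; [apply Chol_plus|].
  - apply Chol_mult; [apply Chol_const|now apply zeta_hol].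
  - apply Chol_mult; [apply Chol_const|].
    apply Chol_ext_near with (fun z => (- (1)) * zeta_deriv zeta z)%C.
    { exists 1. split; [lra|]. intros; ring. }
    apply Chol_mult; [apply Chol_const|now apply zeta_deriv_hol].
  - destruct (dirichlet_deriv (fun m => INR m * g m) K (1/2) z HG HK ltac:(lra)) as [V [_ HV]]. now exists V.
Qed.

Lemma mt_line_series z : 1 < Re z ->
  Cis_series (dirichlet_term (fun m => A + B * ln (INR m) + INR m * g m) z) (mt_line z).
Proof.
  intros Hz. destruct (decays_G g Hg) as [K [HK HG]]. unfold mt_line.
  destruct Hzeta as [Hs _].
  apply Cis_series_ext with (2 := Cis_series_plus _ _ _ _ (Cis_series_plus _ _ _ _
     (Cis_series_scal (RtoC A) _ _ (Hs z Hz)) (Cis_series_scal (RtoC B) _ _ (zeta_log_series zeta z Hzeta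
       Hz)))
     (dirichlet_correct _ K (1/2) z HG ltac:(lra))).
  intros n. unfold dirichlet_term, Cdiv. rewrite !RtoC_plus, (RtoC_mult B). ring.
Qed.

Lemma dirichlet_at_1 : dirichlet (fun m => INR m * g m) (RtoC 1) = RtoC (Series1 g).
Proof.
  destruct (decays_G g Hg) as [K [HK HG]].
  apply (Cis_series_unique (dirichlet_term (fun m => INR m * g m) (RtoC 1))).
  - apply dirichlet_correct with (B := K) (de := 1/2); auto. simpl. lra.
  - apply Cis_series_ext with (2 := RtoC_is_series _ _ (Series_correct _ (decays_ex_series g Hg))).
    intros n. unfold dirichlet_term. pose proof (INR_S_pos n). rewrite cpow_RtoC, Rpower_1 by auto.
    rewrite <- RtoC_div by lra. f_equal. field. lra.
Qed.

(** Since - zeta' has no simple pole at 1, the coefficient B feeds only the double pole and, through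
    [gamma1], the constant; the simple pole comes from A alone. *)
Lemma mt_line_expansion : bigO_at (RtoC 1) 1 (fun z => mt_line z -
  (RtoC B / ((z - 1) * (z - 1)) + RtoC A / (z - 1) + RtoC (A * euler_gamma + B * gamma1 + Series1 g)%R))%C.
Proof.
  destruct (decays_G g Hg) as [K [HK HG]].
  destruct (dirichlet_deriv (fun m => INR m * g m) K (1/2) (RtoC 1) HG HK ltac:(simpl; lra)) as [V [_ HV]].
  eapply bigO_ext; [|apply (bigO_1_plus _ _ _ (bigO_1_plus _ _ _ (bigO_1_scal _ (RtoC A) _ zeta_expansion)
     (bigO_1_scal _ (RtoC B) _ zeta_deriv_expansion)) (Cderiv_bigO _ _ _ HV))].
  exists 1. split; [lra|]. intros z _. cbv beta. unfold mt_line. rewrite dirichlet_at_1, !RtoC_plus,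
    !RtoC_mult.
  unfold Cdiv. ring.
Qed.

End Expansion.

(** [is_mordell_tornheim_sum] has the sum over m inside, [F] the sum over n. The order may be
    exchanged because (n + m x)^t >= n^t and r + t >= 2 bound the terms by n^-2 m^-2. *)
Lemma mordell_tornheim_columns (x : R) (r t : nat) (s L : C) (F : nat -> R) :
  0 < x -> (1 <= r)%nat -> (2 <= r + t)%nat -> 2 <= Re s ->
  is_mordell_tornheim_sum (RtoC (INR r)) s (RtoC (INR t)) x L ->
  (forall m, (1 <= m)%nat -> is_series (fun n => / (INR (S n) ^ r * (INR (S n) + INR m * x) ^ t)) (F m)) ->
  Cis_series (fun m => / cpow (INR (S m)) s * RtoC (F (S m)))%C L.
Proof.
  intros Hx Hr Hrt Hs [a [Ha HL]] HF.
  assert (Et : forall n m, mordell_tornheim_term (RtoC (INR r)) s (RtoC (INR t)) x (S n) (S m) =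
    (/ cpow (INR (S m)) s * RtoC (/ (INR (S n) ^ r * (INR (S n) + INR (S m) * x) ^ t)))%C).
  { intros n m. unfold mordell_tornheim_term. pose proof (INR_S_pos n). pose proof (INR_S_pos m).
    assert (0 < INR (S n) + INR (S m) * x) by nra.
    rewrite !cpow_INR by auto. pose proof (cpow_neq_0 (INR (S m)) s) as N.
    assert (N1 : RtoC (INR (S n) ^ r) <> RtoC 0) by (intros E; apply RtoC_inj in E; revert E; apply
      pow_nonzero; lra).
    assert (N2 : RtoC ((INR (S n) + INR (S m) * x) ^ t) <> RtoC 0) by (intros E; apply RtoC_inj in E;
      revert E; apply pow_nonzero; lra).
    rewrite RtoC_inv, RtoC_mult.
    - field. auto.
    - apply Rmult_integral_contrapositive. split; apply pow_nonzero; lra. }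
  apply (Fubini_series (fun n m => mordell_tornheim_term (RtoC (INR r)) s (RtoC (INR t)) x (S n) (S m))
    (fun n => / (INR (S n) * INR (S n))) (fun m => / (INR (S m) * INR (S m))) a); auto.
  - intros n m. rewrite Et, Cmod_mult, Cmod_R, Rmult_comm.
    pose proof (INR_S_ge1 n) as Hn. pose proof (INR_S_ge1 m) as Hm.
    assert (Hy : INR (S n) <= INR (S n) + INR (S m) * x) by nra.
    assert (P1 : 0 < INR (S n) ^ r) by (apply pow_lt; lra).
    assert (P2 : 0 < (INR (S n) + INR (S m) * x) ^ t) by (apply pow_lt; lra).
    apply Rmult_le_compat; [apply Rabs_pos|apply Cmod_ge_0| |].
    + rewrite Rabs_pos_eq by (left; apply Rinv_0_lt_compat; nra).
      apply Rinv_le_contravar; [nra|].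
      apply Rle_trans with (INR (S n) ^ r * INR (S n) ^ t).
      * rewrite <- pow_add. replace (INR (S n) * INR (S n)) with (INR (S n) ^ 2) by ring. apply Rle_pow; auto.
      * apply Rmult_le_compat_l; [lra|]. apply pow_incr. lra.
    + rewrite Cmod_inv, Cmod_cpow by apply cpow_neq_0.
      apply Rinv_le_contravar; [nra|]. replace (INR (S m) * INR (S m)) with (Rpower (INR (S m)) (INR 2)).
      * apply Rpower_le_exp; auto.
      * rewrite Rpower_pow by lra. ring.
  - intros n. left. apply Rinv_0_lt_compat. pose proof (INR_S_pos n). nra.
  - apply ex_series_inv_sqr.
  - apply ex_series_inv_sqr.
  - intros m. apply Cis_series_ext with (fun n => / cpow (INR (S m)) s * RtoC (/ (INR (S n) ^ r * (INR (S
    n) + INR (S m) * x) ^ t)))%C.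
    + intros n. now rewrite Et.
    + apply Cis_series_scal. apply RtoC_is_series. apply HF. lia.
Qed.

(** If k extended theta holomorphically, q theta = q k would tend to q(s0) k(s0) = 0 instead of L;
    two errors below |L| / 3 give the contradiction. *)
Lemma singular_of_limit theta q (s0 L : C) : Ccont q s0 -> q s0 = RtoC 0 -> L <> RtoC 0 ->
  (forall e, 0 < e -> Cpunctured s0 (fun s => Cmod (q s * theta s - L) < e)) -> singular_point theta s0.
Proof.
  intros Hq Hq0 HL H [U [k [HU [HUs [Hk Hth]]]]].
  assert (Ck : Ccont k s0) by (apply Chol_cont, ex_filterdiff_Chol, Hk; auto).
  pose proof (locally_Cnear _ _ (HU _ HUs)) as HUn.
  apply Cmod_gt_0 in HL. set (e := Cmod L / 3). assert (He : 0 < e) by (unfold e; lra).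
  pose proof (Ccont_mult q k s0 Hq Ck e He) as H1.
  assert (H2 : Cpunctured s0 (fun s => s <> s0)).
  { exists 1. split; [lra|]. intros w [W _] ->. apply Cmod_gt_0 in W. apply W. ring. }
  destruct (Cpunctured_witness _ _ (Cpunctured_and _ _ _ H2 (Cpunctured_and _ _ _ (H e He)
     (Cnear_punctured _ _ (Cnear_and _ _ _ H1 HUn))))) as [s [S1 [S2 [S3 S4]]]].
  rewrite Hth in S2 by auto. rewrite Hq0 in S3.
  assert (Cmod L <= Cmod (q s * k s - 0 * k s0) + Cmod (q s * k s - L)).
  { rewrite (Cmod_minus_sym (q s * k s) L).
    replace L with ((q s * k s - 0 * k s0) + (L - q s * k s))%C at 1 by ring. apply Cmod_triangle. }
  unfold e in *. lra.
Qed.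

(** [singular_of_limit] with q = (s - s0)^2 and limit B or, if B = 0, with q = s - s0 and limit
    A. *)
Lemma singular_of_expansion theta (s0 : C) (A B : R) (c : C) :
  bigO_at s0 1 (fun s => theta s - (RtoC B / ((s - s0) * (s - s0)) + RtoC A / (s - s0) + c))%C ->
  (B <> 0 \/ (B = 0 /\ A <> 0)) -> singular_point theta s0.
Proof.
  intros [K [d [Hd H]]] HAB.
  assert (CL : Ccont (fun s => s - s0)%C s0).
  { apply Chol_cont, Chol_minus; [apply Chol_id|apply Chol_const]. }
  assert (E0 : (s0 - s0)%C = RtoC 0) by ring.
  (* For |s - s0| <= 1 this bounds the cofactor of s - s0 in q theta minus its limit, in both
     cases. *)
  set (R0 := Rabs A + Cmod c + Rabs K).
  assert (HR0 : 0 <= R0) by (unfold R0; pose proof (Rabs_pos A); pose proof (Rabs_pos K); pose proof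
    (Cmod_ge_0 c); lra).
  assert (Hsm : forall e, 0 < e -> exists d', 0 < d' /\ d' <= d /\ d' <= 1 /\ d' * (R0 + 1) <= e).
  { intros e He. exists (Rmin d (Rmin 1 (e / (R0 + 1)))).
    assert (0 < e / (R0 + 1)) by (apply Rdiv_lt_0_compat; lra).
    pose proof (Rmin_l d (Rmin 1 (e / (R0 + 1)))). pose proof (Rmin_r d (Rmin 1 (e / (R0 + 1)))).
    pose proof (Rmin_l 1 (e / (R0 + 1))). pose proof (Rmin_r 1 (e / (R0 + 1))).
    repeat split; try lra; [repeat apply Rmin_pos; lra|].
    replace e with (e / (R0 + 1) * (R0 + 1)) at 2 by (field; lra). apply Rmult_le_compat_r; lra. }
  assert (HK : forall m, 0 < m -> m <= 1 -> K * m ^ 1 <= Rabs K).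
  { intros m M1 M2. simpl. pose proof (Rle_abs K). pose proof (Rabs_pos K). nra. }
  destruct HAB as [HB|[HB HA]].
  - apply (singular_of_limit theta (fun s => (s - s0) * (s - s0))%C s0 (RtoC B)).
    + now apply Ccont_mult.
    + rewrite E0. ring.
    + intros E. now apply RtoC_inj in E.
    + intros e He. destruct (Hsm e He) as [d' [D1 [D2 [D3 D4]]]]. exists d'. split; auto. intros s [S1 S2].
      specialize (H s ltac:(lra)). set (m := Cmod (s - s0)) in *. specialize (HK m S1 ltac:(lra)).
      assert (N : (s - s0)%C <> RtoC 0) by now apply Cmod_gt_0.
      set (Q := (theta s - (B / ((s - s0) * (s - s0)) + A / (s - s0) + c))%C) in *.
      replace ((s - s0) * (s - s0) * theta s - B)%C with ((s - s0) * (RtoC A + (s - s0) * (c + Q)))%C by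
        (unfold Q; field; auto).
      rewrite Cmod_mult. fold m.
      assert (T : Cmod (A + (s - s0) * (c + Q)) <= R0).
      { eapply Rle_trans; [apply Cmod_triangle|]. rewrite Cmod_R, Cmod_mult. fold m.
        pose proof (Cmod_triangle c Q). pose proof (Cmod_ge_0 (c + Q)). unfold R0. nra. }
 nra.
  - subst B. apply (singular_of_limit theta (fun s => (s - s0))%C s0 (RtoC A)); auto.
    + intros E. now apply RtoC_inj in E.
    + intros e He. destruct (Hsm e He) as [d' [D1 [D2 [D3 D4]]]]. exists d'. split; auto. intros s [S1 S2].
      specialize (H s ltac:(lra)). set (m := Cmod (s - s0)) in *. specialize (HK m S1 ltac:(lra)).
      assert (N : (s - s0)%C <> RtoC 0) by now apply Cmod_gt_0.
      set (Q := (theta s - (0 / ((s - s0) * (s - s0)) + A / (s - s0) + c))%C) in *.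
      replace ((s - s0) * theta s - A)%C with ((s - s0) * (c + Q))%C by (unfold Q; field; auto).
      rewrite Cmod_mult. fold m.
      assert (T : Cmod (c + Q) <= R0).
      { eapply Rle_trans; [apply Cmod_triangle|]. unfold R0. pose proof (Rabs_pos A). lra. }
 nra.
Qed.

Lemma mordell_tornheim_expansion zeta gamma1 x Theta (r t : nat) theta (A B : R) (g : nat -> R) :
  is_riemann_zeta zeta -> is_stieltjes1 zeta gamma1 -> 0 < x -> is_mordell_tornheim_zeta x Theta ->
  (1 <= r)%nat -> (2 <= r + t)%nat ->
  is_restriction Theta (RtoC (INR r)) (RtoC (INR t)) theta ->
  decays g ->
  (forall m, (1 <= m)%nat -> is_series (fun n => / (INR (S n) ^ r * (INR (S n) + INR m * x) ^ t))
     ((A + B * ln (INR m) + INR m * g m) / INR m ^ t)) ->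
  bigO_at (RtoC (1 - INR t)%R) 1 (fun s => theta s -
    (RtoC B / ((s - RtoC (1 - INR t)%R) * (s - RtoC (1 - INR t)%R)) + RtoC A / (s - RtoC (1 - INR t)%R)
     + RtoC (A * euler_gamma + B * gamma1 + Series1 g)%R))%C.
Proof.
  intros Hz Hg1 Hx [_ HT] Hr Hrt Hres Hg HF. set (s0 := 1 - INR t).
  pose proof (is_restriction_mero _ _ _ _ Hres) as Hm. pose proof (pos_INR t) as Ht0.
  set (E := fun s => mt_line zeta A B g (s + RtoC (INR t))%C).
  assert (Hsh : forall s, (s + RtoC (INR t) - 1 = s - RtoC s0)%C) by (intros s; unfold s0; rewrite
    RtoC_minus; ring).
  assert (HP : Cpunctured (RtoC s0) (fun s => theta s = E s)).
  (* Re s > 1/2 - t is the half-plane of [mt_line_hol] in z = s + t; for Re s > 2 the double series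
     converges and [mordell_tornheim_columns] applies. *)
  { apply continuation with (a := 1/2 - INR t) (K := 2).
    - unfold s0. lra.
    - intros s. apply Hm.
    - intros s Hs Hne. apply (Chol_comp (fun s => s + RtoC (INR t))%C (mt_line zeta A B g)).
      + apply Chol_plus; [apply Chol_id|apply Chol_const].
      + apply mt_line_hol; auto.
        * rewrite re_plus, re_RtoC. lra.
        * intros Eq. apply Hne. apply Ceq_minus. rewrite <- Hsh, Eq. ring.
    - intros s Hs. destruct (Hm s) as [_ HmT].
      apply Cpunctured_imp with (2 := Cpunctured_and _ _ _ HmT (Cnear_punctured _ _ (Cnear_half_plane 2 s
        Hs))).
      intros w [-> Hw].
      assert (Hrt' : 2 <= INR r + INR t) by (rewrite <- plus_INR; change 2 with (INR 2); apply le_INR; lia).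
      assert (HS : is_mordell_tornheim_sum (RtoC (INR r)) w (RtoC (INR t)) x (Theta (RtoC (INR r), w, RtoC
        (INR t)))).
      { apply HT; rewrite ?re_plus, ?re_RtoC; lra. }
      pose proof (mordell_tornheim_columns x r t w _ _ Hx Hr Hrt ltac:(lra) HS HF) as HC.
      apply (Cis_series_unique _ _ _ HC). unfold E.
      apply Cis_series_ext with (2 := mt_line_series zeta Hz A B g Hg (w + RtoC (INR t))%C ltac:(rewrite
        re_plus, re_RtoC; lra)).
      intros n. pose proof (INR_S_pos n). unfold dirichlet_term. rewrite cpow_plus, cpow_INR by auto.
      pose proof (cpow_neq_0 (INR (S n)) w).
      assert (INR (S n) ^ t <> 0) by (apply pow_nonzero; lra).
      assert (RtoC (INR (S n) ^ t) <> RtoC 0) by (intros Eq; now apply RtoC_inj in Eq).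
      rewrite RtoC_div by auto. field. auto. }
  destruct (mt_line_expansion zeta gamma1 Hz Hg1 A B g Hg) as [K [d [Hd HB]]].
  apply (bigO_ext _ _ (fun s => E s - (RtoC B / ((s - RtoC s0) * (s - RtoC s0)) + RtoC A / (s - RtoC s0)
     + RtoC (A * euler_gamma + B * gamma1 + Series1 g)%R))%C).
  - apply Cpunctured_imp with (2 := HP). intros s ->. reflexivity.
  - exists K, d. split; auto. intros s Hs. specialize (HB (s + RtoC (INR t))%C). rewrite Hsh in HB. apply
    HB. exact Hs.
Qed.

Theorem theorem4p4
    (zeta : C -> C) (Hzeta : is_riemann_zeta zeta)
    (gamma1 : R) (Hgamma1 : is_stieltjes1 zeta gamma1)
    (x : R) (Hx : 0 < x)
    (Theta : C3 -> C) (HTheta : is_mordell_tornheim_zeta x Theta) :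
  (forall (r t : nat) (theta : C -> C),
     (2 <= r)%nat ->
     is_restriction Theta (RtoC (INR r)%R) (RtoC (INR t)%R) theta ->
     let s0 := RtoC (1 - INR t)%R in
     singular_point theta s0 /\
     bigO_at s0 1 (fun s =>
       theta s
       - (RtoC (/ x ^ t)%R * zeta (RtoC (INR r)%R) / (s - s0)
          + const_r_ge2 zeta x r t))%C)
  /\
  (forall (t : nat) (theta : C -> C),
     (1 <= t)%nat ->
     is_restriction Theta (RtoC 1) (RtoC (INR t)%R) theta ->
     let s0 := RtoC (1 - INR t)%R in
     singular_point theta s0 /\
     bigO_at s0 1 (fun s =>
       theta s
       - (RtoC (/ x ^ t)%R / ((s - s0) * (s - s0))
          + RtoC (/ x ^ t * (euler_gamma + ln x - harmonic (t - 1)))%R / (s - s0)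
          + const_r1 zeta gamma1 x t))%C).
Proof.
  assert (Px : forall t, 0 < / x ^ t) by (intros; now apply Rinv_0_lt_compat, pow_lt).
  assert (Hzk : forall k, (2 <= k)%nat -> zeta (RtoC (INR k)) = RtoC (hurwitz k 1)) by (intros; now apply
    zeta_INR).
  split.
  - intros r t theta Hr Hres s0.
    destruct (case_r_ge2 zeta x r t Hx Hr Hzk) as [g [Hg [HF HC]]].
    pose proof (mordell_tornheim_expansion zeta gamma1 x Theta r t theta (/ x ^ t * hurwitz r 1) 0 g
      Hzeta Hgamma1 Hx HTheta ltac:(lia) ltac:(lia) Hres Hg) as HE.
    specialize (HE ltac:(intros m Hm; rewrite Rmult_0_l, Rplus_0_r; auto)). fold s0 in HE. split.
    + apply singular_of_expansion with (1 := HE). right. split; auto. apply Rgt_not_eq, Rmult_lt_0_compat;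
      auto.
      (* The residue is nonzero because (r - 1) zeta(r) >= 1. *)
      pose proof (hurwitz_bounds (r - 1) 1 ltac:(lra) ltac:(lia)) as [_ H].
      replace (S (r - 1)) with r in H by lia. rewrite pow1, Rinv_1 in H.
      assert (0 < INR (r - 1)) by (apply lt_0_INR; lia). nra.
    + apply bigO_ext with (2 := HE). exists 1. split; [lra|]. intros s _.
      rewrite HC, Hzk, <- RtoC_mult by auto.
      replace (/ x ^ t * hurwitz r 1 * euler_gamma + 0 * gamma1 + Series1 g) with (euler_gamma * hurwitz r
        1 * / x ^ t + Series1 g) by ring.
      unfold Cdiv. ring.
  - intros t theta Ht Hres s0.
    assert (Hz2 : zeta (RtoC 2) = RtoC (hurwitz 2 1)) by (rewrite <- Hzk by lia; do 2 f_equal; simpl; ring).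
    destruct (case_r_1 zeta gamma1 x t Hx Ht Hz2) as [g [Hg [HF HC]]].
    pose proof (mordell_tornheim_expansion zeta gamma1 x Theta 1 t theta (/ x ^ t * (euler_gamma + ln x -
      harmonic (t - 1))) (/ x ^ t) g
      Hzeta Hgamma1 Hx HTheta ltac:(lia) ltac:(lia) Hres Hg) as HE.
    assert (HF' : forall m, (1 <= m)%nat -> is_series (fun n => / (INR (S n) ^ 1 * (INR (S n) + INR m * x)
      ^ t))
      ((/ x ^ t * (euler_gamma + ln x - harmonic (t - 1)) + / x ^ t * ln (INR m) + INR m * g m) / INR m ^ t)).
    { intros m Hm. replace (/ x ^ t * (euler_gamma + ln x - harmonic (t - 1)) + / x ^ t * ln (INR m))
        with (/ x ^ t * (ln (INR m) + (euler_gamma + ln x - harmonic (t - 1)))) by ring. auto. }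
    specialize (HE HF'). fold s0 in HE. split.
    + apply singular_of_expansion with (1 := HE). left. apply Rgt_not_eq, Px.
    + apply bigO_ext with (2 := HE). exists 1. split; [lra|]. intros s _. rewrite HC.
      replace (/ x ^ t * (euler_gamma + ln x - harmonic (t - 1)) * euler_gamma + / x ^ t * gamma1 + Series1 g)
        with (/ x ^ t * (euler_gamma * (euler_gamma + ln x - harmonic (t - 1)) + gamma1) + Series1 g) by ring.
      reflexivity.
Qed.
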